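(* Let $M\subset\mathbb{R}^{p,q}$ be an indecomposable extrinsic symmetric space, let $h$ be its mean curvature vector, $A$ its shape operator, and let $\mathfrak{g}$ be the Lie algebra of the full weak extrinsic symmetric triple associated with $M$. Then ${A_h}^2\neq 0$ if and only if $\mathfrak{g}$ is semisimple.
   Context: Extrinsic symmetric spaces. A (connected) non-degenerate submanifold $M$ of the pseudo-Euclidean space $\mathbb{R}^{p,q}$ is called extrinsic symmetric if for each $x\in M$ the reflection $s_x:\mathbb{R}^{p,q}\to\mathbb{R}^{p,q}$ at the affine normal space of $M$ at $x$ maps $M$ to $M$. It is called indecomposable if the embedding $M\subset\mathbb{R}^{p,q}$ does not decompose as a non-trivial direct product of embeddings $M_i\subset\mathbb{R}^{p_i,q_i}$, $i=1,2$, with $M=M_1\times M_2$, $p=p_1+p_2$, $q=q_1+q_2$ (non-trivial: $p_i+q_i>0$ for $i=1,2$). Fullness of $M$ in $\mathbb{R}^{p,q}$ is not assumed. Let $n=\dim M\ge 1$, let $\alpha$ be the second fundamental form and $A$ the shape operator of $M$, i.e. $\langle A_\eta u,v\rangle=\langle\alpha(u,v),\eta\rangle$. The mean curvature vector is $h=\frac1n\operatorname{tr}\alpha$, i.e. $h(x)=\frac1n\sum_{j=1}^n\kappa_j\,\alpha(e_j,e_j)$ for an orthonormal basis $e_1,\dots,e_n$ of $T_xM$, $\kappa_j=\langle e_j,e_j\rangle=\pm1$. The vector field $h$ is parallel, so conditions on $A_h$ can be read at any single point of $M$. Weak extrinsic symmetric triples. A weak extrinsic symmetric triple $(\mathfrak{g},\Phi,\langle\cdot,\cdot\rangle)$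 consists of a finite-dimensional real Lie algebra $\mathfrak{g}$ with an $\operatorname{ad}(\mathfrak{g})$-invariant symmetric bilinear form $\langle\cdot,\cdot\rangle$ (''inner product'') and a pair $\Phi=(D,\theta)$, where $\theta$ is an isometric involutive automorphism of $\mathfrak{g}$ and $D$ is an antisymmetric derivation of $\mathfrak{g}$ with $D\theta=-\theta D$ and $D^3=-D$. Put $\tau=\exp(\pi D)$, a further involution. Let $\mathfrak{g}_\pm$ be the $\pm1$-eigenspaces of $\theta$, $\mathfrak{g}^\pm$ the $\pm1$-eigenspaces of $\tau$, and $\mathfrak{g}_+^+=\mathfrak{g}_+\cap\mathfrak{g}^+$, $\mathfrak{g}_-^+=\mathfrak{g}_-\cap\mathfrak{g}^+$, $\mathfrak{g}_+^-=\mathfrak{g}_+\cap\mathfrak{g}^-$, $\mathfrak{g}_-^-=\mathfrak{g}_-\cap\mathfrak{g}^-$. It is required that $\mathfrak{g}_+^+=[\mathfrak{g}_+^-,\mathfrak{g}_+^-]$ and that $\langle\cdot,\cdot\rangle$ is non-degenerate except that it may be degenerate on $\mathfrak{g}_-^+$ (i.e. its radical is contained in $\mathfrak{g}_-^+$). The triple is full if $\mathfrak{g}_-^+=[\mathfrak{g}_+^-,\mathfrak{g}_-^-]$. Correspondence. Let $V$ be the (possibly degenerate) smallest affine subspace of $\mathbb{R}^{p,q}$ containing $M$; choose a base point $x_0\in M$ as origin, so that $V$ is a vector space with a possibly degenerate inner product. It is known that there is a one-to-one correspondence (up to isomorphism) between full extrinsic symmetric spaces in possibly degenerate ambient spaces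 and full weak extrinsic symmetric triples. The triple associated with $M$ is the one corresponding to $M\subset V$. It is characterised by: $V=\mathfrak{g}_-$ (as vector spaces with inner product), $x_0=0$, and $M$ is the orbit of $0$ under the group $\langle\exp(\phi(X))\mid X\in\mathfrak{g}_+\rangle\subset\operatorname{Iso}(\mathfrak{g}_-)$, where $\phi:\mathfrak{g}_+\to\mathfrak{so}(\mathfrak{g}_-)\ltimes\mathfrak{g}_-$, $\phi(X)=(\operatorname{ad}(X)|_{\mathfrak{g}_-},-D(X))$ (linear part, translation part). Under this identification $T_{x_0}M=\mathfrak{g}_-^-$, the normal space of $M$ in $V$ at $x_0$ is $\mathfrak{g}_-^+$, $h\in\mathfrak{g}_-^+$, and $\alpha(u,v)=[Du,v]$, $A_\eta u=-[Du,\eta]$ for $u,v\in\mathfrak{g}_-^-$, $\eta\in\mathfrak{g}_-^+$. *)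

(* Defs.v *)
From HB Require Import structures.
From mathcomp Require Import all_boot all_order all_algebra.
From mathcomp Require Import sesquilinear.
From mathcomp Require Import all_classical all_reals all_analysis.
Set Implicit Arguments.
Unset Strict Implicit.
Unset Printing Implicit Defensive.
Import Order.TTheory GRing.Theory Num.Theory.
Import numFieldNormedType.Exports.
Import VectorInternalTheory.
Local Open Scope classical_set_scope.
Local Open Scope ring_scope.

(* The underlying vector space of R^{p,q} is 'rV[R]_(p + q): the first p
   coordinates contribute positively, the last q negatively. *)
Definition pseudo_inner (R : realType) (p q : nat) (x y : 'rV[R]_(p + q)) : R :=
  \sum_(i < p) x 0 (lshift q i) * y 0 (lshift q i)
  - \sum_(j < q) x 0 (rshift p j) * y 0 (rshift p j).

(* C^k on the open set U, for finite-dimensional V; the values of f outside U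
   are irrelevant. *)
Fixpoint Ck_on (R : realType) (V W : normedModType R) (k : nat) (U : set V)
    (f : V -> W) {struct k} : Prop :=
  if k is k'.+1 then
    (forall x, U x -> differentiable f x) /\
    (forall v : V, Ck_on k' U ('D_v f))
  else forall x, U x -> {for x, continuous f}.

Definition smooth_on (R : realType) (V W : normedModType R) (U : set V)
    (f : V -> W) : Prop := forall k, Ck_on k U f.

(* Embedded smooth submanifolds, by slice charts: near each of its points, M
   is carried by a diffeomorphism f (with inverse f') between open sets of R^N
   to an n-dimensional linear subspace L. *)
Definition submanifold (R : realType) (N n : nat) (M : set 'rV[R]_N) : Prop :=
  forall x, M x ->
  exists (U U' : set 'rV[R]_N) (f f' : 'rV[R]_N -> 'rV[R]_N)
         (L : {vspace 'rV[R]_N}),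
    [/\ open U, open U' & U x] /\
    [/\ smooth_on U f, smooth_on U' f',
        forall y, U y -> U' (f y) /\ f' (f y) = y &
        forall z, U' z -> U (f' z) /\ f (f' z) = z] /\
    \dim L = n /\ (forall y, U y -> (M y <-> f y \in L)).

Definition tangent (R : realType) (N : nat) (M : set 'rV[R]_N)
    (x v : 'rV[R]_N) : Prop :=
  exists (I : set R^o) (c : R^o -> 'rV[R]_N),
    [/\ open I, I 0 & smooth_on I c] /\
    [/\ forall t, I t -> M (c t), c 0 = x & c^`()%classic 0 = v].

Definition normal (R : realType) (p q : nat) (M : set 'rV[R]_(p + q))
    (x w : 'rV[R]_(p + q)) : Prop :=
  forall v, tangent M x v -> pseudo_inner w v = 0.

Definition nondegenerate_submanifold (R : realType) (p q n : nat)
    (M : set 'rV[R]_(p + q)) : Prop :=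
  submanifold n M /\
  (forall x u, M x -> tangent M x u -> normal M x u -> u = 0).

(* s is the reflection at the affine normal space of M at x. As T_xM is
   non-degenerate, every point is of the form x + t + w as below, in a unique
   way, so that s is determined. *)
Definition normal_reflection (R : realType) (p q : nat)
    (M : set 'rV[R]_(p + q)) (x : 'rV[R]_(p + q))
    (s : 'rV[R]_(p + q) -> 'rV[R]_(p + q)) : Prop :=
  forall t w, tangent M x t -> normal M x w -> s (x + t + w) = x - t + w.

Definition extrinsic_symmetric (R : realType) (p q n : nat)
    (M : set 'rV[R]_(p + q)) : Prop :=
  [/\ connected M,
      nondegenerate_submanifold n M &
      forall x, M x -> exists2 s, normal_reflection M x s & s @` M `<=` M].

(* The linear map (x1, x2) |-> x1 *m P1 + x2 *m P2 is an isometry from the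
   orthogonal sum of R^{p1,q1} and R^{p2,q2} onto R^{p,q}; translations are
   absorbed by M1 and M2. The factors may be points. *)
Definition decomposable (R : realType) (p q : nat) (M : set 'rV[R]_(p + q)) :
    Prop :=
  exists (p1 q1 p2 q2 n1 n2 : nat)
         (P1 : 'M[R]_(p1 + q1, p + q)) (P2 : 'M[R]_(p2 + q2, p + q))
         (M1 : set 'rV[R]_(p1 + q1)) (M2 : set 'rV[R]_(p2 + q2)),
    [/\ (p1 + p2 = p)%N, (q1 + q2 = q)%N, (0 < p1 + q1)%N & (0 < p2 + q2)%N] /\
    (forall x1 y1 x2 y2,
      pseudo_inner (x1 *m P1 + x2 *m P2) (y1 *m P1 + y2 *m P2) =
      pseudo_inner x1 y1 + pseudo_inner x2 y2) /\
    [/\ nondegenerate_submanifold n1 M1, nondegenerate_submanifold n2 M2 &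
        M = [set z | exists x1 x2, [/\ M1 x1, M2 x2 & z = x1 *m P1 + x2 *m P2]]].

Definition indecomposable (R : realType) (p q : nat) (M : set 'rV[R]_(p + q)) :
    Prop := ~ decomposable M.

(* Gauss formula: alpha(u, Y x) is the normal component of the derivative
   of Y in direction u, for every smooth local vector field Y tangent to M. *)
Definition second_fundamental_form (R : realType) (p q : nat)
    (M : set 'rV[R]_(p + q))
    (alpha : 'rV[R]_(p + q) -> 'rV[R]_(p + q) -> 'rV[R]_(p + q) ->
             'rV[R]_(p + q)) : Prop :=
  forall (x u : 'rV[R]_(p + q)) (U : set 'rV[R]_(p + q))
         (Y : 'rV[R]_(p + q) -> 'rV[R]_(p + q)),
    M x -> tangent M x u -> open U -> U x -> smooth_on U Y ->
    (forall y, U y -> M y -> tangent M y (Y y)) ->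
    normal M x (alpha x u (Y x)) /\ tangent M x ('D_u Y x - alpha x u (Y x)).

Definition shape_operator (R : realType) (p q : nat)
    (M : set 'rV[R]_(p + q))
    (alpha A : 'rV[R]_(p + q) -> 'rV[R]_(p + q) -> 'rV[R]_(p + q) ->
               'rV[R]_(p + q)) : Prop :=
  forall x eta u, M x -> normal M x eta -> tangent M x u ->
    tangent M x (A x eta u) /\
    (forall v, tangent M x v ->
      pseudo_inner (A x eta u) v = pseudo_inner (alpha x u v) eta).

(* With n the dimension of M, such a family e is a basis of T_xM. *)
Definition orthonormal_frame (R : realType) (p q n : nat)
    (M : set 'rV[R]_(p + q)) (x : 'rV[R]_(p + q))
    (e : 'I_n -> 'rV[R]_(p + q)) : Prop :=
  [/\ forall i, tangent M x (e i),
      forall i j, i != j -> pseudo_inner (e i) (e j) = 0 &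
      forall i, pseudo_inner (e i) (e i) = 1 \/ pseudo_inner (e i) (e i) = -1].

Definition mean_curvature (R : realType) (p q n : nat)
    (M : set 'rV[R]_(p + q))
    (alpha : 'rV[R]_(p + q) -> 'rV[R]_(p + q) -> 'rV[R]_(p + q) ->
             'rV[R]_(p + q))
    (h : 'rV[R]_(p + q) -> 'rV[R]_(p + q)) : Prop :=
  forall x (e : 'I_n -> 'rV[R]_(p + q)), M x -> orthonormal_frame M x e ->
    h x = n%:R^-1 *:
          \sum_(j < n) pseudo_inner (e j) (e j) *: alpha x (e j) (e j).

Record lieAlgebra (R : realType) (g : vectType R) := LieAlgebra {
  bracket :> {bilinear g -> g -> g};
  bracketxx : forall x, bracket x x = 0;
  jacobi : forall x y z,
    bracket x (bracket y z) + bracket y (bracket z x) +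
    bracket z (bracket x y) = 0
}.

(* [U, W], the span of all brackets; by bilinearity bases suffice. *)
Definition lie_prod (R : realType) (g : vectType R) (br : lieAlgebra g)
    (U W : {vspace g}) : {vspace g} :=
  <<[seq br u w | u <- vbasis U, w <- vbasis W]>>%VS.

Definition lie_ideal (R : realType) (g : vectType R) (br : lieAlgebra g)
    (I : {vspace g}) : Prop := forall x y, y \in I -> br x y \in I.

Definition lie_solvable (R : realType) (g : vectType R) (br : lieAlgebra g)
    (I : {vspace g}) : Prop :=
  exists k, iter k (fun U => lie_prod br U U) I = 0%VS.

Definition lie_semisimple (R : realType) (g : vectType R) (br : lieAlgebra g) :
    Prop := forall I, lie_ideal br I -> lie_solvable br I -> I = 0%VS.

(* The exponential series of an endomorphism; its limit is taken in the
   coordinates v2r of the finite-dimensional space 'End(V). *)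
Definition lfun_exp (R : realType) (V : vectType R) (f : 'End(V)) : 'End(V) :=
  r2v (limn (series (fun k => v2r ((k`!%:R)^-1 *: iter k (comp_lfun f) \1%VF)))).

Section Eigenspaces.
Variables (R : realType) (g : vectType R) (D theta : 'End(g)).

Definition tau : 'End(g) := lfun_exp (pi *: D).

(* Lower index: sign of the eigenvalue of theta; upper index (named t): of
   tau. *)
Definition g_p : {vspace g} := lker (theta - \1)%VF.
Definition g_m : {vspace g} := lker (theta + \1)%VF.
Definition gt_p : {vspace g} := lker (tau - \1)%VF.
Definition gt_m : {vspace g} := lker (tau + \1)%VF.
Definition g_p_tp : {vspace g} := (g_p :&: gt_p)%VS.
Definition g_p_tm : {vspace g} := (g_p :&: gt_m)%VS.
Definition g_m_tp : {vspace g} := (g_m :&: gt_p)%VS.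
Definition g_m_tm : {vspace g} := (g_m :&: gt_m)%VS.

End Eigenspaces.

Record weak_extrinsic_symmetric_triple (R : realType) (g : vectType R)
    (br : lieAlgebra g) (ip : {bilinear g -> g -> R^o}) (D theta : 'End(g)) :
    Prop := WeakExtrinsicSymmetricTriple {
  ip_sym : forall x y, ip x y = ip y x;
  ip_invariant : forall x y z, ip (br x y) z + ip y (br x z) = 0;
  theta_automorphism : forall x y, theta (br x y) = br (theta x) (theta y);
  theta_involutive : forall x, theta (theta x) = x;
  theta_isometric : forall x y, ip (theta x) (theta y) = ip x y;
  D_derivation : forall x y, D (br x y) = br (D x) y + br x (D y);
  D_antisymmetric : forall x y, ip (D x) y = - ip x (D y);
  D_theta : forall x, D (theta x) = - theta (D x);
  D_cube : forall x, D (D (D x)) = - D x;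
  g_p_tp_generated :
    g_p_tp D theta = lie_prod br (g_p_tm D theta) (g_p_tm D theta);
  ip_radical : forall x, (forall y, ip x y = 0) -> x \in g_m_tp D theta
}.

Definition full_triple (R : realType) (g : vectType R) (br : lieAlgebra g)
    (D theta : 'End(g)) : Prop :=
  g_m_tp D theta = lie_prod br (g_p_tm D theta) (g_m_tm D theta).

(* exp (phi X), the exponential of the affine vector field
   y |-> [X, y] - D X, is computed in linear endomorphisms of g x R, where the
   affine space is the hyperplane of points (y, 1). *)
Definition exp_phi (R : realType) (g : vectType R) (br : lieAlgebra g)
    (D : 'End(g)) (X y : g) : g :=
  let F : 'End((g * R^o)%type) :=
    linfun (fun z : g * R^o => (br X z.1 - (z.2 : R) *: D X, 0 : R^o)) in
  (lfun_exp F (y, 1 : R^o)).1.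

(* Since exp (phi X) and exp (phi (- X)) are inverse to each other, the group
   they generate consists of the finite products of maps exp (phi X). *)
Inductive orbit_of_0 (R : realType) (g : vectType R) (br : lieAlgebra g)
    (D theta : 'End(g)) : g -> Prop :=
| orbit_of_0_base : orbit_of_0 br D theta 0
| orbit_of_0_step (X y : g) : X \in g_p theta -> orbit_of_0 br D theta y ->
    orbit_of_0 br D theta (exp_phi br D X y).

(* The smallest affine subspace containing M, for x0 in M, is x0 + W. *)
Definition affine_hull_direction (R : realType) (N : nat) (M : set 'rV[R]_N)
    (x0 : 'rV[R]_N) (W : {vspace 'rV[R]_N}) : Prop :=
  (forall x, M x -> x - x0 \in W) /\
  (forall W' : {vspace 'rV[R]_N}, (forall x, M x -> x - x0 \in W') ->
    (W <= W')%VS).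

(* The identification of g_- with the affine hull V of M, with origin x0, is
   y |-> x0 + J y; only the restriction of J to g_- matters. *)
Definition associated_triple (R : realType) (p q : nat)
    (M : set 'rV[R]_(p + q)) (x0 : 'rV[R]_(p + q)) (g : vectType R)
    (br : lieAlgebra g) (ip : {bilinear g -> g -> R^o}) (D theta : 'End(g)) :
    Prop :=
  exists J : 'Hom(g, 'rV[R]_(p + q)),
    [/\ (forall u, u \in g_m theta -> J u = 0 -> u = 0),
        affine_hull_direction M x0 (J @: g_m theta)%VS,
        (forall u v, u \in g_m theta -> v \in g_m theta ->
          pseudo_inner (J u) (J v) = ip u v) &
        M = [set x0 + J y | y in orbit_of_0 br D theta]].

(* Main.v *)
Require Import Defs.
From HB Require Import structures.
From mathcomp Require Import all_boot all_order all_algebra.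
From mathcomp Require Import sesquilinear spectral complex perm.
From mathcomp Require Import all_classical all_reals all_analysis.
From mathcomp Require Import ring lra.
Import Order.TTheory GRing.Theory Num.Theory.
Import numFieldNormedType.Exports.
Import VectorInternalTheory.
Local Open Scope classical_set_scope.
Local Open Scope ring_scope.
Set Implicit Arguments.
Unset Strict Implicit.
Unset Printing Implicit Defensive.

(** Write T, m, k, N for the eigenspaces g_-^-, g_+^-, g_+^+, g_-^+, and B for
    the Killing form of g.  Let H be the sum of the vectors <a, a> [D a, a] over
    an orthonormal basis of T; it corresponds to n h.

    The Killing form knows the shape operator of the mean curvature vector.  For
    v in T, ad v is the commutator of D and ad (- D v), so that by cyclicity of
    the trace B(u, v) is the trace of ad [u, D v] o D; computing this trace in
    the basis of g^- formed by the vectors a and D a gives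
    B(u, v) = - 2 <[H, D u], v> on T (killing_T), that is - 2 n <A_h u, v>
    (shape_mean).

    If g is semisimple, B is non-degenerate by Cartan's criterion
    (semisimple_killing).  As T is B-orthogonal to m, k and N, the operator A_h
    is injective (shape_injective), and T has dimension n > 0.

    Conversely, let C be the Casimir endomorphism of the inner product; it makes
    sense because the radical of the inner product is central.  It commutes with
    D, theta and all ad x, and <C x, y> = B(x, y), so that C = - 2 n A_h on T.
    If C were nilpotent, B(C x, y) = tr (C ad x ad y) would vanish, whence
    C^2 = 0 on T.  So A_h^2 <> 0 makes the Fitting projector E of C non-zero
    (splitting).  This projector commutes with D, theta and all ad x, is
    self-adjoint and kills the radical.  Therefore J (E g_-) is a non-zero
    non-degenerate subspace of the ambient space, and for y, y' in the orbit of
    the origin E y + (1 - E) y' is again in the orbit (orbit_split): M is the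
    product of its projections to this subspace and to its orthogonal
    complement.  Indecomposability forces the subspace to be everything, hence
    E = 1 on g_-, and then on g, which T generates.  So C is injective, B is
    non-degenerate and g is semisimple (killing_semisimple).

    Three facts link this algebra to the geometry.  The tangent space is J T
    (tangent_T): the one-parameter groups exp (t phi X) give one inclusion; for
    the other one, P = D + ad y satisfies P^3 = - P along the orbit
    (orbit_cubic), and differentiating this at the origin shows that a tangent
    vector J w with w in N has w central, hence is orthogonal to the whole
    affine hull and zero.  The second fundamental form is read off the affine
    vector fields phi X (alphaE).  Finally, the factors of a product that is a
    submanifold are submanifolds (factors_submanifold), which rests on the
    inverse function theorem. *)

(** * Generalized eigenspaces and derivations *)
(** Chinese remainder theorem.  At a matrix with eigenvalues in s, such a p
    acts as the scalar f a on the generalized eigenvectors of order m for a. *)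
Lemma poly_interp_mod (F : fieldType) (f : F -> F) (m : nat) (s : seq F) :
  uniq s -> exists p : {poly F},
    forall a, a \in s -> ('X - a%:P) ^+ m %| p - (f a)%:P.
Proof.
elim: s => [|a s IH] /=; first by exists 0.
case/andP=> a_s /IH [p hp].
pose Q : {poly F} := \prod_(b <- s) ('X - b%:P) ^+ m.
have cop : coprimep Q (('X - a%:P) ^+ m).
  rewrite /Q big_seq; elim/big_ind: _ => [|u v hu hv|b b_s].
  - exact: coprime1p.
  - by rewrite coprimepMl hu.
  - rewrite coprimep_expl // coprimep_expr // coprimep_XsubC root_XsubC.
    by apply: contraNneq a_s => ->.
have /Bezout_eq1_coprimepP [[u v] /= huv] := cop.
exists (p + u * Q * ((f a)%:P - p)) => b; rewrite in_cons => /predU1P[->|b_s].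
  have -> : p + u * Q * ((f a)%:P - p) - (f a)%:P
       = v * (p - (f a)%:P) * ('X - a%:P) ^+ m.
    have -> : u * Q = 1 - v * ('X - a%:P) ^+ m by rewrite -huv addrK.
    ring.
  exact: dvdp_mull.
rewrite addrAC dvdp_addr ?hp // mulrAC dvdp_mull //.
by rewrite /Q (big_rem b b_s) /= dvdp_mulr.
Qed.

Lemma trig_mulmx (F : comNzRingType) n (A B : 'M[F]_n) :
  is_trig_mx A -> is_trig_mx B ->
  is_trig_mx (A *m B) /\ forall i, (A *m B) i i = A i i * B i i.
Proof.
move=> /is_trig_mxP hA /is_trig_mxP hB; split.
  apply/is_trig_mxP => i j ij; rewrite mxE big1 // => k _.
  have [ik|ki] := ltnP i k; first by rewrite hA ?mul0r.
  by rewrite [B k j]hB ?mulr0 // (leq_ltn_trans ki).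
move=> i; rewrite mxE (bigD1 i) //= big1 ?addr0 // => k ki.
have [ik|] := ltnP i k; first by rewrite hA ?mul0r.
rewrite leq_eqVlt => /predU1P[/val_inj/eqP|]; first by rewrite (negPf ki).
by move=> ?; rewrite [B k i]hB ?mulr0.
Qed.

Lemma trig_horner_mx (F : comNzRingType) n (A : 'M[F]_n.+1) (p : {poly F}) :
  is_trig_mx A ->
  is_trig_mx (horner_mx A p) /\ forall i, horner_mx A p i i = p.[A i i].
Proof.
move=> hA; elim/poly_ind: p => [|p c [IH1 IH2]].
  by rewrite rmorph0 mx0_is_trig; split=> // i; rewrite horner0 mxE.
rewrite rmorphD rmorphM /= horner_mx_X horner_mx_C -mulmxE.
have [h1 h2] := trig_mulmx IH1 hA.
split; last by move=> i; rewrite mxE h2 IH2 !hornerE mxE eqxx.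
apply/is_trig_mxP => i j ij; rewrite mxE (is_trig_mxP h1) // mxE.
by rewrite -val_eqE ltn_eqF // mulr0n addr0.
Qed.

Section ConjugateDerivation.
Variables (C : numClosedFieldType) (n : nat).
Variables (ad : {linear 'rV[C]_n.+1 -> 'M[C]_n.+1}) (X : 'M[C]_n.+1).
Hypothesis X_deriv : forall x, ad x *m X = ad (x *m X) + X *m ad x.

(** The derivation rule lets X - (a + b) act on a product as X - a on one
    factor plus X - b on the other. *)
Lemma geigen_bracket (a b : C) k l (x y : 'rV[C]_n.+1) :
  x *m (X - a%:M) ^+ k = 0 -> y *m (X - b%:M) ^+ l = 0 ->
  y *m ad x *m (X - (a + b)%:M) ^+ (k + l) = 0.
Proof.
have step x' (y' : 'rV_n.+1) : y' *m ad x' *m (X - (a + b)%:M) =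
    y' *m ad (x' *m (X - a%:M)) + y' *m (X - b%:M) *m ad x'.
  rewrite !mulmxBr !mul_mx_scalar linearB [ad (a *: _)]linearZ /= mulmxBl !mulmxBr.
  rewrite -(mulmxA y' (ad x')) X_deriv mulmxDr !mulmxA -scalemxAl -scalemxAr.
  by rewrite scalerDl opprD !addrA; congr (_ - _); rewrite addrAC.
have [m] := ubnP (k + l)%N; elim: m k l x y => // m IH [|k] l x y hm.
  by rewrite expr0 mulmx1 => -> _; rewrite linear0 mulmx0 mul0mx.
case: l hm => [|l] hm hx.
  by rewrite expr0 mulmx1 => ->; rewrite !mul0mx.
move=> hy; rewrite addSn exprS -mulmxE mulmxA step mulmxDl.
rewrite (IH k l.+1) ?add0r //; last first.
  by move: hx; rewrite exprS -mulmxE mulmxA.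
rewrite addnS -addSn (IH k.+1 l) //; first by rewrite addnS -addSn in hm.
by move: hy; rewrite exprS -mulmxE mulmxA.
Qed.

(** Let S = p(X) with p congruent to the complex conjugate of a modulo
    (t - a)^(2 N) at every eigenvalue a: the conjugate of the semisimple part of
    X.  By geigen_bracket a product of generalized eigenvectors for a and b is
    one for a + b, of order at most 2 N, and conjugation is additive: so S is a
    derivation.  The trace of X S is the sum of the squared moduli of the
    eigenvalues. *)
Lemma conj_derivation : exists S : 'M[C]_n.+1,
  (forall x, ad x *m S = ad (x *m S) + S *m ad x) /\
  (\tr (X *m S) = 0 -> X ^+ n.+1 = 0).
Proof.
have [P Pu] := Schur X (ltn0Sn n).
have {}Pu : P \in unitmx by apply: unitarymx_unit.
move=> hS; have {hS} : is_trig_mx (P *m X *m invmx P) by rewrite -conjumx.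
set T := P *m X *m invmx P => hT.
have XE : X = invmx P *m T *m P.
  by rewrite /T !mulmxA mulVmx // mul1mx -mulmxA mulVmx // mulmx1.
have hornX q : horner_mx X q = invmx P *m horner_mx T q *m P.
  by rewrite XE horner_mx_uconjC.
pose s := undup [seq T i i | i : 'I_n.+1].
have s_uniq : uniq s by apply: undup_uniq.
have T_s i : T i i \in s by rewrite mem_undup; apply/fintype.imageP; exists i.
pose N := n.+1.
have [p hp] := poly_interp_mod (fun a : C => a^*) (N + N) s_uniq.
pose S := horner_mx X p.
(* Q annihilates X: every vector is a sum of generalized eigenvectors. *)
pose Q : {poly C} := \prod_(i < size s) ('X - (s`_i)%:P) ^+ N.
have Q0 : horner_mx X Q = 0.
  have dvdQ : char_poly T %| Q.
    rewrite char_poly_trig // /Q.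
    rewrite -(big_mkord predT (fun i => ('X - (s`_i)%:P) ^+ N)) -(big_nth 0 predT (fun a => ('X - a%:P) ^+ N)).
    rewrite prodrXl -[N in _ ^+ N]card_ord -prodr_const.
    apply: (big_ind2 (fun u v : {poly C} => u %| v)) => // [u u' v v' *|i _].
      exact: dvdp_mul.
    by rewrite (big_rem _ (T_s i)) /= dvdp_mulIl.
  rewrite hornX; move: dvdQ => /dvdpP[q ->].
  by rewrite rmorphM /= Cayley_Hamilton mulr0 mulmx0 mul0mx.
have dec (x : 'rV[C]_n.+1) : exists x_ : 'I_(size s) -> 'rV[C]_n.+1, x = \sum_i x_ i /\
    forall i, x_ i *m (X - (s`_i)%:M) ^+ N = 0.
  have : (x <= kermxpoly X Q)%MS by apply/sub_kermxP; rewrite Q0 mulmx0.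
  rewrite kermxpoly_prod => [|i j _ _ ij]; last first.
    rewrite coprimep_expl // coprimep_expr // coprimep_XsubC root_XsubC.
    by rewrite nth_uniq // eq_sym.
  case/sub_sumsmxP => u ->; exists (fun i => u i *m kermxpoly X (('X - (s`_i)%:P) ^+ N)).
  split=> // i; rewrite -mulmxA -[RHS](mulmx0 _ (u i)); congr (_ *m _).
  have -> : (X - (s`_i)%:M) ^+ N = horner_mx X (('X - (s`_i)%:P) ^+ N).
    by rewrite rmorphXn rmorphB /= horner_mx_X horner_mx_C.
  by rewrite mulmx_ker.
have S_conj v b k : (k <= N + N)%N -> v *m (X - b%:M) ^+ k = 0 -> v *m S = b^* *: v.
  move=> kN hv; have {}hv : v *m (X - b%:M) ^+ (N + N) = 0.
    by rewrite -(subnK kN) addnC exprD -mulmxE mulmxA hv mul0mx.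
  have hb : (X - b%:M) ^+ (N + N) = horner_mx X (('X - b%:P) ^+ (N + N)).
    by rewrite rmorphXn rmorphB /= horner_mx_X horner_mx_C.
  have [bs|bs] := boolP (b \in s).
    have /dvdpP[q hq] := hp b bs.
    rewrite /S -[p](subrK (b^*)%:P) hq mulrC rmorphD rmorphM /= -hb horner_mx_C.
    by rewrite -mulmxE mulmxDr mulmxA hv mul0mx add0r mul_mx_scalar.
  have cop : coprimep (('X - b%:P) ^+ (N + N)) Q.
    rewrite /Q; elim/big_ind: _ => [|u u' hu hu'|i _]; first exact: coprimep1.
      by rewrite coprimepMr hu.
    rewrite coprimep_expl // coprimep_expr // coprimep_XsubC root_XsubC.
    by apply: contraNneq bs => <-; rewrite mem_nth.
  have /Bezout_eq1_coprimepP [[u w] /= huw] := cop.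
  suff -> : v = 0 by rewrite mul0mx scaler0.
  have h1 := congr1 (horner_mx X) huw.
  rewrite rmorphD !rmorphM rmorph1 /= Q0 mulr0 addr0 -rmorphM mulrC rmorphM /= in h1.
  by rewrite -[v]mulmx1 -[1%:M]h1 -hb -mulmxE mulmxA hv mul0mx.
exists S; split=> [x|].
  apply/row_matrixP => r; rewrite !rowE; set y := delta_mx 0 r.
  have [x_ [-> hx]] := dec x; have [y_ [-> hy]] := dec y.
  rewrite mulmxDr !mulmxA !mulmx_suml -big_split /=; apply: eq_bigr => j _.
  rewrite !linear_sum /= !mulmx_suml -big_split /=; apply: eq_bigr => i _.
  rewrite (S_conj _ _ _ _ _ (geigen_bracket (hx i) (hy j))) //.
  rewrite (S_conj _ _ _ _ _ (hx i)) ?leq_addr // (S_conj _ _ _ _ _ (hy j)) ?leq_addr //.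
  by rewrite linearZ /= -scalemxAr -scalemxAl rmorphD scalerDl.
have XS : X *m S = invmx P *m horner_mx T ('X * p) *m P.
  by rewrite -hornX rmorphM /= horner_mx_X.
rewrite XS mxtrace_mulC mulmxA mulmxV // mul1mx => tr0.
have [_ hd] := trig_horner_mx ('X * p) hT.
have Tii i : T i i = 0.
  have pT j : p.[T j j] = (T j j)^*.
    have /dvdpP[q /(congr1 (fun q => q.[T j j]))] := hp _ (T_s j).
    rewrite !(hornerE, horner_exp) subrr expr0n addnn /= mulr0 => /eqP.
    by rewrite subr_eq0 => /eqP.
  have : \sum_j `|T j j| ^+ 2 = 0.
    rewrite -[RHS]tr0 /mxtrace; apply: eq_bigr => j _.
    by rewrite hd hornerM hornerX pT normCK.
  move/eqP; rewrite psumr_eq0 => [/allP/(_ i)|j _]; last exact: exprn_ge0.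
  by rewrite mem_index_enum expf_eq0 /= normr_eq0 => /(_ isT)/eqP.
have : char_poly T = 'X^N.
  rewrite char_poly_trig // (eq_bigr (fun=> 'X)) => [|i _]; last by rewrite Tii subr0.
  by rewrite prodr_const card_ord.
move=> cT; have := hornX 'X^N; rewrite -cT Cayley_Hamilton mulmx0 mul0mx cT.
by rewrite rmorphXn /= horner_mx_X.
Qed.
End ConjugateDerivation.

Lemma conj_derivation_any (C : numClosedFieldType) (n : nat)
    (ad : {linear 'rV[C]_n -> 'M[C]_n}) (X : 'M[C]_n) :
  (forall x, ad x *m X = ad (x *m X) + X *m ad x) ->
  exists S : 'M[C]_n,
  (forall x, ad x *m S = ad (x *m S) + S *m ad x) /\
  (\tr (X *m S) = 0 -> X ^+ n = 0).
Proof.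
case: n ad X => [|n] ad X; last exact: conj_derivation.
by exists 0; split=> [x|_]; apply/matrixP => -[].
Qed.

Lemma nilpotent_mxtrace (C : numClosedFieldType) (n k : nat) (X : 'M[C]_n) :
  X ^+ k = 0 -> \tr X = 0.
Proof.
case: n X => [|n] X Xk; first by rewrite /mxtrace big_ord0.
have [P Pu] := Schur X (ltn0Sn n).
have {}Pu : P \in unitmx by apply: unitarymx_unit.
move=> hS; have {hS} : is_trig_mx (P *m X *m invmx P) by rewrite -conjumx.
set T := P *m X *m invmx P => hT.
have -> : \tr X = \tr T by rewrite /T mxtrace_mulC mulmxA mulVmx // mul1mx.
have XE : X = invmx P *m T *m P.
  by rewrite /T !mulmxA mulVmx // mul1mx -mulmxA mulVmx // mulmx1.
have hk : horner_mx X 'X^k = 0 by rewrite rmorphXn /= horner_mx_X.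
have Tk : horner_mx T 'X^k = 0.
  by rewrite /T horner_mx_uconj // hk mulmx0 mul0mx.
have [_ hd] := trig_horner_mx 'X^k hT.
rewrite /mxtrace big1 // => i _.
have := hd i; rewrite Tk hornerXn mxE => /esym/eqP.
by rewrite expf_eq0 => /andP[_ /eqP].
Qed.

(** * Traces of endomorphisms *)
Section Trace.
Variables (R : realType) (V : vectType R).
Implicit Types f h : 'End(V).

Definition lftr f : R := \tr (f2mx f).

Lemma lfun_f2mxE f x : v2r (f x) = v2r x *m f2mx f.
Proof. by rewrite unlock /= r2vK. Qed.

Lemma f2mx_inj (f h : 'End(V)) : f2mx f = f2mx h -> f = h.
Proof. by move=> e; apply/lfunP => x; apply: v2r_inj; rewrite !lfun_f2mxE e. Qed.

Lemma f2mxE f (M : 'M[R]_(dim V)) :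
  (forall x, v2r (f x) = v2r x *m M) -> f2mx f = M.
Proof.
move=> h; apply/row_matrixP => i; rewrite !rowE.
by rewrite -[delta_mx 0 i]r2vK -lfun_f2mxE h.
Qed.

Lemma f2mx_comp f h : f2mx (f \o h)%VF = f2mx h *m f2mx f.
Proof. by apply: f2mxE => x; rewrite comp_lfunE !lfun_f2mxE mulmxA. Qed.

Lemma f2mxD f h : f2mx (f + h) = f2mx f + f2mx h.
Proof. by apply: f2mxE => x; rewrite add_lfunE linearD /= !lfun_f2mxE mulmxDr. Qed.

Lemma f2mxZ (a : R) f : f2mx (a *: f) = a *: f2mx f.
Proof. by apply: f2mxE => x; rewrite scale_lfunE linearZ /= !lfun_f2mxE -scalemxAr. Qed.

Lemma lftr_is_linear : linear (lftr : 'End(V) -> R^o).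
Proof. by move=> a f h; rewrite /lftr f2mxD f2mxZ linearD linearZ. Qed.
HB.instance Definition _ :=
  GRing.isLinear.Build R 'End(V) R^o _ (lftr : 'End(V) -> R^o) lftr_is_linear.

Lemma lftrC f h : lftr (f \o h)%VF = lftr (h \o f)%VF.
Proof. by rewrite /lftr !f2mx_comp mxtrace_mulC. Qed.

Lemma lftrD f h : lftr (f + h) = lftr f + lftr h. Proof. exact: linearD. Qed.
Lemma lftrB f h : lftr (f - h) = lftr f - lftr h. Proof. exact: linearB. Qed.
Lemma lftr_rank1 (l : V -> R^o) (w : V) f : linear l ->
  (forall x, f x = l x *: w) -> lftr f = l w.
Proof.
move=> ll fE.
pose lL := HB.pack_for {linear V -> R^o} l (GRing.isLinear.Build R V R^o _ l ll).
have fM : f2mx f = (\col_i l (r2v (delta_mx 0 i))) *m v2r w.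
  apply: f2mxE => x; rewrite fE linearZ /= mulmxA -mul_scalar_mx; congr (_ *m _).
  apply/matrixP => i j; rewrite !ord1 !mxE eqxx mulr1n.
  rewrite -[in LHS](v2rK x) [in LHS](row_sum_delta (v2r x)) !linear_sum.
  rewrite -[l]/(lL : V -> R^o) linear_sum; apply: eq_bigr => k _.
  by rewrite linearZ linearZ mxE.
rewrite /lftr fM mxtrace_mulC /mxtrace big_ord1 !mxE.
rewrite -[in RHS](v2rK w) [in RHS](row_sum_delta (v2r w)) !linear_sum.
rewrite -[l]/(lL : V -> R^o) linear_sum; apply: eq_bigr => k _.
by rewrite linearZ linearZ mxE.
Qed.

Lemma iter_comp_lfunE k f x : iter k (comp_lfun f) \1%VF x = iter k f x.
Proof. by elim: k => [|k IH] /=; rewrite ?id_lfunE // comp_lfunE IH. Qed.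

Lemma lftr_nilpotent k f : (forall x, iter k f x = 0) -> lftr f = 0.
Proof.
move=> fk; pose C := R[i].
have hX : (map_mx (real_complex R) (f2mx f)) ^+ k = 0.
  have : (f2mx f) ^+ k = 0.
    suff h j : f2mx (iter j (comp_lfun f) \1%VF) = (f2mx f) ^+ j.
      by rewrite -h; apply: f2mxE => x; rewrite iter_comp_lfunE fk linear0 mulmx0.
    elim: j => [|j IH] /=.
      by apply: f2mxE => x; rewrite id_lfunE expr0 mulmx1.
    by rewrite f2mx_comp IH exprSr.
  move=> h; suff hm j : (map_mx (real_complex R) (f2mx f)) ^+ j =
      map_mx (real_complex R) ((f2mx f) ^+ j) by rewrite hm h map_mx0.
  by elim: j => [|j IH]; rewrite ?expr0 ?map_mx1 // !exprS IH -!mulmxE map_mxM.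
have := nilpotent_mxtrace hX; rewrite trace_map_mx => /eqP.
by rewrite fmorph_eq0 => /eqP.
Qed.
End Trace.

(** * Lie algebras *)
Section LieBasics.
Variables (R : realType) (g : vectType R) (br : lieAlgebra g).
Implicit Types (x y z : g) (U W : {vspace g}).

Definition ad x : 'End(g) := linfun (br x).

Lemma adE x y : ad x y = br x y. Proof. by rewrite lfunE. Qed.

Lemma brDl x y z : br (x + y) z = br x z + br y z. Proof. exact: linearDl. Qed.
Lemma brDr x y z : br x (y + z) = br x y + br x z. Proof. exact: linearD. Qed.
Lemma brZl a x y : br (a *: x) y = a *: br x y. Proof. exact: linearZl_LR. Qed.
Lemma brZr a x y : br x (a *: y) = a *: br x y. Proof. exact: linearZ. Qed.
Lemma br0l x : br 0 x = 0. Proof. exact: linear0l. Qed.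
Lemma br0r x : br x 0 = 0. Proof. exact: linear0. Qed.
Lemma brNl x y : br (- x) y = - br x y. Proof. exact: linearNl. Qed.
Lemma brNr x y : br x (- y) = - br x y. Proof. exact: linearN. Qed.
Lemma brBl x y z : br (x - y) z = br x z - br y z. Proof. exact: linearBl. Qed.
Lemma brBr x y z : br x (y - z) = br x y - br x z. Proof. exact: linearB. Qed.
Lemma br_suml I (r : seq I) (P : pred I) (F : I -> g) z :
  br (\sum_(i <- r | P i) F i) z = \sum_(i <- r | P i) br (F i) z.
Proof. exact: linear_sumlz. Qed.
Lemma br_sumr I (r : seq I) (P : pred I) (F : I -> g) z :
  br z (\sum_(i <- r | P i) F i) = \sum_(i <- r | P i) br z (F i).
Proof. exact: linear_sum. Qed.

Lemma brC x y : br x y = - br y x.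
Proof.
apply/eqP; rewrite -addr_eq0; have := bracketxx br (x + y).
by rewrite brDl !brDr !bracketxx addr0 add0r => ->.
Qed.

Lemma jacobi_ad x y z : br x (br y z) = br (br x y) z + br y (br x z).
Proof.
have := jacobi br x y z; rewrite (brC z (br x y)) (brC z x) brNr => /eqP.
by rewrite -addrA -opprD subr_eq0 addrC => /eqP.
Qed.

Lemma ad_br x y : ad (br x y) = (ad x \o ad y)%VF - (ad y \o ad x)%VF.
Proof.
apply/lfunP => z; rewrite add_lfunE opp_lfunE !comp_lfunE !adE.
by rewrite [br x (br y z)]jacobi_ad addrK.
Qed.

Lemma ad_is_linear : linear ad.
Proof.
by move=> a x y; apply/lfunP => z; rewrite add_lfunE scale_lfunE !adE brDl brZl.
Qed.
HB.instance Definition _ := GRing.isLinear.Build R g 'End(g) _ ad ad_is_linear.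

Definition killing x y : R := lftr (ad x \o ad y)%VF.

Lemma killingE x y : killing x y = lftr (ad x \o ad y)%VF. Proof. by []. Qed.

Lemma killingC x y : killing x y = killing y x.
Proof. exact: lftrC. Qed.

Lemma killing_inv x y z : killing (br x y) z + killing y (br x z) = 0.
Proof.
rewrite /killing !ad_br; have -> : (((ad x \o ad y) - (ad y \o ad x)) \o ad z)%VF =
   ((ad x \o (ad y \o ad z)) - (ad y \o (ad x \o ad z)))%VF.
  by apply/lfunP => u; rewrite !(comp_lfunE, add_lfunE, opp_lfunE).
have -> : (ad y \o ((ad x \o ad z) - (ad z \o ad x)))%VF =
   ((ad y \o (ad x \o ad z)) - ((ad y \o ad z) \o ad x))%VF.
  by apply/lfunP => u; rewrite !(comp_lfunE, add_lfunE, opp_lfunE) linearB.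
by rewrite !lftrB [lftr ((_ \o _) \o ad x)%VF]lftrC addrA addrNK subrr.
Qed.

Lemma killing_is_linear x : linear (killing x : g -> R^o).
Proof.
move=> a y z; rewrite /killing linearP /=; set f := ad y; set h := ad z.
have -> : (ad x \o (a *: f + h))%VF = a *: (ad x \o f)%VF + (ad x \o h)%VF.
  by rewrite comp_lfunDr comp_lfunZr.
exact: lftr_is_linear.
Qed.
HB.instance Definition _ x :=
  GRing.isLinear.Build R g R^o _ (killing x : g -> R^o) (killing_is_linear x).

Lemma memv_lie_prod U W x y : x \in U -> y \in W -> br x y \in lie_prod br U W.
Proof.
move=> /coord_vbasis -> /coord_vbasis ->.
rewrite br_suml; apply: memv_suml => i _; rewrite linear_sumr.
apply: memv_suml => j _; rewrite brZl brZr.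
do 2!apply: memvZ; apply/memv_span/allpairsP.
exists ((vbasis U)`_i, (vbasis W)`_j).
by split=> //=; rewrite -tnth_nth mem_tnth.
Qed.

Lemma lie_prod_sub U W (X : {vspace g}) :
  (forall x y, x \in U -> y \in W -> br x y \in X) -> (lie_prod br U W <= X)%VS.
Proof.
move=> h; apply/span_subvP => _ /allpairsP[[x y] /= [hx hy ->]].
by apply: h; apply: vbasis_mem.
Qed.

Lemma lie_prodP U W z : z \in lie_prod br U W ->
  exists m (u w : 'I_m -> g), [/\ forall i, u i \in U, forall i, w i \in W &
    z = \sum_i br (u i) (w i)].
Proof.
pose X := [seq br u w | u <- vbasis U, w <- vbasis W].
rewrite /lie_prod -/X => /(coord_span (X := in_tuple X)) ->.
have hX (i : 'I_(size X)) : exists p : g * g, [/\ p.1 \in U, p.2 \in W & X`_i = br p.1 p.2].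
  have : X`_i \in X by apply: mem_nth.
  by case/allpairsP => -[x y] /= [hx hy ->]; exists (x, y); split=> //; apply: vbasis_mem.
have {hX}[f hf] := choice hX.
exists (size X), (fun i => coord (in_tuple X) i z *: (f i).1), (fun i => (f i).2).
split=> [i|i|]; first by have [h _ _] := hf i; apply: memvZ.
  by have [] := hf i.
by apply: eq_bigr => i _; have [_ _ ->] := hf i; rewrite brZl.
Qed.

Definition centralizer U : {vspace g} :=
  (\bigcap_(i < \dim U) lker (ad (vbasis U)`_i))%VS.

Lemma centralizerP U x : reflect (forall y, y \in U -> br y x = 0) (x \in centralizer U).
Proof.
rewrite memvE; apply: (iffP subv_bigcapP) => h.
  move=> y /coord_vbasis ->; rewrite br_suml big1 // => i _.
  have := h i isT; rewrite -memvE memv_ker adE => /eqP e.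
  by rewrite brZl e scaler0.
move=> i _; rewrite -memvE memv_ker adE; apply/eqP/h.
by apply: vbasis_mem; rewrite -tnth_nth mem_tnth.
Qed.

Lemma abelian_solvable U : (forall x y, x \in U -> y \in U -> br x y = 0) ->
  lie_solvable br U.
Proof.
move=> h; exists 1%N => /=; apply/eqP; rewrite -subv0; apply: lie_prod_sub.
by move=> x y hx hy; rewrite h // mem0v.
Qed.

(** ** Engel's theorem *)

(** The relative form (a vector of V1 outside V0 carried into V0) makes the
    induction work without quotient modules: it applies to a maximal proper
    subalgebra s' acting on s relatively to s'. *)
Lemma engel (s : {vspace g}) :
  (forall x y, x \in s -> y \in s -> br x y \in s) ->
  (forall x, x \in s -> exists k, forall y, iter k (br x) y = 0) ->
  forall V0 V1 : {vspace g}, (V0 <= V1)%VS -> ~~ (V1 <= V0)%VS ->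
  (forall x v, x \in s -> v \in V0 -> br x v \in V0) ->
  (forall x v, x \in s -> v \in V1 -> br x v \in V1) ->
  exists v, [/\ v \in V1, v \notin V0 & forall x, x \in s -> br x v \in V0].
Proof.
have [m] := ubnP (\dim s); elim: m s => // m IH s dim_s s_alg s_nil V0 V1 V01 V10 sV0 sV1.
have [/eqP s0|s_nz] := boolP (s == 0%VS).
  have /subvPn[v v1 v0] := V10; exists v; split=> // x.
  by rewrite s0 memv0 => /eqP ->; rewrite br0l mem0v.
pose P d := `[< exists s' : {vspace g}, [/\ (s' <= s)%VS, s' != s, \dim s' = d &
   forall x y, x \in s' -> y \in s' -> br x y \in s'] >].
have exP : exists d, P d.
  exists 0%N; apply/asboolP; exists 0%VS; split; rewrite ?sub0v ?dimv0 //.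
    by rewrite eq_sym.
  by move=> x y; rewrite memv0 => /eqP -> _; rewrite br0l mem0v.
have ubP d : P d -> (d <= \dim s)%N.
  by case/asboolP => s' [? _ <- _]; apply: dimvS.
(* s' is a maximal proper subalgebra of s; it has codimension 1. *)
have [d /asboolP[s' [s's s'Ns ds' s'_alg]] dmax] := ex_maxnP exP ubP.
have lt_s' : (\dim s' < \dim s)%N.
  by rewrite ltn_neqAle (dimv_leqif_eq s's).2 s'Ns dimvS.
have dim_s' : (\dim s' < m)%N by rewrite (leq_trans lt_s').
have s'_nil x : x \in s' -> exists k, forall y, iter k (br x) y = 0.
  by move=> /(subvP s's)/s_nil.
have := IH s' dim_s' s'_alg s'_nil.
move=> IHs'.
have sNs' : ~~ (s <= s')%VS.
  by apply: contra s'Ns => ss'; rewrite eqEsubv s's.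
have [x [xs xs' hx]] : exists x, [/\ x \in s, x \notin s' & forall y, y \in s' -> br y x \in s'].
  apply: IHs' => // y z ys' zs; apply: s_alg => //; exact: (subvP s's).
have sE : s = (s' + <[x]>)%VS.
  pose s2 := (s' + <[x]>)%VS.
  have s2s : (s2 <= s)%VS by rewrite subv_add s's -memvE.
  have s'2 : (s' <= s2)%VS by apply: addvSl.
  have x2 : x \in s2 by apply: (subvP (addvSr _ _)); apply: memv_line.
  have s2_alg : forall y z, y \in s2 -> z \in s2 -> br y z \in s2.
    move=> y z /memv_addP[y1 y1s [_ /vlineP[a ->] ->]] /memv_addP[z1 z1s [_ /vlineP[b ->] ->]].
    rewrite brDl !brDr !brZl !brZr bracketxx !scaler0 addr0.
    rewrite rpredD ?rpredD ?memvZ //; apply: (subvP s'2).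
    - exact: s'_alg.
    - exact: hx.
    - by rewrite brC memvN hx.
  apply/eqP; apply: contraTT isT => sN2 /=; rewrite eq_sym in sN2.
  have : P (\dim s2) by apply/asboolP; exists s2.
  move/dmax; rewrite leqNgt => /negP[].
  rewrite -ds' ltn_neqAle (dimvS s'2) andbT (dimv_leqif_eq s'2).2.
  by apply: contraNneq xs' => ->.
have [w [w1 w0 hw]] : exists v, [/\ v \in V1, v \notin V0 & forall x, x \in s' -> br x v \in V0].
  by apply: IHs' => // y v ys' hv; [apply: sV0|apply: sV1] => //; apply: (subvP s's).
have hiter j : iter j (br x) w \in V1 /\ forall y, y \in s' -> br y (iter j (br x) w) \in V0.
  elim: j => [|j [h1 h2]] //=; split; first exact: sV1.
  move=> y ys'; rewrite jacobi_ad rpredD //.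
    by apply: h2; apply: hx.
  by apply: sV0 => //; apply: h2.
have [k hk] := s_nil x xs.
have exj : exists j, iter j (br x) w \in V0 by exists k; rewrite hk mem0v.
case: (ex_minnP exj) => -[|j] hj jmin; first by rewrite /= hj in w0.
exists (iter j (br x) w); have [h1 h2] := hiter j; split=> //.
  by apply/negP => /jmin; rewrite ltnn.
move=> y; rewrite sE => /memv_addP[y1 y1s [_ /vlineP[a ->] ->]].
by rewrite brDl brZl rpredD ?h2 // memvZ.
Qed.

End LieBasics.

(** * Cartan's criterion *)
Section CartanCriterion.
Variables (R : realType) (g : vectType R) (br : lieAlgebra g).
Local Notation ad := (ad br).
Local Notation killing := (killing br).
Local Notation C := R[i].
Local Notation n := (dim g).
Local Notation cplx := (map_mx (real_complex R)).

(** The complexified adjoint representation, in matrices that act on rows of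
    coordinates. *)
Definition adC_def (v : 'rV[C]_n) : 'M[C]_n :=
  \sum_j v 0 j *: cplx (f2mx (ad (r2v (delta_mx 0 j)))).

Lemma adC_is_linear : linear adC_def.
Proof.
move=> a u v; rewrite /adC_def scaler_sumr -big_split; apply: eq_bigr => j _.
by rewrite !mxE scalerDl scalerA.
Qed.
HB.instance Definition _ :=
  GRing.isLinear.Build C 'rV[C]_n 'M[C]_n _ adC_def adC_is_linear.
Definition adC : {linear 'rV[C]_n -> 'M[C]_n} := adC_def.

Lemma f2mx_sum I (r : seq I) (P : pred I) (F : I -> 'End(g)) :
  f2mx (\sum_(i <- r | P i) F i) = \sum_(i <- r | P i) f2mx (F i).
Proof.
apply: (big_morph _ (@f2mxD _ _)); apply: f2mxE => x.
by rewrite zero_lfunE linear0 mulmx0.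
Qed.

Lemma adC_real x : adC (cplx (v2r x)) = cplx (f2mx (ad x)).
Proof.
rewrite -[in RHS](v2rK x) [in RHS](row_sum_delta (v2r x)) !linear_sum /=.
rewrite f2mx_sum raddf_sum /=; apply: eq_bigr => j _.
by rewrite !linearZ /= f2mxZ map_mxZ mxE.
Qed.

Lemma adC_jacobi z x : let X := cplx (f2mx (ad z)) in
  adC x *m X = adC (x *m X) + X *m adC x.
Proof.
move=> X.
have real y : adC (cplx (v2r y)) *m X = adC (cplx (v2r y) *m X) + X *m adC (cplx (v2r y)).
  rewrite adC_real -!map_mxM -lfun_f2mxE adC_real -map_mxD adE; congr map_mx.
  rewrite -!f2mx_comp -f2mxD; congr f2mx; apply/lfunP => w.
  by rewrite add_lfunE !comp_lfunE !adE jacobi_ad.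
have delta j : delta_mx 0 j = cplx (v2r (r2v (delta_mx 0 j) : g)) :> 'rV[C]_n.
  by rewrite r2vK map_delta_mx.
rewrite (row_sum_delta x) !linear_sum /= !mulmx_suml linear_sum /=.
rewrite -big_split /=; apply: eq_bigr => j _.
rewrite -scalemxAl !linearZ /= -scalemxAl delta real scalerDr. by [].
Qed.

(** The conjugate S of the semisimple part of ad z is a derivation of the
    complexification, so that tr (ad z S) reduces to Killing products with the
    vectors u i. *)
Lemma killing_radical_nilpotent m (u w : 'I_m -> g) (z : g) :
  (forall i y, killing (u i) y = 0) -> z = \sum_i br (u i) (w i) ->
  exists k, forall y, iter k (br z) y = 0.
Proof.
move=> u0 zE; pose X := cplx (f2mx (ad z)).
have [S [S_der S_tr]] := conj_derivation_any (adC_jacobi z).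
exists n => y; apply: v2r_inj; rewrite linear0.
suff /S_tr Xn : \tr (X *m S) = 0.
  have cX j : X ^+ j = cplx (f2mx (iter j (comp_lfun (ad z)) \1%VF)).
    elim: j => [|j IH] /=.
      rewrite expr0 (_ : f2mx _ = 1%:M) ?map_mx1 //.
      by apply: f2mxE => x; rewrite id_lfunE mulmx1.
    by rewrite f2mx_comp map_mxM -IH exprSr.
  have iterE j : iter j (br z) y = iter j (comp_lfun (ad z)) \1%VF y.
    by elim: j => [|j IH] /=; rewrite ?id_lfunE // comp_lfunE adE -IH.
  rewrite iterE lfun_f2mxE.
  have -> : f2mx (iter n (comp_lfun (ad z)) \1%VF) = 0.
    by move/eqP: Xn; rewrite cX map_mx_eq0 => /eqP.
  exact: mulmx0.
have -> : X = \sum_i (cplx (f2mx (ad (w i))) *m cplx (f2mx (ad (u i)))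
                      - cplx (f2mx (ad (u i))) *m cplx (f2mx (ad (w i)))).
  rewrite /X zE linear_sum /= f2mx_sum raddf_sum /=; apply: eq_bigr => i _.
  rewrite -!map_mxM -map_mxB -!f2mx_comp; congr map_mx.
  by rewrite ad_br -scaleN1r f2mxD f2mxZ scaleN1r.
rewrite mulmx_suml linear_sum big1 //= => i _.
rewrite mulmxBl linearB /= mxtrace_mulC mulmxA -[in X in _ - X]mulmxA.
rewrite [X in X - _]mxtrace_mulC -linearB /= -mulmxBr.
have := S_der (cplx (v2r (w i))); rewrite adC_real => ->.
rewrite opprD addrCA subrr addr0 mulmxN raddfN /= /adC_def.
rewrite mulmx_sumr (raddf_sum (@mxtrace C n)) /=.
rewrite [X in - X]big1 ?oppr0 // => j _.
rewrite -scalemxAr -map_mxM -f2mx_comp mxtraceZ trace_map_mx.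
by have := u0 i (r2v (delta_mx 0 j)); rewrite killingC !killingE /lftr => ->; rewrite rmorph0 mulr0.
Qed.

Lemma killing_radicalP : exists r : {vspace g},
  forall x, (x \in r) <-> (forall y, killing x y = 0).
Proof.
pose k x : 'Hom(g, R^o) := linfun (killing x : g -> R^o).
have kE x y : k x y = killing x y by rewrite lfunE.
have k_lin : linear k.
  move=> a x y; apply/lfunP => z; rewrite add_lfunE scale_lfunE !kE.
  by rewrite ![killing _ z]killingC linearP.
pose kL := HB.pack_for {linear g -> 'Hom(g, R^o)} k
  (GRing.isLinear.Build R g 'Hom(g, R^o) _ k k_lin).
exists (lker (linfun kL)) => x; rewrite memv_ker lfunE /=.
split=> [/eqP k0 y|h]; first by rewrite -kE k0 zero_lfunE.
by apply/eqP/lfunP => y; rewrite kE h zero_lfunE.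
Qed.

(** Let r be the radical of the Killing form and q = [g, r].  By Engel's
    theorem a non-zero q would have a non-zero centre, an abelian ideal of g; so
    q = 0, and r is itself an abelian ideal. *)
Theorem semisimple_killing : lie_semisimple br ->
  forall x, (forall y, killing x y = 0) -> x = 0.
Proof.
move=> ss; have [r rP] := killing_radicalP.
have r_ideal : lie_ideal br r.
  move=> x y /rP hy; apply/rP => z.
  by have := killing_inv br x y z; rewrite hy addr0.
suff r0 : r = 0%VS by move=> x /rP; rewrite r0 memv0 => /eqP.
pose q := lie_prod br r fullv.
have q_ideal : lie_ideal br q.
  move=> x y /lie_prodP[m [u [w [hu hw ->]]]]; rewrite br_sumr rpred_sum // => i _.
  rewrite jacobi_ad rpredD // memv_lie_prod ?memvf //; exact: r_ideal.
have q_nil x : x \in q -> exists k, forall y, iter k (br x) y = 0.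
  move=> /lie_prodP[m [u [w [hu hw xE]]]].
  by apply: (killing_radical_nilpotent _ xE) => i; apply/rP.
have q_alg x y : x \in q -> y \in q -> br x y \in q by move=> _; apply: q_ideal.
have [/eqP q0|q0] := boolP (q == 0%VS).
  apply: ss => //; apply: abelian_solvable => x y hx hy.
  by have := memv_lie_prod br hx (memvf y); rewrite -/q q0 memv0 => /eqP.
have [|||c [cq c0 hc]] := engel q_alg q_nil (sub0v q).
- by rewrite subv0.
- by move=> x v _; rewrite memv0 => /eqP ->; rewrite br0r mem0v.
- by move=> x v _; apply: q_ideal.
pose Z := (q :&: centralizer br q)%VS.
suff Z0 : Z = 0%VS.
  have : c \in Z.
    rewrite memv_cap cq; apply/centralizerP => y /hc.
    by rewrite memv0 => /eqP.
  by rewrite Z0 (negPf c0).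
apply: ss; last first.
  apply: abelian_solvable => x y; rewrite memv_cap => /andP[xq _].
  by rewrite memv_cap => /andP[_ /centralizerP]; apply.
move=> x y; rewrite !memv_cap => /andP[yq /centralizerP hy].
rewrite q_ideal //; apply/centralizerP => z zq.
by rewrite jacobi_ad (hy z zq) br0r addr0 hy // brC memvN q_ideal.
Qed.

Lemma derived_ideal I k : lie_ideal br I ->
  lie_ideal br (iter k (fun U => lie_prod br U U) I).
Proof.
move=> hI; elim: k => [//|k IH] /= x y /lie_prodP[m [u [w [hu hw ->]]]].
rewrite br_sumr rpred_sum // => i _; rewrite jacobi_ad.
by rewrite rpredD // memv_lie_prod // IH.
Qed.

(** The last non-zero term of the derived series of a solvable ideal is
    abelian, and for x in an abelian ideal ad x o ad y is nilpotent. *)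
Theorem killing_semisimple :
  (forall x, (forall y, killing x y = 0) -> x = 0) -> lie_semisimple br.
Proof.
move=> nd I I_ideal [k]; elim: k => [//|k IH] /=.
set J := iter k _ I => JJ; apply: IH; apply/eqP; rewrite -subv0.
apply/subvP => x xJ; rewrite memv0; apply/eqP/nd => y.
have J_ideal : lie_ideal br J by apply: derived_ideal.
apply: (@lftr_nilpotent _ _ 2) => z /=; rewrite !comp_lfunE !adE.
have xyz : br x (br y z) \in J by rewrite brC memvN J_ideal.
have := memv_lie_prod br xJ (J_ideal y _ xyz).
by rewrite JJ memv0 => /eqP.
Qed.
End CartanCriterion.

(** * One-parameter groups of endomorphisms *)
Definition linear_of (R : nzRingType) (U W : lmodType R) (f : U -> W)
    (f_lin : linear f) : {linear U -> W} :=
  HB.pack_for {linear U -> W} f (GRing.isLinear.Build R U W _ f f_lin).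

Section ExpSeries.
Variables (R : realType) (V : vectType R) (F : 'End(V)).
Implicit Types (l : {linear 'End(V) -> R^o}).

Definition lfun_pow k : 'End(V) := iter k (comp_lfun F) \1%VF.

Lemma lfun_pow_f2mx k : f2mx (lfun_pow k) = f2mx F ^+ k.
Proof.
rewrite /lfun_pow; elim: k => [|k IH] /=.
  by rewrite expr0; apply: f2mxE => x; rewrite id_lfunE mulmx1.
by rewrite f2mx_comp IH exprSr.
Qed.

Lemma lfun_pow_bound l : exists C M : R, [/\ 0 <= C, 0 <= M &
  forall k, `|l (lfun_pow k) : R| <= C * M ^+ k].
Proof.
set n := dim V; pose A := f2mx F; pose M : R := \sum_i \sum_j `|A i j|.
pose E i j : 'End(V) := Hom (delta_mx i j).
pose C : R := \sum_i \sum_j `|l (E i j) : R|.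
have M0 : 0 <= M by do 2!(apply: sumr_ge0 => ? _).
exists C, M; split=> // [|k]; first by do 2!(apply: sumr_ge0 => ? _).
have entry i j : `|(A ^+ k) i j| <= M ^+ k.
  elim: k i j => [|k IH] i j.
    by rewrite !expr0 mxE; case: eqP; rewrite ?normr1 ?normr0.
  rewrite !exprSr mxE (le_trans (ler_norm_sum _ _ _)) //.
  apply: (@le_trans _ _ (\sum_m M ^+ k * `|A m j|)).
    by apply: ler_sum => m _; rewrite normrM ler_wpM2r.
  rewrite -mulr_sumr ler_wpM2l ?exprn_ge0 //.
  apply: ler_sum => m _; rewrite (bigD1 j) //= lerDl.
  by apply: sumr_ge0.
have powE : lfun_pow k = \sum_i \sum_j (A ^+ k) i j *: E i j.
  apply: f2mx_inj; rewrite lfun_pow_f2mx [LHS]matrix_sum_delta.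
  have f2mx_sum m (G : 'I_m -> 'End(V)) : f2mx (\sum_i G i) = \sum_i f2mx (G i).
    apply: (big_morph _ (@f2mxD _ _)); apply: f2mxE => x.
    by rewrite zero_lfunE linear0 mulmx0.
  rewrite f2mx_sum; apply: eq_bigr => i _.
  by rewrite f2mx_sum; apply: eq_bigr => j _; rewrite f2mxZ.
rewrite powE linear_sum (le_trans (ler_norm_sum _ _ _)) //.
rewrite mulr_suml; apply: ler_sum => i _.
rewrite linear_sum (le_trans (ler_norm_sum _ _ _)) //.
rewrite mulr_suml; apply: ler_sum => j _.
by rewrite linearZ normrM mulrC ler_wpM2l.
Qed.

Definition exp_coef l k : R := l (lfun_pow k) / k`!%:R.

Lemma is_cvg_exp_coef l (t : R) : cvgn (pseries (exp_coef l) t).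
Proof.
have [C [M [C0 M0 hCM]]] := lfun_pow_bound l.
apply: normed_cvg => /=.
apply: (@series_le_cvg _ _ (fun k => C *: exp_coeff (M * `|t|) k)) => [k|k|k|].
- exact: normr_ge0.
- by rewrite mulr_ge0 // exp_coeff_ge0 // mulr_ge0.
- rewrite /exp_coef /exp_coeff /= !normrM normfV normrX [`|k`!%:R|]ger0_norm //.
  have -> : C *: ((M * `|t|) ^+ k / k`!%:R) = C * M ^+ k / k`!%:R * `|t| ^+ k :> R.
    by rewrite exprMn /GRing.scale /=; ring.
  by rewrite ler_wpM2r ?exprn_ge0 // ler_wpM2r // invr_ge0 ler0n.
- by apply: is_cvg_seriesZ; exact: is_cvg_series_exp_coeff.
Qed.
End ExpSeries.

Lemma cvg_rV (T : topologicalType) d (I : Type) (G : set_system I) (u : I -> 'rV[T]_d)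
    (L : 'rV[T]_d) : Filter G ->
  (forall j, (fun n => u n 0 j) @ G --> L 0 j) -> u @ G --> L.
Proof.
move=> FG h A [P LP sPA].
have : \forall n \near G, forall j, P 0 j (u n 0 j).
  by apply: filter_forall => j; apply: (h j); exact: LP.
rewrite /nbhs /=; apply: filterS => n hn; apply: sPA => i j.
by rewrite ord1; apply: hn.
Qed.

Lemma linear_rV_continuous (R : realType) d (W : normedModType R)
  (f : {linear 'rV[R]_d -> W}) : continuous f.
Proof.
have fE : (f : 'rV[R]_d -> W) = (fun x => \sum_j x 0 j *: f (delta_mx 0 j)).
  apply/funext => x; rewrite [in LHS](row_sum_delta x) linear_sum.
  by apply: eq_bigr => j _; rewrite linearZ.
rewrite fE; apply: continuous_big => [|j _]; first exact: add_continuous.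
move=> x; exact: (cvgZ (@coord_continuous R 1 d 0 j x) (cvg_cst _)).
Qed.

Section ExpDerivative.
Variables (R : realType) (V : vectType R) (F : 'End(V)).
Implicit Types (l : {linear 'End(V) -> R^o}).

Lemma lfun_exp_lim l (t : R) :
  l (lfun_exp (t *: F)) = limn (pseries (exp_coef F l) t).
Proof.
pose u := series (fun k => v2r ((k`!%:R)^-1 *: iter k (comp_lfun (t *: F)) \1%VF)).
have powZ k : iter k (comp_lfun (t *: F)) \1%VF = t ^+ k *: lfun_pow F k.
  elim: k => [|k IH] /=; first by rewrite expr0 scale1r.
  by rewrite IH -comp_lfunZl -comp_lfunZr scalerA -exprS.
have coordE (m : {linear 'End(V) -> R^o}) n : m (r2v (u n)) = pseries (exp_coef F m) t n.
  rewrite /u /series /pseries /= !linear_sum; apply: eq_bigr => k _.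
  transitivity (m ((k`!%:R)^-1 *: iter k (comp_lfun (t *: F)) \1%VF)).
    by congr (m _); exact: v2rK.
  rewrite linearZ powZ linearZ /exp_coef /= /GRing.scale /=.
  ring.
have row_lin j : linear (fun f : 'End(V) => v2r f 0 j : R^o).
  by move=> a f h; rewrite linearP !mxE.
pose row j := linear_of (row_lin j).
have u_cvg : u @ \oo --> \row_j limn (pseries (exp_coef F (row j)) t).
  apply: cvg_rV => j; rewrite mxE.
  rewrite (_ : (fun n => u n 0 j) = pseries (exp_coef F (row j)) t).
    exact: is_cvg_exp_coef.
  by apply/funext => n; rewrite -coordE /= r2vK.
pose lr : {linear 'rV[R]_(dim 'End(V)) -> R^o} := l \o r2v.
rewrite -[LHS]/(lr (limn u)); apply/esym/cvg_lim; first exact: Rhausdorff.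
rewrite (_ : pseries (exp_coef F l) t = lr \o u); last first.
  by apply/funext => n; rewrite -coordE.
apply: continuous_cvg; first exact: linear_rV_continuous.
by rewrite (cvg_lim _ u_cvg).
Qed.

Lemma lfun_exp_derive l (t : R) :
  is_derive (t : R^o) 1 (fun s : R^o => l (lfun_exp ((s : R) *: F)))
    (l (F \o lfun_exp (t *: F))%VF).
Proof.
have lF_lin : linear (fun f : 'End(V) => l (F \o f)%VF).
  by move=> a f h; rewrite comp_lfunDr -comp_lfunZr linearP.
pose lF := linear_of lF_lin.
have diffs (m : {linear 'End(V) -> R^o}) (mF : {linear 'End(V) -> R^o}) :
    (forall f, mF f = m (F \o f)%VF) -> pseries_diffs (exp_coef F m) = exp_coef F mF.
  move=> mFE; apply/funext => k; rewrite /pseries_diffs /exp_coef mFE factS natrM.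
  by rewrite invfM mulrCA mulrA -mulrA mulVKf.
have lF2_lin : linear (fun f : 'End(V) => lF (F \o f)%VF).
  by move=> a f h; rewrite comp_lfunDr -comp_lfunZr linearP.
have d1 : pseries_diffs (exp_coef F l) = exp_coef F lF by apply: diffs.
have d2 : pseries_diffs (exp_coef F lF) = exp_coef F (linear_of lF2_lin) by apply: diffs.
rewrite (_ : (fun s : R^o => l (lfun_exp ((s : R) *: F))) =
    (fun s => limn (pseries (exp_coef F l) s))); last first.
  by apply/funext => s; rewrite lfun_exp_lim.
rewrite -[l _]/(lF (lfun_exp (t *: F))) lfun_exp_lim -d1.
apply: (@pseries_snd_diffs _ _ (`|t| + 1)); rewrite ?d1 ?d2; try exact: is_cvg_exp_coef.
by rewrite [ltRHS]ger0_norm ?addr_ge0 // ltrDl.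
Qed.

Lemma lfun_expC : (F \o lfun_exp F)%VF = (lfun_exp F \o F)%VF.
Proof.
apply: v2r_inj; apply/rowP => j.
have l1_lin : linear (fun f : 'End(V) => v2r (F \o f)%VF 0 j : R^o).
  by move=> a f h; rewrite comp_lfunDr -comp_lfunZr linearP !mxE.
have l2_lin : linear (fun f : 'End(V) => v2r (f \o F)%VF 0 j : R^o).
  by move=> a f h; rewrite comp_lfunDl -comp_lfunZl linearP !mxE.
have := lfun_exp_lim (linear_of l1_lin) 1; rewrite scale1r [X in X = _ -> _]/= => ->.
have := lfun_exp_lim (linear_of l2_lin) 1; rewrite scale1r [X in X = _ -> _]/= => ->.
suff -> : exp_coef F (linear_of l1_lin) = exp_coef F (linear_of l2_lin) by [].
apply: funext => k.
suff E : (F \o lfun_pow F k)%VF = (lfun_pow F k \o F)%VF by rewrite /exp_coef /= E.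
elim: k => [|k IH]; first by rewrite /lfun_pow /= comp_lfun1l comp_lfun1r.
change ((F \o (F \o lfun_pow F k)) = ((F \o lfun_pow F k) \o F))%VF.
by rewrite {1}IH comp_lfunA.
Qed.
End ExpDerivative.

Lemma lfun_exp0 (R : realType) (V : vectType R) : lfun_exp (0 : 'End(V)) = \1%VF.
Proof.
apply: v2r_inj; apply/rowP => j.
have row_lin : linear (fun f : 'End(V) => v2r f 0 j : R^o).
  by move=> a f h; rewrite linearP !mxE.
pose l := linear_of row_lin.
suff : l (lfun_exp ((0 : R) *: (0 : 'End(V)))) = l (\1)%VF by rewrite scale0r.
rewrite lfun_exp_lim; apply: cvg_lim; first exact: Rhausdorff.
rewrite -(cvg_shiftS (pseries _ 0)). rewrite (_ : (fun n => _) = cst (l (\1)%VF)); first exact: cvg_cst.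
apply/funext => n /=; rewrite /pseries /series /= big_nat_recl //= big1 => [|i _].
  by rewrite expr0 mulr1 addr0 /exp_coef fact0 divr1.
by rewrite expr0n mulr0.
Qed.

(** ** Curves in a finite-dimensional space *)
Section VectorDerivative.
Variable R : realType.

(** Derivatives are tested on linear functionals, as a vectType carries no
    topology. *)
Definition vderiv (V : vectType R) (Z : R -> V) (t : R) (v : V) : Prop :=
  forall l : {linear V -> R^o}, is_derive (t : R^o) 1 (fun s : R^o => l (Z s)) (l v).

Lemma vderiv_lin (V W : vectType R) (f : {linear V -> W}) Z t v :
  vderiv Z t v -> vderiv (fun s => f (Z s)) t (f v).
Proof. by move=> h l; apply: (h (l \o f)). Qed.

Lemma vderivD (V : vectType R) (Z Y : R -> V) t z y :
  vderiv Z t z -> vderiv Y t y -> vderiv (fun s => Z s + Y s) t (z + y).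
Proof.
move=> hZ hY l; rewrite linearD.
rewrite (_ : (fun s => _) = (fun s : R^o => l (Z s)) + (fun s : R^o => l (Y s))).
  exact: is_deriveD.
by apply/funext => s; rewrite linearD.
Qed.

Lemma vderiv_sum (V : vectType R) m (Z : 'I_m -> R -> V) t (z : 'I_m -> V) :
  (forall i, vderiv (Z i) t (z i)) ->
  vderiv (fun s => \sum_i Z i s) t (\sum_i z i).
Proof.
move=> h l; rewrite linear_sum.
rewrite (_ : (fun s => _) = \sum_i (fun s : R^o => l (Z i s))).
  by apply: is_derive_sum => i; exact: h.
by apply/funext => s; rewrite linear_sum fct_sumE.
Qed.

Lemma vderivZ (V : vectType R) (a : R -> R^o) (Y : R -> V) t (da : R^o) y :
  is_derive (t : R^o) 1 a da -> vderiv Y t y ->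
  vderiv (fun s => (a s : R) *: Y s) t ((a t : R) *: y + (da : R) *: Y t).
Proof.
move=> ha hY l; rewrite linearP linearZ.
rewrite (_ : (fun s => _) = (a : R^o -> R) * (fun s : R^o => l (Y s) : R)).
  by have := is_deriveM ha (hY l); rewrite [l (Y t) *: da]mulrC.
by apply/funext => s; rewrite linearZ.
Qed.

Lemma vderiv_bilin (U V W : vectType R) (b : U -> V -> W) Z Y t z y :
  (forall v, linear (b^~ v)) -> (forall u, linear (b u)) ->
  vderiv Z t z -> vderiv Y t y ->
  vderiv (fun s => b (Z s) (Y s)) t (b z (Y t) + b (Z t) y).
Proof.
move=> bl br hZ hY.
pose cd i (u : U) : R^o := coord (vbasis fullv) i u.
have ZE u v : b u v = \sum_i (cd i u : R) *: b (vbasis fullv)`_i v.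
  rewrite [in LHS](coord_vbasis (memvf u)) -[b _ v]/(linear_of (bl v) _) linear_sum.
  by apply: eq_bigr => i _; rewrite linearZ.
rewrite (_ : (fun s => _) = fun s => \sum_i (cd i (Z s) : R) *: b (vbasis fullv)`_i (Y s)).
  rewrite addrC !ZE -big_split /=; apply: vderiv_sum => i.
  apply: vderivZ.
    have cd_lin : linear (cd i) by move=> a u u'; rewrite /cd linearP.
    exact: (hZ (linear_of cd_lin)).
  exact: (vderiv_lin (linear_of (br _)) hY).
by apply/funext => s; rewrite ZE.
Qed.

Lemma vderiv_exp (V : vectType R) (F : 'End(V)) t :
  vderiv (fun s => lfun_exp (s *: F)) t (F \o lfun_exp (t *: F))%VF.
Proof. by move=> l; exact: lfun_exp_derive. Qed.

Lemma vderiv_cst (V : vectType R) (Z : R -> V) :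
  (forall t, vderiv Z t 0) -> forall t, Z t = Z 0.
Proof.
move=> h t; apply: v2r_inj; apply/rowP => j.
have row_lin : linear (fun f : V => v2r f 0 j : R^o).
  by move=> a f f'; rewrite linearP !mxE.
pose l := linear_of row_lin.
apply: (@is_derive_0_is_cst R (fun s => l (Z s))) => s.
by have := h s l; rewrite linear0.
Qed.

Lemma vderiv_expE (V : vectType R) (F : 'End(V)) (v : V) t :
  vderiv (fun s => lfun_exp (s *: F) v) t (F (lfun_exp (t *: F) v)).
Proof.
have ev_lin : linear (fun f : 'End(V) => f v).
  by move=> a f h; rewrite add_lfunE scale_lfunE.
by have := vderiv_lin (linear_of ev_lin) (vderiv_exp F t); rewrite /= comp_lfunE.
Qed.

Let exp_ode (V : vectType R) (F : 'End(V)) (Z : R -> V) :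
  (forall t, vderiv Z t (F (Z t))) -> forall t, lfun_exp (- t *: F) (Z t) = Z 0.
Proof.
move=> hZ t.
pose W s := lfun_exp (- s *: F) (Z s).
suff hW s : vderiv W s 0.
  by have := vderiv_cst hW t; rewrite /W oppr0 scale0r lfun_exp0 id_lfunE.
clear t.
pose ap (f : 'End(V)) v := f v.
have h1 v : linear (ap^~ v) by move=> a f h; rewrite /ap add_lfunE scale_lfunE.
have h2 f : linear (ap f) by move=> a u v; rewrite /ap linearP.
have := vderiv_bilin h1 h2 (vderiv_exp (- F) s) (hZ s).
rewrite /ap (_ : (fun s => _) = W); last first.
  by apply/funext => r; rewrite /W scalerN scaleNr.
rewrite comp_lfunE opp_lfunE scalerN -scaleNr.
have -> : F (lfun_exp (- s *: F) (Z s)) = lfun_exp (- s *: F) (F (Z s)).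
  have [->|s0] := eqVneq s 0; first by rewrite oppr0 scale0r lfun_exp0 !id_lfunE.
  have := lfun_expC (- s *: F); rewrite -comp_lfunZl -comp_lfunZr.
  move/(congr1 (fun f => (- s)^-1 *: f)); rewrite !scalerA mulVf ?oppr_eq0 // !scale1r.
  by move/lfunP => /(_ (Z s)); rewrite !comp_lfunE.
by rewrite addNr.
Qed.

Lemma lfun_expN (V : vectType R) (F : 'End(V)) v : lfun_exp (- F) (lfun_exp F v) = v.
Proof.
have := exp_ode (Z := fun s => lfun_exp (s *: F) v) (vderiv_expE F v) 1.
by rewrite scaleN1r scale1r scale0r lfun_exp0 id_lfunE.
Qed.

Lemma lfun_expVN (V : vectType R) (F : 'End(V)) v : lfun_exp F (lfun_exp (- F) v) = v.
Proof. by have := lfun_expN (- F) v; rewrite opprK. Qed.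

(** The curve exp (- t F) (Z t) has derivative zero. *)
Lemma linear_ode_unique (V : vectType R) (F : 'End(V)) (Z : R -> V) :
  (forall t, vderiv Z t (F (Z t))) -> forall t, Z t = lfun_exp (t *: F) (Z 0).
Proof. by move=> hZ t; rewrite -(exp_ode hZ t) scaleNr lfun_expVN. Qed.

(** Both sides, as functions of time, solve the linear equation of F'. *)
Lemma lfun_exp_intertwine (V W : vectType R) (P : 'Hom(V, W)) (F : 'End(V)) (F' : 'End(W)) :
  (forall v, P (F v) = F' (P v)) -> forall v, P (lfun_exp F v) = lfun_exp F' (P v).
Proof.
move=> PF v; have := linear_ode_unique (F := F') (Z := fun s => P (lfun_exp (s *: F) v)).
rewrite scale0r lfun_exp0 id_lfunE => h; have := h _ 1; rewrite !scale1r; apply => t.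
by rewrite -PF; exact: (vderiv_lin P (vderiv_expE F v t)).
Qed.

(** Both sides, as functions of time, solve the linear equation of H.  Hence
    exponentials of antisymmetric maps are isometries, and those of derivations
    are automorphisms. *)
Lemma lfun_exp_bilin (U V W : vectType R) (b : U -> V -> W)
    (F : 'End(U)) (G : 'End(V)) (H : 'End(W)) :
  (forall v, linear (b^~ v)) -> (forall u, linear (b u)) ->
  (forall u v, H (b u v) = b (F u) v + b u (G v)) ->
  forall u v, lfun_exp H (b u v) = b (lfun_exp F u) (lfun_exp G v).
Proof.
move=> bl br HFG u v.
have := linear_ode_unique (F := H)
  (Z := fun s => b (lfun_exp (s *: F) u) (lfun_exp (s *: G) v)).
rewrite !scale0r !lfun_exp0 !id_lfunE => h; have := h _ 1; rewrite !scale1r => -> // t.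
rewrite HFG; exact: (vderiv_bilin bl br (vderiv_expE F u t) (vderiv_expE G v t)).
Qed.
End VectorDerivative.

(** * Orthonormal bases and Fitting projectors *)
Section OrthoBasis.
Variables (R : realType) (V : vectType R) (f : V -> V -> R).
Hypotheses (f_sym : forall x y, f x y = f y x) (f_lin : forall x, linear (f x : V -> R^o)).

Let fD x y z : f x (y + z) = f x y + f x z.
Proof. by have := f_lin x 1 y z; rewrite !scale1r. Qed.
Let f0 x : f x 0 = 0.
Proof. exact: (linear0 (linear_of (f_lin x))). Qed.
Let fZ a x y : f x (a *: y) = a * f x y.
Proof. exact: (linearZ_LR (linear_of (f_lin x)) a y). Qed.
Let fB x y z : f x (y - z) = f x y - f x z.
Proof. exact: (linearB (linear_of (f_lin x))). Qed.

Definition orthonormal (s1 s2 : seq V) : Prop :=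
  [/\ pairwise (fun x y => f x y == 0) (s1 ++ s2),
      forall x, x \in s1 -> f x x = 1 & forall x, x \in s2 -> f x x = -1].

(** Induction on the orthogonal complement of a vector v with f v v <> 0; it
    exists because a symmetric form is determined by its diagonal. *)
Lemma ortho_basis (U : {vspace V}) :
  (forall x, x \in U -> (forall y, y \in U -> f x y = 0) -> x = 0) ->
  exists s1 s2, [/\ orthonormal s1 s2, (size s1 + size s2)%N = \dim U,
    forall x, x \in s1 ++ s2 -> x \in U &
    forall x, x \in U -> x = \sum_(e <- s1 ++ s2) (f e e * f x e) *: e].
Proof.
have [m] := ubnP (\dim U); elim: m U => // m IH U dimU nd.
have [/eqP U0|U0] := boolP (U == 0%VS).
  exists [::], [::]; split=> //; rewrite ?U0 ?dimv0 // => x.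
  by rewrite memv0 => /eqP ->; rewrite big_nil.
have [v vU fv0] : exists2 v, v \in U & f v v != 0.
  apply: contrapT => hn.
  have f2 x : x \in U -> f x x = 0.
    by move=> xU; apply: contrapT => /eqP h; apply: hn; exists x.
  have fxy x y : x \in U -> y \in U -> f x y = 0.
    move=> xU yU; have := f2 _ (memvD xU yU).
    rewrite fD ![f (x + y) _]f_sym !fD !f2 // addr0 add0r [f y x]f_sym => /eqP.
    by rewrite -mulr2n mulrn_eq0 /= => /eqP.
  have /eqP := U0; apply; apply/eqP; rewrite -subv0; apply/subvP => x xU.
  by rewrite memv0; apply/eqP/nd => // y yU; apply: fxy.
pose a := Num.sqrt `|f v v|; have a0 : 0 < a by rewrite sqrtr_gt0 normr_gt0.
pose w := a^-1 *: v; have wU : w \in U by apply: memvZ.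
have ww : f w w = Num.sg (f v v).
  rewrite fZ f_sym fZ mulrA -invfM -expr2 sqr_sqrtr //.
  by rewrite {2}[f v v]numEsg mulrCA mulVf ?mulr1 // normr_eq0.
have ww2 : f w w * f w w = 1 by rewrite ww -expr2 sqr_sg fv0.
pose l := linfun (linear_of (f_lin w)); have lE x : l x = f w x by rewrite lfunE.
pose U' := (U :&: lker l)%VS.
have memU' x : (x \in U') = (x \in U) && (f w x == 0) by rewrite memv_cap memv_ker lE.
have decU x : x \in U -> x - (f w w * f x w) *: w \in U'.
  move=> xU; rewrite memU' memvB ?memvZ //= fB fZ mulrAC ww2 mul1r.
  by rewrite [f x w]f_sym subrr.
have dimU' : \dim U = (\dim U').+1.
  have := limg_ker_dim l U; rewrite -/U'; suff -> : \dim (l @: U) = 1%N by rewrite addn1 => <-.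
  apply/eqP; rewrite eqn_leq; apply/andP; split.
    by rewrite (leq_trans (dimvS (subvf _))) // dimvf.
  rewrite lt0n dimv_eq0; apply/eqP => l0.
  have := memv_img l wU; rewrite l0 memv0 lE => /eqP ww0.
  by have /eqP := ww2; rewrite ww0 mul0r eq_sym oner_eq0.
have U'U x : x \in U' -> x \in U by rewrite memU' => /andP[].
have [|x xU' xy|s1 [s2 [[spair sp sn] ssize sU sexp]]] := IH U'.
- by rewrite dimU' in dimU.
- apply: nd; first exact: U'U.
  move=> y yU; have := xy _ (decU y yU); rewrite fB fZ.
  by move: xU'; rewrite memU' => /andP[_ /eqP]; rewrite f_sym => ->; rewrite mulr0 subr0.
have wperp e : e \in s1 ++ s2 -> f w e = 0.
  by move=> /sU; rewrite memU' => /andP[_ /eqP].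
have expansion x : x \in U -> x = (f w w * f x w) *: w +
    \sum_(e <- s1 ++ s2) (f e e * f x e) *: e.
  move=> xU; rewrite -[x in LHS](subrK ((f w w * f x w) *: w)) addrC; congr (_ + _).
  rewrite [LHS](sexp _ (decU x xU)) big_seq [RHS]big_seq; apply: eq_bigr => e es.
  by rewrite [f (x - _) e]f_sym fB fZ [f e w]f_sym (wperp _ es) mulr0 subr0 [f e x]f_sym.
have perm_w : perm_eq (s1 ++ w :: s2) (w :: s1 ++ s2) by rewrite -[w :: s2]cat1s perm_catCA.
have mem_w x : x \in s1 ++ w :: s2 -> x \in U.
  by rewrite (perm_mem perm_w) in_cons => /predU1P[->//|/sU/U'U].
have wpair : all (fun e => f w e == 0) (s1 ++ s2).
  by apply/allP => e /wperp ->.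
have [fvp|fvn|/eqP] := ltgtP 0 (f v v); last by rewrite eq_sym (negPf fv0).
  exists (w :: s1), s2; split.
  - split=> /= [|x|]; [by rewrite wpair spair| |exact: sn].
    by rewrite in_cons => /predU1P[->|/sp//]; rewrite ww gtr0_sg.
  - by rewrite /= addSn ssize -dimU'.
  - by move=> x /=; rewrite -(perm_mem perm_w); exact: mem_w.
  - by move=> x xU; rewrite /= big_cons; exact: expansion.
exists s1, (w :: s2); split.
- split=> [|//|x]; last by rewrite in_cons => /predU1P[->|/sn//]; rewrite ww ltr0_sg.
  rewrite pairwise_cat /= allrel_consr.
  move: spair wpair; rewrite pairwise_cat all_cat => /and3P[h1 h2 h3] /andP[h4 h5].
  rewrite h1 h2 h3 h5 !andbT /=; apply/allP => e /(allP h4).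
  by rewrite f_sym.
- by rewrite /= addnS ssize -dimU'.
- exact: mem_w.
- by move=> x xU; rewrite (perm_big _ perm_w) big_cons; exact: expansion.
Qed.
End OrthoBasis.

Section Fitting.
Variables (R : realType) (V : vectType R) (C : 'End(V)).

Lemma lfun_powE k x : lfun_pow C k x = iter k C x.
Proof. by rewrite /lfun_pow iter_comp_lfunE. Qed.

Lemma lfun_pow_comm (G : 'End(V)) k : (forall x, G (C x) = C (G x)) ->
  forall x, G (lfun_pow C k x) = lfun_pow C k (G x).
Proof.
move=> GC x; rewrite !lfun_powE; elim: k x => [//|k IH] x.
by rewrite !iterS GC IH.
Qed.

(** E is the projector onto the stable image of C along its stable kernel. *)
Lemma fitting : exists (E : 'End(V)) k, [/\ forall x, E (E x) = E x,
  forall G : 'End(V), (forall x, G (C x) = C (G x)) -> forall x, G (E x) = E (G x),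
  forall x, iter k C (x - E x) = 0,
  forall x, exists y, E x = iter k C y &
  forall x, C x = 0 -> E x = 0].
Proof.
pose I k := limg (lfun_pow C k).
have exI : exists d, `[< exists k, \dim (I k) = d >] by exists (\dim (I 0%N)); apply/asboolP; exists 0%N.
have [d /asboolP[k0 dk0] dmin] := ex_minnP exI.
have powD i j x : lfun_pow C (i + j) x = lfun_pow C i (lfun_pow C j x).
  by rewrite !lfun_powE iterD.
have subI i j : (I (i + j)%N <= I j)%VS.
  apply/subvP => _ /memv_imgP[x _ ->]; rewrite addnC powD.
  by apply: memv_img; apply: memvf.
(* Beyond the index k0 of the smallest image, so that ker C lies in ker C^k
   also when k0 = 0. *)
pose k := k0.+1.
have dimI i : \dim (I (i + k0)%N) = d.
  apply/eqP; rewrite eqn_leq -{1}dk0 (dimvS (subI _ _)) /=.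
  by apply: dmin; apply/asboolP; exists (i + k0)%N.
have Ik i : I (i + k)%N = I k.
  apply/eqP; rewrite eqEdim subI /= /k addnS -addSn dimI.
  by rewrite -(dimI 1%N) add1n.
have dk : \dim (I k) = d by rewrite -(dimI 1%N) add1n.
have imgI i : (lfun_pow C i @: I k)%VS = I k.
  rewrite -[in RHS](Ik i); apply/eqP; rewrite eqEsubv; apply/andP; split.
    apply/subvP => _ /memv_imgP[_ /memv_imgP[x _ ->] ->].
    by rewrite -powD memv_img ?memvf.
  apply/subvP => _ /memv_imgP[x _ ->]; rewrite powD.
  by do 2!apply: memv_img; apply: memvf.
have injI i : (I k :&: lker (lfun_pow C i) = 0)%VS.
  apply/eqP; rewrite -dimv_eq0; have := limg_ker_dim (lfun_pow C i) (I k).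
  by rewrite imgI -[X in _ = X]add0n => /addIn ->.
pose K := lker (lfun_pow C k).
have full : (I k + K)%VS = fullv.
  apply/eqP; rewrite eqEdim subvf /= dimv_disjoint_sum ?injI //.
  by rewrite -(limg_ker_dim (lfun_pow C k) fullv) capfv addnC.
pose E := daddv_pi (I k) K.
have capKI : (K :&: I k = 0)%VS by rewrite capvC injI.
have dec x : E x + daddv_pi K (I k) x = x.
  by rewrite daddv_pi_add ?injI // full memvf.
have EI x : E x \in I k by apply: memv_pi.
have EK x : x - E x \in K by rewrite -{1}(dec x) addrC addKr; apply: memv_pi.
have Eid x : x \in I k -> E x = x by move=> ?; apply: daddv_pi_id; rewrite ?injI.
have E0 x : x \in K -> E x = 0.
  move=> xK; have : E x \in (I k :&: K)%VS.
    rewrite memv_cap EI /=; have := memvB xK (EK x); by rewrite opprB addrC subrK.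
  by rewrite injI memv0 => /eqP.
exists E, k; split.
- by move=> x; apply: Eid.
- move=> G GC x.
  have GI y : y \in I k -> G y \in I k.
    by case/memv_imgP => z _ ->; rewrite lfun_pow_comm // memv_img ?memvf.
  have GK y : y \in K -> G y \in K.
    by rewrite !memv_ker -lfun_pow_comm // => /eqP ->; rewrite linear0.
  rewrite -{2}(subrK (E x) x) linearD /= linearD /= [E (G (x - _))]E0 ?GK //.
  by rewrite add0r [RHS]Eid //; apply: GI; exact: EI.
- by move=> x; have := EK x; rewrite memv_ker lfun_powE => /eqP.
- by move=> x; have /memv_imgP[y _ ->] := EI x; exists y; rewrite lfun_powE.
- by move=> x Cx; apply: E0; rewrite memv_ker lfun_powE /k iterSr Cx -lfun_powE linear0.
Qed.
End Fitting.

(** * Weak extrinsic symmetric triples *)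
Section TripleAlgebra.
Variables (R : realType) (g : vectType R) (br : lieAlgebra g)
  (ip : {bilinear g -> g -> R^o}) (D theta : 'End(g)).
Hypothesis tri : weak_extrinsic_symmetric_triple br ip D theta.
Hypothesis full : full_triple br D theta.
Local Notation ad := (ad br).
Local Notation killing := (killing br).
Implicit Types x y z u v w : g.

Lemma ipC x y : ip x y = ip y x. Proof. exact: (ip_sym tri). Qed.
Lemma ipDl x y z : ip (x + y) z = ip x z + ip y z. Proof. exact: linearDl. Qed.
Lemma ipDr x y z : ip x (y + z) = ip x y + ip x z. Proof. exact: linearD. Qed.
Lemma ipBl x y z : ip (x - y) z = ip x z - ip y z. Proof. exact: linearBl. Qed.
Lemma ipBr x y z : ip x (y - z) = ip x y - ip x z. Proof. exact: linearB. Qed.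
Lemma ipZl (a : R) x y : ip (a *: x) y = a * ip x y. Proof. exact: linearZl_LR. Qed.
Lemma ipZr (a : R) x y : ip x (a *: y) = a * ip x y. Proof. exact: linearZ_LR. Qed.
Lemma ipNl x y : ip (- x) y = - ip x y. Proof. exact: linearNl. Qed.
Lemma ipNr x y : ip x (- y) = - ip x y. Proof. exact: linearN. Qed.
Lemma ip0l x : ip 0 x = 0. Proof. exact: linear0l. Qed.
Lemma ip0r x : ip x 0 = 0. Proof. exact: linear0. Qed.
Lemma ip_suml I (r : seq I) (P : pred I) (F : I -> g) z :
  ip (\sum_(i <- r | P i) F i) z = \sum_(i <- r | P i) ip (F i) z.
Proof. exact: linear_sumlz. Qed.
Lemma ip_sumr I (r : seq I) (P : pred I) (F : I -> g) z :
  ip z (\sum_(i <- r | P i) F i) = \sum_(i <- r | P i) ip z (F i).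
Proof. exact: linear_sum. Qed.

Lemma ip_br x y z : ip (br x y) z = - ip y (br x z).
Proof. by apply/eqP; rewrite -addr_eq0; apply/eqP/(ip_invariant tri). Qed.

Lemma ip_br2 x y z : ip (br x y) z = ip x (br y z).
Proof. by rewrite brC ipNl ip_br opprK. Qed.

Lemma Dbr x y : D (br x y) = br (D x) y + br x (D y).
Proof. exact: (D_derivation tri). Qed.
Lemma ipD x y : ip (D x) y = - ip x (D y).
Proof. exact: (D_antisymmetric tri). Qed.
Lemma D3 x : D (D (D x)) = - D x. Proof. exact: (D_cube tri). Qed.
Lemma thD x : D (theta x) = - theta (D x). Proof. exact: (D_theta tri). Qed.
Lemma thth x : theta (theta x) = x. Proof. exact: (theta_involutive tri). Qed.
Lemma thbr x y : theta (br x y) = br (theta x) (theta y).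
Proof. exact: (theta_automorphism tri). Qed.
Lemma ipth x y : ip (theta x) (theta y) = ip x y.
Proof. exact: (theta_isometric tri). Qed.

(** As D^3 = - D, the group generated by D rotates the image of D. *)
Lemma exp_D (t : R) x : lfun_exp (t *: D) x = x + (sin t *: D x + (1 - cos t) *: D (D x)).
Proof.
pose Z (t : R) := x + (sin t *: D x + (1 - cos t) *: D (D x)).
have Z0 : Z 0 = x by rewrite /Z sin0 cos0 subrr !scale0r !addr0.
rewrite -[x in LHS]Z0 -[RHS]/(Z t); apply/esym/(linear_ode_unique (F := D)) => {}t.
have cst0 w : vderiv (fun _ => w) t 0.
  by move=> l; rewrite linear0; exact: is_derive_cst.
have dsin : is_derive (t : R^o) 1 (sin : R -> R^o) (cos t : R^o) by exact: is_derive_sin.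
have dcos : is_derive (t : R^o) 1 ((fun s => 1 - cos s) : R -> R^o) (sin t : R^o).
  have := is_deriveB (is_derive_cst (1 : R^o) (t : R^o) 1) (is_derive_cos t).
  by rewrite sub0r opprK.
have := vderivD (cst0 x) (vderivD (vderivZ dsin (cst0 (D x))) (vderivZ dcos (cst0 (D (D x))))).
rewrite !scaler0 !add0r /Z !linearD /= !linearZ /= D3.
congr vderiv; rewrite scalerN scalerBl scale1r opprB [RHS]addrC -addrA subrK.
exact: addrC.
Qed.

Lemma tauE x : tau D x = x + 2 *: D (D x).
Proof.
by rewrite /tau exp_D sinpi cospi scale0r add0r opprK.
Qed.

Lemma mem_g_p x : (x \in g_p theta) = (theta x == x).
Proof. by rewrite memv_ker add_lfunE opp_lfunE id_lfunE subr_eq0. Qed.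
Lemma mem_g_m x : (x \in g_m theta) = (theta x == - x).
Proof. by rewrite memv_ker add_lfunE id_lfunE addr_eq0. Qed.
Lemma mem_gt_p x : (x \in gt_p D) = (D x == 0).
Proof.
rewrite memv_ker add_lfunE opp_lfunE id_lfunE tauE addrC addKr scaler_eq0 pnatr_eq0 /=.
apply/eqP/eqP => [h|->]; last exact: linear0.
by apply/eqP; rewrite -oppr_eq0 -D3 h linear0.
Qed.
Lemma mem_gt_m x : (x \in gt_m D) = (D (D x) == - x).
Proof.
rewrite memv_ker add_lfunE id_lfunE tauE addrAC -mulr2n -scaler_nat -scalerDr scaler_eq0.
by rewrite pnatr_eq0 /= addrC addr_eq0.
Qed.

Local Notation T := (g_m_tm D theta).
Local Notation m := (g_p_tm D theta).
Local Notation k := (g_p_tp D theta).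
Local Notation N := (g_m_tp D theta).

Lemma memT x : (x \in T) = (theta x == - x) && (D (D x) == - x).
Proof. by rewrite memv_cap mem_g_m mem_gt_m. Qed.
Lemma memm x : (x \in m) = (theta x == x) && (D (D x) == - x).
Proof. by rewrite memv_cap mem_g_p mem_gt_m. Qed.
Lemma memk x : (x \in k) = (theta x == x) && (D x == 0).
Proof. by rewrite memv_cap mem_g_p mem_gt_p. Qed.
Lemma memN x : (x \in N) = (theta x == - x) && (D x == 0).
Proof. by rewrite memv_cap mem_g_m mem_gt_p. Qed.

Lemma thD' x : theta (D x) = - D (theta x).
Proof. by rewrite thD opprK. Qed.

Lemma DT x : x \in T -> D x \in m.
Proof.
rewrite memT memm => /andP[/eqP h1 _].
by rewrite thD' h1 linearN /= opprK D3 !eqxx.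
Qed.
Lemma Dm x : x \in m -> D x \in T.
Proof.
rewrite memT memm => /andP[/eqP h1 _].
by rewrite thD' h1 D3 !eqxx.
Qed.

Lemma g_dec x : exists xT xm xk xN, [/\ xT \in T, xm \in m, xk \in k & xN \in N] /\
  x = xT + xm + (xk + xN).
Proof.
pose q : R := 2^-1.
have q2 y : q *: y + q *: y = y by rewrite -scalerDl -mulr2n -[q *+ 2]mulr_natr mulVf ?scale1r ?pnatr_eq0.
pose a := - D (D x); pose b := x + D (D x).
have DDa : D (D a) = - a by rewrite /a !linearN /= D3 linearN /= opprK.
have Db : D b = 0 by rewrite /b linearD /= D3 subrr.
have xE : x = a + b by rewrite /a /b addrC addrK.
clearbody a b.
have thDD y : D (D (theta y)) = theta (D (D y)) by rewrite thD linearN /= thD opprK.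
have Dthb : D (theta b) = 0 by rewrite thD Db linear0 oppr0.
exists (q *: (a - theta a)), (q *: (a + theta a)), (q *: (b + theta b)), (q *: (b - theta b)).
split; first split.
- apply: memvZ; rewrite memT; apply/andP; split; apply/eqP.
    by rewrite [theta _]linearB /= thth opprB.
  by rewrite [D (a - _)]linearB /= [D (_ - _)]linearB /= thDD DDa linearN /= -opprD.
- apply: memvZ; rewrite memm; apply/andP; split; apply/eqP.
    by rewrite [theta _]linearD /= thth addrC.
  by rewrite [D (a + _)]linearD /= [D (_ + _)]linearD /= thDD DDa linearN /= -opprD.
- apply: memvZ; rewrite memk; apply/andP; split; apply/eqP.
    by rewrite [theta _]linearD /= thth addrC.
  by rewrite [D _]linearD /= Db Dthb addr0.
- apply: memvZ; rewrite memN; apply/andP; split; apply/eqP.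
    by rewrite [theta _]linearB /= thth opprB.
  by rewrite [D _]linearB /= Db Dthb subr0.
rewrite -!scalerDr.
have e y : y - theta y + (y + theta y) = y + y by rewrite addrACA addNr addr0.
have e' y : y + theta y + (y - theta y) = y + y by rewrite addrC e.
by rewrite e e' !scalerDr !q2 xE.
Qed.

Lemma ip_perp x y : D x = 0 -> D (D y) = - y -> ip x y = 0.
Proof.
move=> Dx DDy; have -> : y = - D (D y) by rewrite DDy opprK.
by rewrite ipNr -ipD Dx ip0l.
Qed.
Lemma ip_perp_th x y : theta x = x -> theta y = - y -> ip x y = 0.
Proof.
move=> hx hy; have := ipth x y; rewrite hx hy ipNr => /eqP.
by rewrite eq_sym -addr_eq0 -mulr2n mulrn_eq0 /= => /eqP.
Qed.
Lemma br_pm x y : D x = 0 -> D (D y) = - y -> D (D (br x y)) = - br x y.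
Proof.
by move=> Dx DDy; rewrite Dbr Dx br0l add0r Dbr Dx br0l add0r DDy brNr.
Qed.
(** The vector u = [x, y] - [D x, D y] satisfies D^2 u = - 4 u, whereas
    D^3 = - D leaves only the eigenvalues 0 and - 1 to D^2; so u = 0. *)
Lemma br_mm x y : D (D x) = - x -> D (D y) = - y ->
  D (br x y) = 0 /\ br (D x) (D y) = br x y.
Proof.
move=> DDx DDy; pose w := br x y; pose w' := br (D x) (D y).
have DDw : D (D w) = (w' - w) + (w' - w).
  rewrite /w Dbr linearD /= !Dbr DDx DDy brNl brNr.
  by rewrite [- br x y + _]addrC.
have DDw' : D (D w') = (w - w') + (w - w').
  rewrite /w' Dbr linearD /= !Dbr D3 D3 DDx DDy !brNl !brNr opprK.
  by rewrite -/w -/w' [- w' + _]addrC.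
pose u := w - w'.
have u4 : D (D u) = - 4 *: u.
  rewrite /u linearB /= linearB /= DDw DDw' -/u.
  have -> : w' - w = - u by rewrite opprB.
  have e4 : 4 *: u = (u + u) + (u + u).
    by rewrite -[RHS]/(u *+ 2 *+ 2) -mulrnA scaler_nat.
  by rewrite scaleNr e4 -!opprD.
have u0 : u = 0.
  have := D3 (D u); rewrite u4 linearZ /= linearZ /= u4 scalerA => /eqP.
  rewrite -subr_eq0 -scaleNr -scalerBl scaler_eq0 => /orP[|/eqP//].
  have -> : -4 * -4 - - -4 = 12 :> R by ring.
  by rewrite pnatr_eq0.
have ww : w' = w by apply/esym/eqP; rewrite -subr_eq0 -/u u0.
split; last exact: ww.
have := D3 w; rewrite DDw ww subrr addr0 linear0 => /eqP.
by rewrite eq_sym oppr_eq0 => /eqP.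
Qed.

Lemma br_mT x y : x \in m -> y \in T -> br x y \in N.
Proof.
rewrite memm memT memN => /andP[/eqP h1 /eqP h2] /andP[/eqP h3 /eqP h4].
have [-> _] := br_mm h2 h4.
by rewrite thbr h1 h3 brNr !eqxx.
Qed.
Lemma br_Nm x y : x \in N -> y \in m -> br x y \in T.
Proof.
rewrite memm memT memN => /andP[/eqP h1 /eqP h2] /andP[/eqP h3 /eqP h4].
by rewrite br_pm // thbr h1 h3 brNl !eqxx.
Qed.

(** Indeed m = D T, k = [m, m], and N = [m, T] by fullness. *)
Lemma gen_T (W : {vspace g}) : (T <= W)%VS -> (forall x, x \in W -> D x \in W) ->
  (forall x y, x \in W -> y \in W -> br x y \in W) -> forall x, x \in W.
Proof.
move=> TW DW brW x; have [xT [xm [xk [xN [[hT hm hk hN] ->]]]]] := g_dec x.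
have mW y : y \in m -> y \in W.
  move=> ym; have := ym; rewrite memm => /andP[_ /eqP h].
  by rewrite -memvN -h; apply: DW; apply: (subvP TW); apply: Dm.
have kW : (k <= W)%VS.
  by rewrite (g_p_tp_generated tri); apply: lie_prod_sub => y z ? ?; apply: brW; apply: mW.
have NW : (N <= W)%VS.
  rewrite full; apply: lie_prod_sub => y z ? ?; apply: brW; first exact: mW.
  exact: (subvP TW).
by do 2!apply: memvD; [exact: (subvP TW)|exact: mW|exact: (subvP kW)|exact: (subvP NW)].
Qed.

(** For z in g^-, the vector [x, z] is in the radical, hence in g^+, but also
    in g^- because x is in g^+; so it vanishes, and T generates g. *)
Lemma ip_radical_central x : (forall y, ip x y = 0) -> forall y, br x y = 0.
Proof.
move=> x0 y; pose W := lker (ad x).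
have Wm z : D (D z) = - z -> br x z = 0.
  move=> DDz; have := ip_radical tri x0; rewrite memN => /andP[_ /eqP Dx].
  have : forall w, ip (br x z) w = 0 by move=> w; rewrite ip_br2 x0.
  move=> /(ip_radical tri); rewrite memN => /andP[_ /eqP h].
  by have := br_pm Dx DDz; rewrite h linear0 => /eqP; rewrite eq_sym oppr_eq0 => /eqP.
have Dx : D x = 0 by have := ip_radical tri x0; rewrite memN => /andP[_ /eqP].
have memW z : (z \in W) = (br x z == 0) by rewrite memv_ker adE.
suff : y \in W by rewrite memW => /eqP.
apply: gen_T => [|z|z w].
- by apply/subvP => z; rewrite memT memW => /andP[_ /eqP/Wm ->].
- rewrite !memW => /eqP h; have := Dbr x z.
  by rewrite h linear0 Dx br0l add0r => <-.
- rewrite !memW => /eqP h1 /eqP h2.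
  by rewrite jacobi_ad h1 h2 br0l br0r addr0.
Qed.

Lemma ipT_nondeg x : x \in T -> (forall y, y \in T -> ip x y = 0) -> x = 0.
Proof.
rewrite memT => /andP[/eqP h1 /eqP h2] h.
have : x \in N.
  apply: (ip_radical tri) => y; have [yT [ym [yk [yN [[hT hm hk hN] ->]]]]] := g_dec y.
  rewrite !ipDr h // add0r.
  move: hm hk hN; rewrite memm memk memN => /andP[/eqP m1 _] /andP[_ /eqP k2] /andP[_ /eqP n2].
  by rewrite ipC (ip_perp_th m1) // add0r ipC (ip_perp k2) // ipC (ip_perp n2) // addr0.
rewrite memN => /andP[_ /eqP Dx]; move/eqP: h2.
by rewrite Dx linear0 eq_sym oppr_eq0 => /eqP.
Qed.
End TripleAlgebra.

(** * The Killing form and the mean curvature *)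
Section TripleKilling.
Variables (R : realType) (g : vectType R) (br : lieAlgebra g)
  (ip : {bilinear g -> g -> R^o}) (D theta : 'End(g)).
Hypothesis tri : weak_extrinsic_symmetric_triple br ip D theta.
Local Notation ad := (ad br).
Local Notation killing := (killing br).
Implicit Types x y z u v w : g.
Local Notation T := (g_m_tm D theta).
Local Notation m := (g_p_tm D theta).
Local Notation k := (g_p_tp D theta).
Local Notation N := (g_m_tp D theta).

Lemma ip_linear x : linear (ip x : g -> R^o).
Proof. by move=> a y z; rewrite linearP. Qed.

Lemma ip_linear_l x : linear (fun y => ip y x : R^o).
Proof. by move=> a y z; rewrite ipDl ipZl. Qed.

Lemma lftr_sum I (r : seq I) (F : I -> 'End(g)) :
  lftr (\sum_(i <- r) F i) = \sum_(i <- r) lftr (F i).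
Proof. by elim/big_ind2: _ => [|x1 x2 y1 y2 <- <-|//]; [exact: linear0|exact: lftrD]. Qed.

Lemma lftr_expansion (F : 'End(g)) (r : seq g) (c : g -> R) (d w : g -> g) :
  (forall x, F x = \sum_(a <- r) (c a * ip x (d a)) *: w a) ->
  lftr F = \sum_(a <- r) c a * ip (w a) (d a).
Proof.
move=> FE.
have G_lin a : linear (fun x => (c a * ip x (d a)) *: w a).
  by move=> b x y; rewrite ipDl ipZl mulrDr scalerDl scalerA mulrCA.
have -> : F = \sum_(a <- r) linfun (linear_of (G_lin a)).
  by apply/lfunP => x; rewrite FE sum_lfunE; apply: eq_bigr => a _; rewrite lfunE.
rewrite lftr_sum; apply: eq_bigr => a _.
apply: (lftr_rank1 (l := fun x => c a * ip x (d a) : R^o)) => [b x y|x].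
  by rewrite ipDl ipZl mulrDr mulrCA.
by rewrite lfunE.
Qed.

Section TangentBasis.
Variable e : seq g.
Hypotheses (eT : forall a, a \in e -> a \in T)
  (e_exp : forall x, x \in T -> x = \sum_(a <- e) (ip a a * ip x a) *: a).

(** For an orthonormal basis e of T: n times the mean curvature vector of the
    orbit at the origin. *)
Definition mean_vector : g := \sum_(a <- e) ip a a *: br (D a) a.
Local Notation H := mean_vector.

Lemma mean_vectorN : H \in N.
Proof.
rewrite /mean_vector big_seq; apply: memv_suml => a ae.
by apply: memvZ; apply: (br_mT tri); [apply: (DT tri)|]; apply: eT.
Qed.

(** The endomorphism is concentrated on g^-, where the vectors a and D a for
    a in e form an orthonormal basis; both halves contribute ip H eta. *)
Lemma trace_ad_D eta : eta \in N -> lftr (ad eta \o D)%VF = 2 * ip H eta.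
Proof.
move=> etaN; have := etaN; rewrite (memN tri) => /andP[_ /eqP Deta].
have De a : a \in e -> D (D a) = - a.
  by move=> /eT; rewrite (memT tri) => /andP[_ /eqP].
pose F := (ad eta \o D)%VF.
have FE x : F x = br eta (D x) by rewrite comp_lfunE adE.
have FD x : F (D x) = D (F x) by rewrite !FE (Dbr tri) Deta br0l add0r.
rewrite -/F; clearbody F.
have FT x : x \in T -> F x = \sum_(a <- e) (ip a a * ip x a) *: F a.
  by move=> /e_exp {1}->; rewrite linear_sum; apply: eq_bigr => a _; rewrite linearZ.
have Fdec x : F x = \sum_(a <- e) (ip a a * ip x a) *: F a
    + \sum_(a <- e) (ip a a * ip x (D a)) *: F (D a).
  have [xT [xm [xk [xN [[hT hm hk hN] xE]]]]] := g_dec tri x.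
  have DxT : D xm \in T by apply: (Dm tri).
  have DDm : D (D xm) = - xm by move: hm; rewrite (memm tri) => /andP[_ /eqP].
  have Dk : D xk = 0 by move: hk; rewrite (memk tri) => /andP[_ /eqP].
  have DN : D xN = 0 by move: hN; rewrite (memN tri) => /andP[_ /eqP].
  have thm : theta xm = xm by move: hm; rewrite (memm tri) => /andP[/eqP].
  have -> : F x = F xT + F xm.
    by rewrite xE !linearD /= [F xk]FE [F xN]FE Dk DN br0r !addr0.
  have -> : F xm = - D (F (D xm)) by rewrite -FD DDm [F (- xm)]linearN opprK.
  rewrite (FT _ hT) (FT _ DxT) linear_sum -sumrN.
  congr (_ + _); rewrite big_seq [RHS]big_seq; apply: eq_bigr => a ae.
    have := eT ae; rewrite (memT tri) => /andP[/eqP tha /eqP DDa].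
    rewrite xE !ipDl (ip_perp_th tri thm tha) (ip_perp tri Dk DDa) (ip_perp tri DN DDa).
    by rewrite !addr0.
  have := eT ae; rewrite (memT tri) => /andP[/eqP tha /eqP DDa].
  have thDa : theta (D a) = D a by rewrite (thD' tri) tha linearN /= opprK.
  have thT : theta xT = - xT by move: hT; rewrite (memT tri) => /andP[/eqP].
  have DDDa : D (D (D a)) = - D a by exact: (D3 tri).
  rewrite linearZ /= -FD (ipD tri) mulrN scaleNr opprK.
  rewrite xE !ipDl (ip_perp tri Dk DDDa) (ip_perp tri DN DDDa).
  by rewrite [ip xT _](ipC tri) (ip_perp_th tri thDa thT) add0r !addr0.
have lin1 (w : g -> g) (c : g -> g) : linear (fun x => \sum_(a <- e) (ip a a * ip x (c a)) *: w a).
  move=> b x y; rewrite scaler_sumr -big_split; apply: eq_bigr => a _.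
  by rewrite ipDl ipZl mulrDr scalerDl scalerA mulrCA.
have -> : F = linfun (linear_of (lin1 F id)) + linfun (linear_of (lin1 (F \o D) D)).
  by apply/lfunP => x; rewrite add_lfunE !lfunE /= Fdec.
rewrite lftrD (@lftr_expansion _ e (fun a => ip a a) id F); last by move=> x; rewrite lfunE.
rewrite (@lftr_expansion _ e (fun a => ip a a) D (F \o D)); last by move=> x; rewrite lfunE.
rewrite /mean_vector ip_suml mulr_sumr -big_split big_seq [RHS]big_seq /=.
apply: eq_bigr => a /De DDa.
have -> : ip (F a) a = ip (br (D a) a) eta by rewrite FE (ip_br2 tri) (ipC tri).
have -> : ip (F (D a)) (D a) = ip (br (D a) a) eta.
  by rewrite FE DDa brNr ipNl (ip_br2 tri) [br a _]brC ipNr opprK (ipC tri).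
by rewrite ipZl mulrCA mulr_natl mulr2n mulrDr.
Qed.

(** As ad v is the commutator of D and ad (- D v), cyclicity turns
    killing u v into the trace of ad (br u (D v)) o D. *)
Lemma killing_T u v : u \in T -> v \in T -> killing u v = - 2 * ip (br H (D u)) v.
Proof.
move=> uT vT.
have [h1 h2] : theta v = - v /\ D (D v) = - v.
  by move: vT; rewrite (memT tri) => /andP[/eqP ? /eqP ?].
have vE : ad v = (D \o ad (- D v))%VF - (ad (- D v) \o D)%VF.
  apply/lfunP => z; rewrite add_lfunE opp_lfunE !comp_lfunE !adE (Dbr tri).
  by rewrite addrK linearN /= h2 opprK.
rewrite !killingE vE.
have -> : (ad u \o ((D \o ad (- D v)) - (ad (- D v) \o D)))%VF =
   (((ad u \o D) \o ad (- D v)) - ((ad u \o ad (- D v)) \o D))%VF.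
  apply/lfunP => z; rewrite !(comp_lfunE, add_lfunE, opp_lfunE) !adE. by rewrite brBr.
rewrite lftrB lftrC comp_lfunA -lftrB.
have -> : (((ad (- D v) \o ad u) \o D) - ((ad u \o ad (- D v)) \o D))%VF = (ad (br u (D v)) \o D)%VF.
  apply/lfunP => z; rewrite !(comp_lfunE, add_lfunE, opp_lfunE) !adE !brNl brNr.
  by rewrite opprK [br u (br (D v) _)]jacobi_ad addrC addrK.
have DvM : D v \in m by apply: (DT tri).
rewrite trace_ad_D; last by rewrite brC memvN; apply: (br_mT tri).
have := mean_vectorN; rewrite (memN tri) => /andP[_ /eqP DH].
rewrite -(ip_br2 tri) -[ip (br H u) _]opprK -(ipD tri) (Dbr tri) DH br0l add0r.
by rewrite mulrN mulNr.
Qed.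
End TangentBasis.
End TripleKilling.

(** * The Casimir endomorphism *)
Section Casimir.
Variables (R : realType) (g : vectType R) (br : lieAlgebra g)
  (ip : {bilinear g -> g -> R^o}) (D theta : 'End(g)).
Hypothesis tri : weak_extrinsic_symmetric_triple br ip D theta.
Hypothesis full : full_triple br D theta.
Local Notation ad := (ad br).
Local Notation killing := (killing br).
Implicit Types x y z u v w : g.
Local Notation T := (g_m_tm D theta).
Local Notation N := (g_m_tp D theta).

Lemma ip_radicalP : exists r : {vspace g}, forall x, (x \in r) <-> (forall y, ip x y = 0).
Proof.
pose f x : 'Hom(g, R^o) := linfun (ip x : g -> R^o).
have fE x y : f x y = ip x y by rewrite lfunE.
have f_lin : linear f.
  by move=> a x y; apply/lfunP => z; rewrite add_lfunE scale_lfunE !fE ipDl ipZl.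
exists (lker (linfun (linear_of f_lin))) => x; rewrite memv_ker lfunE /=.
split=> [/eqP f0 y|h]; first by rewrite -fE f0 zero_lfunE.
by apply/eqP/lfunP => y; rewrite fE h zero_lfunE.
Qed.

(** Take an orthonormal basis of a complement of the radical: the component
    of x in the radical is central. *)
Lemma radical_complement_basis : exists e : seq g,
  forall x y, br x y = \sum_(a <- e) (ip a a * ip x a) *: br a y.
Proof.
have [r rP] := ip_radicalP.
have [|s1 [s2 [_ _ _ hexp]]] := ortho_basis (f := ip) (ipC tri) (ip_linear ip) (U := (r^C)%VS).
  move=> x xU h.
  have : x \in (r :&: r^C)%VS.
    rewrite memv_cap xU andbT; apply/rP => y.
    have : y \in (r + r^C)%VS by rewrite addv_complf memvf.
    move=> /memv_addP[y1 /rP y1r [y2 y2U ->]].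
    by rewrite ipDr [ip x y1](ipC tri) y1r h // addr0.
  by rewrite capv_compl memv0 => /eqP.
exists (s1 ++ s2) => x y.
have : x \in (r + r^C)%VS by rewrite addv_complf memvf.
move=> /memv_addP[x1 /rP x1r [x2 x2U ->]].
rewrite brDl (ip_radical_central tri full x1r) add0r {1}(hexp _ x2U) br_suml.
by apply: eq_bigr => a _; rewrite brZl ipDl x1r add0r.
Qed.

Section WithBasis.
Variable e : seq g.
Hypothesis eP : forall x y, br x y = \sum_(a <- e) (ip a a * ip x a) *: br a y.
Definition casimir : 'End(g) := \sum_(a <- e) ip a a *: (ad a \o ad a)%VF.
Local Notation C := casimir.

Lemma casimirE z : C z = \sum_(a <- e) ip a a *: br a (br a z).
Proof.
by rewrite sum_lfunE; apply: eq_bigr => a _; rewrite scale_lfunE comp_lfunE !adE.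
Qed.

(** Expanding d a in the basis e pairs the coefficients ip (d a) b,
    antisymmetric in a and b, with terms symmetric in a and b. *)
Lemma casimir_derivation (d : 'End(g)) :
  (forall x y, d (br x y) = br (d x) y + br x (d y)) ->
  (forall x y, ip (d x) y = - ip x (d y)) -> forall z, d (C z) = C (d z).
Proof.
move=> dbr dip z; rewrite !casimirE linear_sum.
have -> : \sum_(a <- e) d (ip a a *: br a (br a z)) =
  \sum_(a <- e) ip a a *: br a (br a (d z)) +
  \sum_(a <- e) ip a a *: (br (d a) (br a z) + br a (br (d a) z)).
  rewrite -big_split; apply: eq_bigr => a _ /=.
  rewrite linearZ /= !dbr brDr -scalerDr; congr (_ *: _).
  by rewrite addrA [RHS]addrC.
rewrite [X in _ + X](_ : _ = 0) ?addr0 //.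
under eq_bigr do rewrite scalerDr.
rewrite big_split /=.
rewrite [X in X + _](_ : _ = \sum_(a <- e) \sum_(b <- e) (ip a a * ip b b * ip (d a) b) *: br b (br a z)); last first.
  apply: eq_bigr => a _; rewrite (eP (d a)) scaler_sumr; apply: eq_bigr => b _.
  by rewrite scalerA mulrA.
rewrite [X in _ + X](_ : _ = \sum_(a <- e) \sum_(b <- e) (ip a a * ip b b * ip (d a) b) *: br a (br b z)); last first.
  apply: eq_bigr => a _; rewrite (eP (d a)) br_sumr scaler_sumr; apply: eq_bigr => b _.
  by rewrite brZr scalerA mulrA.
rewrite exchange_big -big_split big1 // => a _; rewrite -big_split big1 // => b _ /=.
by rewrite -scalerDl [ip (d b) a]dip [ip b (d a)](ipC tri) [ip b b * _]mulrC mulrN addNr scale0r.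
Qed.

Lemma casimir_ad y z : C (br y z) = br y (C z).
Proof.
have := @casimir_derivation (ad y) _ _ z; rewrite !adE => -> // => [a b|a b].
  by rewrite !adE jacobi_ad.
by rewrite !adE (ip_br tri).
Qed.

Lemma casimir_br y z : br (C y) z = C (br y z).
Proof. by rewrite brC -casimir_ad [br z y]brC linearN /= opprK. Qed.

Lemma casimir_D z : C (D z) = D (C z).
Proof. by rewrite (casimir_derivation (Dbr tri) (ipD tri)). Qed.

(** The Casimir endomorphism is the same for the orthonormal family
    theta e. *)
Lemma casimir_theta z : C (theta z) = theta (C z).
Proof.
rewrite !casimirE linear_sum.
have thE b w : br b w = \sum_(a <- e) (ip a a * ip (theta a) b) *: br (theta a) w.
  rewrite -[br b w](thth tri) (thbr tri) (eP (theta b)) linear_sum.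
  apply: eq_bigr => a _; rewrite linearZ /= (thbr tri) (thth tri) -(ipth tri (theta b)).
  by rewrite (thth tri) [ip b _](ipC tri).
transitivity (\sum_(a <- e) \sum_(b <- e) (ip a a * ip b b * ip (theta b) a) *:
    br a (br (theta b) (theta z))).
  apply: eq_bigr => a _; rewrite {1}(thE a (theta z)) br_sumr scaler_sumr.
  by apply: eq_bigr => b _; rewrite brZr scalerA mulrA.
rewrite exchange_big; apply: eq_bigr => b _ /=.
rewrite linearZ /= !(thbr tri) (eP _ (br _ _)) scaler_sumr; apply: eq_bigr => a _.
by rewrite scalerA mulrA [ip a a * _]mulrC.
Qed.

Lemma casimir_center z : (forall y, br z y = 0) -> C z = 0.
Proof.
move=> zC; rewrite casimirE big1 // => a _.
by rewrite [br a z]brC zC oppr0 br0r scaler0.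
Qed.

Lemma casimir_killing x y : ip (C x) y = killing x y.
Proof.
rewrite !killingE.
rewrite (@lftr_expansion _ _ ip _ e (fun a => ip a a) id (ad x \o ad y)%VF).
  rewrite casimirE ip_suml; apply: eq_bigr => a _.
  rewrite ipZl comp_lfunE !adE; congr (_ * _).
  by rewrite !(ip_br tri _ (br _ _)) (ipC tri) [br a y]brC [br a x]brC ipNl ipNr opprK.
move=> z; rewrite comp_lfunE !adE [br y z]brC brNr (eP z) br_sumr -sumrN.
apply: eq_bigr => a _.
by rewrite comp_lfunE !adE [br a y]brC scalerN brNr brZr opprK.
Qed.

Lemma casimir_sym x y : ip (C x) y = ip x (C y).
Proof. by rewrite casimir_killing killingC -casimir_killing (ipC tri). Qed.

(** As ad (C u) = C o ad u, killing (C u) y is the trace of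
    C o ad u o ad y, nilpotent with C.  So C (C u) is in the radical of ip,
    which meets T trivially. *)
Lemma casimir_nilpotent k : (forall x, iter k C x = 0) ->
  forall u, u \in T -> C (C u) = 0.
Proof.
move=> Ck u uT.
have Cu0 y : ip (C (C u)) y = 0.
  rewrite casimir_killing !killingE; apply: (@lftr_nilpotent _ _ k) => z.
  pose F := (ad u \o ad y)%VF.
  have FC x : F (C x) = C (F x) by rewrite !comp_lfunE !adE -!casimir_ad.
  have -> : iter k (ad (C u) \o ad y)%VF z = iter k C (iter k F z).
    elim: k {Ck} => // k IH; rewrite iterS IH iterSr.
    rewrite comp_lfunE !adE casimir_br.
    have -> : C (br u (br y (iter k C (iter k F z)))) = C (F (iter k C (iter k F z))).
      by rewrite comp_lfunE !adE.
    have -> : F (iter k C (iter k F z)) = iter k C (F (iter k F z)).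
      by elim: k {IH} (iter k F z) => // k IH w; rewrite !iterS FC IH.
    by rewrite -iterS -[in RHS]iterSr.
  exact: Ck.
have := ip_radical tri Cu0; rewrite (memN tri) => /andP[_ /eqP].
move: uT; rewrite (memT tri) -!casimir_D => /andP[_ /eqP DDu].
move=> h; have : C (C (D (D u))) = 0 by rewrite casimir_D casimir_D h linear0.
by rewrite DDu !linearN /= => /eqP; rewrite oppr_eq0 => /eqP.
Qed.
End WithBasis.
End Casimir.

(** * The Fitting projector of the Casimir endomorphism *)
Section Splitting.
Variables (R : realType) (g : vectType R) (br : lieAlgebra g)
  (ip : {bilinear g -> g -> R^o}) (D theta : 'End(g)).
Hypothesis tri : weak_extrinsic_symmetric_triple br ip D theta.
Hypothesis full : full_triple br D theta.
Local Notation killing := (killing br).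
Implicit Types x y z u v w : g.
Local Notation T := (g_m_tm D theta).
Local Notation N := (g_m_tp D theta).
Variable e : seq g.
Hypotheses (eT : forall a, a \in e -> a \in T)
  (e_exp : forall x, x \in T -> x = \sum_(a <- e) (ip a a * ip x a) *: a).
Local Notation H := (mean_vector br ip D e).

Lemma killing_theta x y : killing (theta x) y = killing x (theta y).
Proof.
pose th : 'End(g) := theta.
have adth z : ad br (theta z) = ((th \o ad br z) \o th)%VF.
  by apply/lfunP => w; rewrite !comp_lfunE !adE (thbr tri) (thth tri).
rewrite !killingE !adth -[((th \o _) \o th)%VF]comp_lfunA -comp_lfunA lftrC.
by congr lftr; apply/lfunP => w; rewrite !comp_lfunE.
Qed.

Lemma killing_D x y : killing (D x) y = - killing x (D y).
Proof.
have adD z : ad br (D z) = (D \o ad br z)%VF - (ad br z \o D)%VF.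
  by apply/lfunP => w; rewrite add_lfunE opp_lfunE !comp_lfunE !adE (Dbr tri) addrK.
rewrite !killingE !adD.
have -> : (((D \o ad br x) - (ad br x \o D)) \o ad br y)%VF =
   (D \o (ad br x \o ad br y))%VF - ((ad br x \o D) \o ad br y)%VF.
  by apply/lfunP => w; rewrite !(comp_lfunE, add_lfunE, opp_lfunE).
have -> : (ad br x \o ((D \o ad br y) - (ad br y \o D)))%VF =
   ((ad br x \o D) \o ad br y)%VF - ((ad br x \o ad br y) \o D)%VF.
  by apply/lfunP => w; rewrite !(comp_lfunE, add_lfunE, opp_lfunE) linearB.
by rewrite !lftrB opprB lftrC.
Qed.

(** By invariance under theta and D, the Killing form pairs T with T only. *)
Lemma shape_injective : lie_semisimple br ->
  forall u, u \in T -> br H (D u) = 0 -> u = 0.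
Proof.
move=> ss u uT Hu; apply: (semisimple_killing ss) => y.
have [yT [ym [yk [yN [[hT hm hk hN] ->]]]]] := g_dec tri y.
have kD a b : killing u (a + b) = killing u a + killing u b by rewrite linearD.
have := uT; rewrite (memT tri) => /andP[/eqP thu /eqP DDu].
have kNl z w : killing (- z) w = - killing z w.
  by rewrite killingC linearN /= killingC.
have D0 z : D z = 0 -> killing u z = 0.
  by move=> Dz; rewrite -[u]opprK -DDu kNl killing_D Dz linear0 !oppr0.
rewrite !kD (killing_T tri eT e_exp uT hT) Hu ip0l mulr0 add0r.
rewrite (D0 yk) ?(D0 yN) ?addr0 //.
- have := killing_theta u ym; rewrite thu kNl.
  move: hm; rewrite (memm tri) => /andP[/eqP -> _] /eqP.
  by rewrite eq_sym -addr_eq0 -mulr2n mulrn_eq0 /= => /eqP.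
- by move: hN; rewrite (memN tri) => /andP[_ /eqP].
by move: hk; rewrite (memk tri) => /andP[_ /eqP].
Qed.

(** What the splitting of the orbit needs from the Fitting projector of the
    Casimir endomorphism. *)
Record splitting_projector (E : 'End(g)) : Prop := SplittingProjector {
  E_idem : forall x, E (E x) = E x;
  E_D : forall x, E (D x) = D (E x);
  E_theta : forall x, E (theta x) = theta (E x);
  E_br : forall x y, E (br x y) = br x (E y);
  E_brl : forall x y, E (br x y) = br (E x) y;
  E_sym : forall x y, ip (E x) y = ip x (E y);
  E_center : forall x, (forall y, br x y = 0) -> E x = 0;
  E_neq0 : exists2 u, u \in T & E u <> 0;
  E_full : (forall u, u \in T -> E u = u) -> lie_semisimple br
}.

(** By killing_T the Casimir endomorphism C is - 2 times u |-> [H, D u] on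
    T, so it is not nilpotent, and its Fitting projector E is non-zero.  If E is
    the identity then C is injective, while C^2 kills the radical of the Killing
    form. *)
Lemma splitting : (exists2 u, u \in T & br H (D (br H (D u))) <> 0) ->
  exists E, splitting_projector E.
Proof.
move=> [u uT Au]; have [c cP] := radical_complement_basis tri full.
pose C := casimir br ip c.
have [E [k [EE Ecomm Cnil Eim E0]]] := fitting C.
have Eb x y : E (br x y) = br x (E y).
  rewrite -(adE br x) -(adE br x (E y)); apply/esym/Ecomm => z.
  by rewrite !adE (casimir_ad tri cP).
have Ebl x y : E (br x y) = br (E x) y by rewrite brC linearN /= Eb -brC.
have ED x : E (D x) = D (E x) by apply/esym/Ecomm => z; rewrite (casimir_D tri cP).
have Eth x : E (theta x) = theta (E x).
  by apply/esym/Ecomm => z; rewrite (casimir_theta tri cP).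
have perp x y : ip (E x) (y - E y) = 0.
  have [z ->] := Eim x.
  have -> : ip (iter k C z) (y - E y) = ip z (iter k C (y - E y)).
    elim: k {Cnil Eim} z => // k IH z.
    by rewrite iterSr IH (casimir_sym tri cP) // -iterS.
  by rewrite Cnil ip0r.
have Esym x y : ip (E x) y = ip x (E y).
  have h a b : ip (E a) b = ip (E a) (E b).
    by apply/eqP; rewrite -subr_eq0 -ipBr perp.
  by rewrite (h x y) [RHS](ipC tri) (h y x) (ipC tri).
have memK (F : 'End(g)) x : (x \in lker F) = (F x == 0) by rewrite memv_ker.
have CT v : v \in T -> C v = - 2 *: br H (D v).
  move=> vT; have := vT; rewrite (memT tri) => /andP[/eqP thv /eqP DDv].
  have HDv : br H (D v) \in T.
    by apply: (br_Nm tri); [exact: (mean_vectorN tri eT)|exact: (DT tri)].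
  have CvT : C v \in T.
    rewrite (memT tri) -(casimir_theta tri cP) // -!(casimir_D tri cP) // thv DDv.
    by rewrite linearN /= !eqxx.
  apply/eqP; rewrite -subr_eq0; apply/eqP; apply: (ipT_nondeg tri) => [|w wT].
    by apply: memvB => //; apply: memvZ.
  rewrite ipBl ipZl (casimir_killing tri cP) //.
  by rewrite (killing_T tri eT e_exp vT wT) subrr.
exists E; split=> //.
- by move=> x hx; apply/E0/casimir_center.
- apply: contrapT => h; apply: Au.
  have ET v : v \in T -> E v = 0.
    by move=> vT; apply: contrapT => Ev; apply: h; exists v.
  have Ez x : E x = 0.
    apply/eqP; rewrite -memK; apply: (gen_T tri full) => [|z|z w].
    - by apply/subvP => z /ET; rewrite memK => ->.
    - by rewrite !memK ED => /eqP ->; rewrite linear0.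
    - by rewrite !memK Eb => _ /eqP ->; rewrite br0r.
  have Ck x : iter k C x = 0 by rewrite -(Cnil x) Ez subr0.
  have := casimir_nilpotent tri cP Ck uT.
  rewrite (CT _ uT) linearZ /= CT; last first.
    by apply: (br_Nm tri); [exact: (mean_vectorN tri eT)|exact: (DT tri)].
  move=> /eqP; rewrite scalerA scaler_eq0 mulf_eq0 oppr_eq0 pnatr_eq0 /=.
  by move=> /eqP.
move=> Eid; have E1 x : E x = x.
  apply/eqP; rewrite -subr_eq0.
  have -> : E x - x = (E - \1)%VF x by rewrite add_lfunE opp_lfunE id_lfunE.
  have mem1 z : (z \in lker (E - \1)%VF) = (E z == z).
    by rewrite memv_ker add_lfunE opp_lfunE id_lfunE subr_eq0.
  rewrite -memK; apply: (gen_T tri full) => [|z|z w].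
  - by apply/subvP => z /Eid; rewrite mem1 => ->.
  - by rewrite !mem1 ED => /eqP ->.
  - by rewrite !mem1 Eb => _ /eqP ->.
have Cinj x : C x = 0 -> x = 0 by move=> /E0; rewrite E1.
apply: killing_semisimple => x kx; apply: (Cinj x); apply: (Cinj (C x)).
apply: (casimir_center ip) => y; apply: (ip_radical_central tri full) => z.
by rewrite (casimir_killing tri cP).
Qed.
End Splitting.

(** * The transvection group acting on the orbit of the origin *)
Section Orbit.
Variables (R : realType) (g : vectType R) (br : lieAlgebra g)
  (ip : {bilinear g -> g -> R^o}) (D theta : 'End(g)).
Hypothesis tri : weak_extrinsic_symmetric_triple br ip D theta.
Local Notation ad := (ad br).
Implicit Types x y z u v w X : g.
Local Opaque lfun_exp.
Local Notation exp_phi := (exp_phi br D).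
Local Notation orbit := (orbit_of_0 br D theta).

(** The linear vector field on g x R that restricts to phi X at height 1. *)
Definition aff_gen X : 'End((g * R^o)%type) :=
  linfun (fun z : g * R^o => (br X z.1 - (z.2 : R) *: D X, 0 : R^o)).

Lemma aff_genE X (z : g * R^o) : aff_gen X z = (br X z.1 - (z.2 : R) *: D X, 0 : R^o).
Proof.
have h : linear (fun z : g * R^o => (br X z.1 - (z.2 : R) *: D X, 0 : R^o) : g * R^o).
  move=> a u v; congr pair => /=; last by rewrite -[a *: 0]/(a * 0) mulr0 addr0.
  rewrite brDr brZr scalerDl -[a *: u.2]/(a * (u.2 : R)) -scalerA scalerBr opprD.
  by rewrite addrACA.
exact: (lfunE (linear_of h) z).
Qed.

Lemma exp_phiE X y : exp_phi X y = (lfun_exp (aff_gen X) (y, 1 : R^o)).1.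
Proof. by []. Qed.
Local Opaque Defs.exp_phi aff_gen.

Lemma exp_ker (V : vectType R) (F : 'End(V)) (w : V) : F w = 0 -> lfun_exp F w = w.
Proof.
move=> Fw; have h : linear (fun s : R^o => (s : R) *: w).
  by move=> a s t; rewrite scalerDl -[a *: s]/(a * (s : R)) scalerA.
pose P : 'Hom(R^o, V) := linfun (linear_of h).
have PE s : P s = (s : R) *: w by rewrite lfunE.
have := @lfun_exp_intertwine _ _ _ P 0 F _ 1.
rewrite lfun_exp0 id_lfunE PE scale1r => <- // s.
by rewrite zero_lfunE linear0 PE linearZ /= Fw scaler0.
Qed.

Lemma exp_aff2 X (z : g * R^o) : (lfun_exp (aff_gen X) z).2 = z.2.
Proof.
have h : linear (fun s : g * R^o => s.2 : R^o) by [].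
pose P : 'Hom((g * R^o)%type, R^o) := linfun (linear_of h).
have PE s : P s = s.2 by rewrite lfunE.
have := @lfun_exp_intertwine _ _ _ P (aff_gen X) 0 _ z.
rewrite !PE lfun_exp0 id_lfunE; apply=> v.
by rewrite PE aff_genE zero_lfunE.
Qed.

Lemma exp_affE X y : lfun_exp (aff_gen X) (y, 1 : R^o) = (exp_phi X y, 1 : R^o).
Proof. by rewrite exp_phiE; case: (lfun_exp _ _) (exp_aff2 X (y, 1 : R^o)) => a b /= ->. Qed.

Lemma exp_aff0 X y : lfun_exp (aff_gen X) (y, 0 : R^o) = (lfun_exp (ad X) y, 0 : R^o).
Proof.
have h : linear (fun y : g => (y, 0 : R^o) : g * R^o).
  by move=> a u v; congr pair; rewrite /= -[a *: 0]/(a * 0) mulr0 addr0.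
pose P : 'Hom(g, (g * R^o)%type) := linfun (linear_of h).
have PE s : P s = (s, 0) by rewrite lfunE.
have := @lfun_exp_intertwine _ _ _ P (ad X) (aff_gen X) _ y.
rewrite !PE => <- // v.
by rewrite !PE aff_genE /= scale0r subr0 adE.
Qed.

Lemma exp_phiD X y z : exp_phi X (y + z) = lfun_exp (ad X) z + exp_phi X y.
Proof.
have yzE : (y + z, 1 : R^o) = (z, 0 : R^o) + (y, 1 : R^o) :> g * R^o.
  by congr pair; rewrite /= ?add0r // addrC.
have e : lfun_exp (aff_gen X) (y + z, 1 : R^o) =
    (lfun_exp (ad X) z, 0 : R^o) + (exp_phi X y, 1 : R^o).
  by rewrite -exp_aff0 -exp_affE yzE linearD.
by rewrite exp_phiE e.
Qed.

Lemma aff_genN X : aff_gen (- X) = - aff_gen X.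
Proof.
apply/lfunP => z; rewrite opp_lfunE !aff_genE; congr pair; rewrite /= ?oppr0 //.
by rewrite brNl linearN scalerN opprB opprK addrC.
Qed.

Lemma exp_phiNK X y : exp_phi (- X) (exp_phi X y) = y.
Proof. by rewrite exp_phiE -exp_affE aff_genN lfun_expN. Qed.

Lemma exp_phiVK X y : exp_phi X (exp_phi (- X) y) = y.
Proof. by rewrite -{1}[X]opprK exp_phiNK. Qed.

(** The map P x id intertwines the linear vector fields of X and X' on
    g x R. *)
Lemma exp_phi_intertwine (P : 'End(g)) X X' :
  (forall z, P (br X z) = br X' (P z)) -> P (D X) = D X' ->
  forall y, P (exp_phi X y) = exp_phi X' (P y).
Proof.
move=> Pb PD y.
have h : linear (fun z : g * R^o => (P z.1, z.2) : g * R^o).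
  by move=> a u v; congr pair; rewrite /= linearP.
pose Q : 'End((g * R^o)%type) := linfun (linear_of h).
have QE s : Q s = (P s.1, s.2) by rewrite lfunE.
clearbody Q.
have e : Q (lfun_exp (aff_gen X) (y, 1 : R^o)) = lfun_exp (aff_gen X') (Q (y, 1 : R^o)).
  apply: lfun_exp_intertwine => v; rewrite !QE !aff_genE; congr pair.
  by rewrite /= linearB linearZ /= Pb PD.
have Qy : Q (y, 1 : R^o) = (P y, 1 : R^o) by rewrite QE.
have e1 := etrans (congr1 Q (esym (exp_affE X y))) (etrans e (congr1 (lfun_exp (aff_gen X')) Qy)).
exact: (congr1 fst (etrans (esym (QE _)) (etrans e1 (exp_affE X' (P y))))).
Qed.

Lemma exp_phi_m X y : X \in g_p theta -> y \in g_m theta -> exp_phi X y \in g_m theta.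
Proof.
rewrite mem_g_p !mem_g_m => /eqP thX /eqP thy.
have h : (- theta)%VF (exp_phi X y) = exp_phi X ((- theta)%VF y).
  apply: exp_phi_intertwine => [z|].
    by rewrite !opp_lfunE (thbr tri) thX brNr.
  by rewrite opp_lfunE (thD' tri) thX opprK.
by rewrite !opp_lfunE thy opprK in h; rewrite -[theta _]opprK h.
Qed.

Lemma orbit_m y : orbit y -> y \in g_m theta.
Proof. by elim=> [|X z hX _ IH]; [exact: mem0v|exact: exp_phi_m]. Qed.

Section Flow.
Variable X : g.
Hypothesis hX : X \in g_p theta.
Local Notation eX := (lfun_exp (ad X)).

Lemma exp_ad_m y : y \in g_m theta -> eX y \in g_m theta.
Proof.
move: hX; rewrite mem_g_p !mem_g_m => /eqP thX /eqP thy.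
rewrite (@lfun_exp_intertwine _ _ _ theta (ad X) (ad X)) ?thy ?linearN //.
by move=> v; rewrite !adE (thbr tri) thX.
Qed.

Lemma exp_ad_isometry y z : ip (eX y) (eX z) = ip y z.
Proof.
have := @lfun_exp_bilin _ _ _ _ (fun u v => ip u v) (ad X) (ad X) 0 (ip_linear_l ip) (ip_linear ip) _ y z.
rewrite lfun_exp0 id_lfunE => <- // u v.
by rewrite zero_lfunE !adE (ip_br tri) addNr.
Qed.

(** The exponentials of aff_gen X and of ad X preserve the bilinear map
    ((y, s), z) |-> s D z + [y, z]; this is its value at height s = 1. *)
Lemma exp_ad_transport y z :
  eX (D z + br y z) = D (eX z) + br (exp_phi X y) (eX z).
Proof.
pose b (w : g * R^o) v := (w.2 : R) *: D v + br w.1 v.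
have h1 v : linear (b^~ v).
  move=> a w1 w2; rewrite /b /= scalerDl brDl brZl -[a *: w1.2]/(a * (w1.2 : R)).
  by rewrite scalerDr scalerA addrACA.
have h2 (w : g * R^o) : linear (b w).
  move=> a u v; rewrite /b linearP brDr brZr !scalerDr !scalerA [w.2 * a]mulrC.
  by rewrite addrACA.
have := @lfun_exp_bilin _ _ _ _ b (aff_gen X) (ad X) (ad X) h1 h2 _ (y, 1) z.
rewrite exp_affE /b !scale1r; apply=> w v; rewrite aff_genE /= !adE scale0r add0r.
rewrite brDr brZr (Dbr tri) [br X (br _ _)]jacobi_ad brDl brNl brZl scalerDr.
have ac (p q a c : g) : a - q + (q + p + c) = p + (a + c).
  by rewrite -[q + p + c]addrA [a - q + _]addrA subrK addrCA.
exact/esym/ac.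
Qed.
End Flow.

(** This is D^3 = - D at the origin, and exp_ad_transport conjugates D + ad y
    into D + ad (exp_phi X y). *)
Lemma orbit_cubic y : orbit y -> forall z, let P z := D z + br y z in
  P (P (P z)) = - P z.
Proof.
elim=> [|X {}y hX _ IH] z P; first by rewrite /P !br0l !addr0 (D3 tri).
have PE v : P (lfun_exp (ad X) v) = lfun_exp (ad X) (D v + br y v).
  by rewrite exp_ad_transport.
rewrite -[z](lfun_expVN (ad X)) !PE.
by have /= -> := IH (lfun_exp (- ad X) z); rewrite linearN.
Qed.

Section OrbitSplitting.
Variable E : 'End(g).
Hypotheses (EE : forall x, E (E x) = E x) (E_D : forall x, E (D x) = D (E x))
  (E_th : forall x, E (theta x) = theta (E x))
  (E_b : forall x y, E (br x y) = br x (E y)) (E_bl : forall x y, E (br x y) = br (E x) y).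

Lemma proj_g_p X : X \in g_p theta -> E X \in g_p theta.
Proof. by rewrite !mem_g_p -E_th => /eqP ->. Qed.

Lemma exp_phi_proj X y : E (exp_phi X y) = exp_phi (E X) (E y).
Proof. by apply: exp_phi_intertwine => // z; rewrite -E_bl -E_b EE. Qed.

Lemma exp_phi_projE X y : exp_phi (E X) y = E (exp_phi X y) + (y - E y).
Proof.
have -> : exp_phi (E X) y = exp_phi (E X) (E y + (y - E y)) by rewrite addrC subrK.
rewrite exp_phiD exp_phi_proj addrC; congr (_ + _); apply: exp_ker.
by rewrite adE -E_bl E_b linearB /= EE subrr br0r.
Qed.

Lemma orbit_proj y : orbit y -> orbit (E y).
Proof.
elim=> [|X {}y hX _ IH]; first by rewrite linear0; exact: orbit_of_0_base.
by rewrite exp_phi_proj; apply: orbit_of_0_step => //; exact: proj_g_p.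
Qed.
End OrbitSplitting.

(** With F = 1 - E: when y' moves by exp_phi X, the point E y + F y' moves by
    exp_phi (F X), which does not affect its E-component. *)
Lemma orbit_split (E : 'End(g)) : (forall x, E (E x) = E x) ->
  (forall x, E (D x) = D (E x)) -> (forall x, E (theta x) = theta (E x)) ->
  (forall x y, E (br x y) = br x (E y)) -> (forall x y, E (br x y) = br (E x) y) ->
  forall y y', orbit y -> orbit y' -> orbit (E y + (y' - E y')).
Proof.
move=> EE ED Eth Eb Ebl y y' hy.
elim=> [|X {}y' hX _ IH].
  by rewrite linear0 subr0 addr0; apply: orbit_proj.
pose F : 'End(g) := (\1 - E)%VF.
have FE x : F x = x - E x by rewrite add_lfunE opp_lfunE id_lfunE.
have FF x : F (F x) = F x by rewrite !FE linearB /= EE subrr subr0.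
have FD x : F (D x) = D (F x) by rewrite !FE linearB /= ED.
have Fb x z : F (br x z) = br x (F z) by rewrite !FE brBr Eb.
have Fbl x z : F (br x z) = br (F x) z by rewrite !FE brBl Ebl.
have Fth x : F (theta x) = theta (F x) by rewrite !FE linearB /= Eth.
pose w := E y + (y' - E y').
have Fw : F w = F y' by rewrite /w linearD /= !FE EE subrr add0r linearB /= EE subrr subr0.
have -> : E y + (exp_phi X y' - E (exp_phi X y')) = exp_phi (F X) w.
  rewrite exp_phi_projE // addrC Fw -FE.
  by rewrite [F (exp_phi X w)]exp_phi_proj // Fw -exp_phi_proj // FE /w FE addrK.
by apply: orbit_of_0_step => //; apply: proj_g_p.
Qed.
End Orbit.

(** * Smooth maps *)
Section Differentiable.
Variables (R : realType) (V W : normedModType R).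
Implicit Types (f g : V -> W) (x v : V).

Lemma differentiable_epsP f x (L : {linear V -> W}) : continuous L ->
  (forall e : R, 0 < e -> \forall h \near (0 : V),
     `|f (h + x) - (f x + L h)| <= e * `|h|) ->
  differentiable f x /\ 'd f x = L :> (V -> W).
Proof.
move=> Lc hL.
have fE : f \o shift x = cst (f x) + L +o_ 0 id.
  by apply/eqaddoE/eqaddoP => e e0; apply: hL.
have dE : 'd f x = L :> (V -> W) by apply: diff_unique.
by split=> //; apply/diff_locallyP; rewrite dE.
Qed.

Lemma differentiable_eps f x : differentiable f x ->
  forall e : R, 0 < e -> \forall h \near (0 : V),
     `|f (h + x) - (f x + 'd f x h)| <= e * `|h|.
Proof.
by move=> /diff_locallyP[_ /eqaddoP h] e e0; apply: h.
Qed.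

Lemma near_eq_differentiable f g x : {near x, f =1 g} ->
  differentiable f x -> differentiable g x.
Proof.
move=> fg df; have fgx : f x = g x by exact: (nbhs_singleton fg).
have fg0 : \forall h \near (0 : V), f (h + x) = g (h + x).
  by have := (near_shift 0 x (fun y => f y = g y)); rewrite subr0 => <-.
apply: (differentiable_epsP (L := 'd f x) _ _).1 => [|e e0].
  exact: diff_continuous.
near=> h; rewrite -fgx.
have <- : f (h + x) = g (h + x) by near: h.
by near: h; apply: differentiable_eps.
Unshelve. all: by end_near. Qed.
End Differentiable.

Section CkBasics.
Variables (R : realType) (V W : normedModType R).
Implicit Types (f g : V -> W) (x v : V) (U : set V) (k : nat).

Lemma Ck_on_eq k U f g : open U -> (forall x, U x -> f x = g x) ->
  Ck_on k U f -> Ck_on k U g.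
Proof.
move=> oU; elim: k f g => [|k IH] f g fg /=.
  move=> fc x Ux; rewrite /prop_for /continuous_at -fg //.
  apply: cvg_trans (fc x Ux); apply: near_eq_cvg.
  by near=> y; apply: fg; near: y; exact: open_nbhs_nbhs.
have near_fg x : U x -> {near x, f =1 g}.
  by move=> Ux; near=> y; apply: fg; near: y; exact: open_nbhs_nbhs.
move=> [fd fD]; split=> [x Ux|v]; first exact: near_eq_differentiable (near_fg x Ux) (fd x Ux).
by apply: IH (fD v) => x Ux; exact: near_eq_derive (near_fg x Ux).
Unshelve. all: by end_near. Qed.

Lemma Ck_on_sub k U U' f : U' `<=` U -> Ck_on k U f -> Ck_on k U' f.
Proof.
move=> sU; elim: k f => [|k IH] f /=; first by move=> fc x /sU; exact: fc.
by move=> [fd fD]; split=> [x /sU|v]; [exact: fd|exact: IH].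
Qed.

Lemma Ck_onW k U f : Ck_on k.+1 U f -> Ck_on k U f.
Proof.
elim: k f => [|k IH] f; last by move=> [fd fD]; split=> // v; apply: IH.
by move=> [fd _] x /fd; exact: differentiable_continuous.
Qed.

Lemma Ck_on_cst k U (c : W) : Ck_on k U (cst c : V -> W).
Proof.
elim: k c => [|k IH] c /=; first by move=> x _; exact: cst_continuous.
split=> [x _|v]; first exact: differentiable_cst.
rewrite (_ : 'D_v (cst c) = cst 0) //.
by apply/funext => x; rewrite derive_cst.
Qed.

Lemma Ck_on_lin k U (f : {linear V -> W}) : continuous f -> Ck_on k U f.
Proof.
case: k => [|k] fc /=; first by move=> x _; exact: fc.
split=> [x _|v]; first exact: linear_differentiable.
rewrite (_ : 'D_v f = cst (f v)); first exact: Ck_on_cst.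
apply/funext => x; rewrite deriveE; last exact: linear_differentiable.
by rewrite diff_lin.
Qed.

Lemma Ck_onD k U f g : open U -> Ck_on k U f -> Ck_on k U g -> Ck_on k U (f + g).
Proof.
move=> oU; elim: k f g => [|k IH] f g /=.
  by move=> fc gc x Ux; apply: continuousD; [exact: fc|exact: gc].
move=> [fd fD] [gd gD]; split=> [x Ux|v].
  by apply: differentiableD; [exact: fd|exact: gd].
apply: Ck_on_eq (IH _ _ (fD v) (gD v)) => // x Ux.
by rewrite deriveD //; apply: diff_derivable; [exact: fd|exact: gd].
Qed.

Lemma Ck_on_sum k U (I : Type) (r : seq I) (f : I -> V -> W) : open U ->
  (forall i, Ck_on k U (f i)) -> Ck_on k U (fun x => \sum_(i <- r) f i x).
Proof.
move=> oU h; elim: r => [|i r IH].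
  by apply: Ck_on_eq (Ck_on_cst k U (0 : W)) => // x _; rewrite big_nil.
by apply: Ck_on_eq (Ck_onD oU (h i) IH) => // x _; rewrite big_cons.
Qed.
End CkBasics.

Section CkScale.
Variables (R : realType) (V W : normedModType R).

Definition scale_fun (a : R^o) (w : W) : W := (a : R) *: w.

Lemma scale_fun_bilinear : bilinear_for (GRing.Scale.Law.clone _ _ *:%R _)
  (GRing.Scale.Law.clone _ _ *:%R _) scale_fun.
Proof.
rewrite /scale_fun.
split=> [w|a] b u v /=; first by rewrite scalerDl scalerA.
by rewrite scalerDr !scalerA mulrC.
Qed.
HB.instance Definition _ := bilinear_isBilinear.Build R R^o W W _ _
  scale_fun scale_fun_bilinear.

Lemma diff_scale (a : V -> R^o) (f : V -> W) x :
  differentiable a x -> differentiable f x ->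
  differentiable (fun y => (a y : R) *: f y) x /\
  forall v, 'd (fun y => (a y : R) *: f y) x v =
            (a x : R) *: 'd f x v + ('d a x v : R) *: f x.
Proof.
move=> da df.
pose b : {bilinear R^o -> W -> W} := scale_fun.
have bc : continuous (fun p : R^o * W => b p.1 p.2) by exact: scale_continuous.
have -> : (fun y => (a y : R) *: f y) = (fun p => b p.1 p.2) \o (fun y => (a y, f y)) by [].
have dp := differentiable_pair da df.
have db := differentiable_bilin (a x, f x) bc.
split=> [|v]; first exact: differentiable_comp.
by rewrite diff_comp //= diff_pair // diff_bilin.
Qed.

Lemma Ck_onZ k U (a : V -> R^o) (f : V -> W) : open U -> Ck_on k U a -> Ck_on k U f ->
  Ck_on k U (fun x => (a x : R) *: f x).
Proof.
move=> oU; elim: k a f => [|k IH] a f ha hf.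
  by move=> x Ux; apply: (@continuousZ _ _ _ (a : V -> R)); [exact: ha|exact: hf].
have [ad aD] := ha; have [fd fD] := hf.
split=> [x Ux|v].
  by have [] := diff_scale (ad _ Ux) (fd _ Ux).
have h1 := Ck_onD oU (IH _ _ (Ck_onW ha) (fD v)) (IH _ _ (aD v) (Ck_onW hf)).
apply: Ck_on_eq h1 => // x Ux; have [d1 d2] := diff_scale (ad _ Ux) (fd _ Ux).
rewrite [RHS]deriveE // d2 /= [in LHS]/GRing.add /=.
by rewrite !deriveE //; [exact: ad|exact: fd].
Qed.
End CkScale.

Section CkComp.
Variables (R : realType) (V : normedModType R).

Lemma Ck_on_coord k U d (f : V -> 'rV[R]_d) : open U ->
  (forall j, Ck_on k U (fun x => f x 0 j : R^o)) -> Ck_on k U f.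
Proof.
move=> oU h; rewrite (_ : f = fun x => \sum_j (f x 0 j) *: delta_mx 0 j); last first.
  by apply/funext => x; rewrite -row_sum_delta.
apply: Ck_on_sum => // j.
exact: (Ck_onZ (f := cst (delta_mx 0 j)) oU (h j) (Ck_on_cst _ _ _)).
Qed.

Lemma Ck_on_comp_lin (W W' : normedModType R) k U (f : V -> W) (l : {linear W -> W'}) :
  continuous l -> open U -> Ck_on k U f -> Ck_on k U (l \o f).
Proof.
move=> lc oU; elim: k f => [|k IH] f /=.
  by move=> fc x Ux; apply: continuous_comp; [exact: fc|exact: lc].
move=> [fd fD]; split=> [x Ux|v].
  by apply: differentiable_comp; [exact: fd|exact: linear_differentiable].
apply: Ck_on_eq (IH _ (fD v)) => // x Ux /=.
rewrite [RHS]deriveE; last by apply: differentiable_comp; [exact: fd|exact: linear_differentiable].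
by rewrite diff_comp ?diff_lin ?deriveE //; [exact: fd|exact: fd|exact: linear_differentiable].
Qed.

Lemma coord_linear d (j : 'I_d) : linear (fun x : 'rV[R]_d => x 0 j : R^o).
Proof. by move=> a x y; rewrite !mxE. Qed.

Lemma Ck_on_entry k U d (f : V -> 'rV[R]_d) j : open U ->
  Ck_on k U f -> Ck_on k U (fun x => f x 0 j : R^o).
Proof.
move=> oU; apply: (Ck_on_comp_lin (l := linear_of (@coord_linear d j))) => //.
exact: linear_rV_continuous.
Qed.

Lemma Ck_on_comp (W : normedModType R) d k U U' (f : 'rV[R]_d -> W) (h : V -> 'rV[R]_d) :
  open U -> open U' -> (forall x, U x -> U' (h x)) ->
  Ck_on k U' f -> Ck_on k U h -> Ck_on k U (f \o h).
Proof.
move=> oU oU' hUU'; elim: k f h hUU' => [|k IH] f h hUU' hf hh.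
  by move=> x Ux; apply: continuous_comp; [exact: hh|apply: hf; exact: hUU'].
have [fd fD] := hf; have [hd hD] := hh.
have fhd x : U x -> differentiable (f \o h) x.
  by move=> Ux; apply: differentiable_comp; [exact: hd|apply: fd; exact: hUU'].
split=> // v.
pose F x := \sum_j ('D_v h x 0 j) *: (('D_(delta_mx 0 j) f) \o h) x.
have hF : Ck_on k U F.
  apply: Ck_on_sum => // j; apply: (Ck_onZ (a := fun x => 'D_v h x 0 j : R^o)) => //.
    exact: Ck_on_entry (hD v).
  exact: (IH _ _ hUU' (fD _) (Ck_onW hh)).
apply: Ck_on_eq hF => // x Ux; rewrite [RHS]deriveE; last exact: fhd.
have dfx : differentiable f (h x) by apply: fd; exact: hUU'.
rewrite diff_comp //=; last exact: hd.
have -> : 'd h x v = 'D_v h x by rewrite deriveE //; exact: hd.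
rewrite [in RHS](row_sum_delta ('D_v h x)) linear_sum; apply: eq_bigr => j _.
by rewrite linearZ /=; congr (_ *: _); rewrite deriveE.
Qed.
End CkComp.

(** * The inverse function theorem *)
Section CkScalar.
Variables (R : realType) (V : normedModType R).
Implicit Types (f g : V -> R^o) (U : set V).

Lemma Ck_onM k U f g : open U -> Ck_on k U f -> Ck_on k U g ->
  Ck_on k U ((fun x => (f x : R) * (g x : R)) : V -> R^o).
Proof. by move=> oU hf hg; exact: (Ck_onZ oU hf hg). Qed.

Lemma Ck_on_prod k U (I : Type) (r : seq I) (F : I -> V -> R^o) : open U ->
  (forall i, Ck_on k U (F i)) -> Ck_on k U ((fun x => \prod_(i <- r) (F i x : R)) : V -> R^o).
Proof.
move=> oU hF; elim: r => [|i r IH].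
  apply: Ck_on_eq (Ck_on_cst k U (1 : R^o)) => // x _; by rewrite big_nil.
by apply: Ck_on_eq (Ck_onM oU (hF i) IH) => // x _; rewrite big_cons.
Qed.

Lemma Ck_on_det k U m (M : V -> 'M[R]_m) : open U ->
  (forall i j, Ck_on k U (fun x => M x i j : R^o)) ->
  Ck_on k U (fun x => \det (M x) : R^o).
Proof.
move=> oU hM; rewrite /determinant.
apply: Ck_on_sum => // s.
have h := Ck_on_prod (index_enum 'I_m) oU (fun i => hM i (s i)).
exact: (Ck_onM oU (Ck_on_cst k U ((-1) ^+ s : R^o)) h).
Qed.

Lemma Ck_onV k U f : open U -> (forall x, U x -> f x != 0) -> Ck_on k U f ->
  Ck_on k U ((fun x => (f x : R)^-1) : V -> R^o).
Proof.
move=> oU f0; elim: k f f0 => [|k IH] f f0 hf.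
  by move=> x Ux; apply: (@cvgV R); [exact: f0|exact: hf].
have hfk := Ck_onW hf; have [fd fD] := hf; split=> [x Ux|v].
  by apply: (@differentiableV R V (f : V -> R)); [exact: fd|exact: f0].
have h1 := IH f f0 hfk.
have := Ck_onM oU (Ck_onM oU (Ck_on_cst _ _ (-1 : R^o)) (Ck_onM oU h1 h1)) (fD v).
apply: Ck_on_eq => // x Ux /=.
rewrite (@deriveV R V (f : V -> R)); [|exact: f0|by apply: diff_derivable; exact: fd].
by rewrite /GRing.scale /= mulN1r -invfM expr2.
Qed.

(** By Cramer's formula the inverse is rational in the entries. *)
Lemma Ck_on_mul_invmx k U m (M : V -> 'M[R]_m) (v : 'rV[R]_m) : open U ->
  (forall x, U x -> M x \in unitmx) ->
  (forall i j, Ck_on k U (fun x => M x i j : R^o)) ->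
  Ck_on k U (fun x => v *m invmx (M x)).
Proof.
move=> oU hU hM; apply: Ck_on_coord => // j.
pose G x : R^o := \sum_i v 0 i * ((\det (M x))^-1 * ((-1) ^+ (j + i) * \det (row' j (col' i (M x))))).
suff hG : Ck_on k U G.
  apply: Ck_on_eq hG => // x Ux; rewrite mxE; apply: eq_bigr => i _.
  by rewrite /invmx hU // !mxE.
apply: Ck_on_sum => // i; apply: (Ck_onM oU (Ck_on_cst _ _ (v 0 i : R^o))).
apply: Ck_onM => //.
  apply: Ck_onV => //; last exact: Ck_on_det.
  by move=> x Ux; have := hU x Ux; rewrite unitmxE unitfE.
apply: (Ck_onM oU (Ck_on_cst _ _ ((-1) ^+ (j + i) : R^o))).
apply: Ck_on_det => // a b.
by apply: Ck_on_eq (hM (lift j a) (lift i b)) => // x _; rewrite !mxE.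
Qed.
End CkScalar.

(** Lets matrices be a complete normed module, as the fixed point theorem
    requires. *)
HB.instance Definition _ (R : realType) (m n : nat) := Complete.on 'M[R]_(m, n).

Section InverseFunction.
Variables (R : realType) (N : nat).
Local Notation E := 'rV[R]_N.

Lemma entry_le_norm (x : E) j : `|x 0 j| <= `|x|.
Proof.
rewrite [leRHS]/Num.Def.normr /= mx_normrE.
exact: (le_bigmax _ (fun ij : 'I_1 * 'I_N => `|x ij.1 ij.2|) (0, j)).
Qed.

Lemma norm_le_entries (x : E) (e : R) : 0 <= e -> (forall j, `|x 0 j| <= e) -> `|x| <= e.
Proof.
move=> e0 h; rewrite [leLHS]/Num.Def.normr /= mx_normrE.
by apply: bigmax_le => // -[i j] _; rewrite ord1.
Qed.

(** Mean value theorem for each coordinate along a segment, which stays in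
    the ball by convexity. *)
Lemma small_derivative_lipschitz (phi : E -> E) (x0 : E) (r d : R) : 0 <= d ->
  (forall x, ball x0 r x -> differentiable phi x) ->
  (forall x i j, ball x0 r x -> `|'D_(delta_mx 0 i) phi x 0 j| <= d) ->
  forall x y, ball x0 r x -> ball x0 r y -> `|phi x - phi y| <= N%:R * d * `|x - y|.
Proof.
move=> d0 dphi Dphi x y Bx By.
apply: norm_le_entries => [|j]; first by rewrite !mulr_ge0.
pose line (t : R^o) : E := y + (t : R) *: (x - y).
have line_ball t : 0 <= t <= 1 -> ball x0 r (line t).
  case/andP=> t0 t1; rewrite /line -ball_normE /=.
  have -> : x0 - (y + t *: (x - y)) = (1 - t) *: (x0 - y) + t *: (x0 - x).
    by apply/rowP => i; rewrite !mxE; ring.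
  move: Bx By; rewrite -!ball_normE /= => Bx By.
  rewrite (le_lt_trans (ler_normD _ _)) // !normrZ ger0_norm ?subr_ge0 // (ger0_norm t0).
  have [t00|tn0] := eqVneq t 0; first by rewrite t00 subr0 mul1r mul0r addr0.
  have tp : 0 < t by rewrite lt_neqAle eq_sym tn0.
  rewrite (@le_lt_trans _ _ ((1 - t) * r + t * `|x0 - x|)) //.
    by rewrite lerD2r ler_wpM2l ?subr_ge0 // ltW.
  rewrite (@lt_le_trans _ _ ((1 - t) * r + t * r)) //; first by rewrite ltrD2l ltr_pM2l.
  by rewrite -mulrDl subrK mul1r.
have dline t : is_diff (t : R^o) line (fun s : R^o => (s : R) *: (x - y)).
  by apply: is_diff_eq; rewrite ?add0r.
pose psi (t : R^o) : R^o := phi (line t) 0 j.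
pose dpsi (t : R) : R := 'D_(x - y) phi (line t) 0 j.
have dpsiP t : 0 <= t <= 1 -> is_derive (t : R^o) 1 psi (dpsi t).
  move=> t01.
  have dphi_t := dphi _ (line_ball t t01).
  have [dl dlE] := dline t.
  have dpl : differentiable (phi \o line) (t : R^o) by apply: differentiable_comp.
  have dd : derivable (phi \o line) (t : R^o) 1 by apply: diff_derivable.
  apply: DeriveDef; first by have /derivable_mxP := dd; apply.
  have := derive_mx dd => /(congr1 (fun M : 'rV_N => M 0 j)); rewrite mxE => <-.
  by rewrite deriveE // diff_comp //= dlE /dpsi scale1r deriveE.
have [||c] := @MVT R psi dpsi 0 1 ltr01.
- by move=> t; rewrite in_itv /= => /andP[t0 t1]; apply: dpsiP; rewrite !ltW.
- apply: derivable_within_continuous => t; rewrite in_itv /= => t01.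
  by have [] := dpsiP t t01.
rewrite in_itv /= => /andP[c0 c1]; rewrite subr0 mulr1 /psi /line.
rewrite scale1r scale0r addr0 addrCA subrr addr0 !mxE => ->.
have Bc : ball x0 r (line c) by apply: line_ball; rewrite !ltW.
rewrite /dpsi deriveE; last exact: dphi.
have -> : 'd phi (line c) (x - y) 0 j =
    \sum_i (x - y) 0 i * 'd phi (line c) (delta_mx 0 i) 0 j.
  rewrite [in LHS](row_sum_delta (x - y)) linear_sum summxE.
  by apply: eq_bigr => i _; rewrite linearZ mxE.
rewrite (le_trans (ler_norm_sum _ _ _)) //.
apply: (@le_trans _ _ (\sum_(i < N) d * `|x - y|)).
  apply: ler_sum => i _; rewrite normrM mulrC.
  apply: ler_pM => //; last exact: entry_le_norm.
  by rewrite -deriveE; [exact: Dphi|exact: dphi].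
by rewrite sumr_const card_ord -mulrA mulr_natl.
Qed.

Lemma near_imp2 (T : topologicalType) (x : T) (P Q S : T -> Prop) :
  (forall y, P y -> Q y -> S y) ->
  (\forall y \near x, P y) -> (\forall y \near x, Q y) -> \forall y \near x, S y.
Proof. by move=> h hP hQ; near=> y; apply: h; near: y. Unshelve. all: by end_near. Qed.

(** As phi = id - c is a contraction near x0, x |-> phi x + z has a fixed
    point, a solution of c x = z.  The inverse is Lipschitz, hence differentiable
    with differential the inverse Jacobian, which Cramer's formula shows to be as
    smooth as g and the Jacobian of c; this yields one more derivative of g. *)
Theorem inverse_function (U : set E) (c : E -> E) (x0 : E) :
  open U -> U x0 -> smooth_on U c -> (forall v, 'd c x0 v = v) ->
  exists (U1 V1 : set E) (g : E -> E),
    [/\ open U1, open V1, U1 x0 & U1 `<=` U] /\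
    [/\ smooth_on V1 g, forall y, U1 y -> V1 (c y) /\ g (c y) = y &
        forall z, V1 z -> U1 (g z) /\ c (g z) = z].
Proof.
move=> oU Ux0 sc dc0.
have [cd cD] := sc 1%N; have cC v : Ck_on 1 U ('D_v c) by have [_ h] := sc 2%N; exact: h.
pose phi : E -> E := id - c.
have dphi x : U x -> differentiable phi x /\ forall v, 'd phi x v = v - 'd c x v.
  move=> Ux; have dc := cd x Ux; have did : differentiable (id : E -> E) x by [].
  split=> [|v]; first exact: differentiableB.
  have := congr1 (fun f : E -> E => f v) (diffB did dc).
  have [_ e] := is_diff_id x; have {}e := congr1 (fun f : E -> E => f v) e.
  by move=> h; rewrite [LHS]h; congr (_ - _).
have phiE x : phi x = x - c x by [].
clearbody phi.
(* Makes phi 1/2-Lipschitz near x0; the successor covers N = 0. *)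
pose d : R := (2 * N.+1%:R)^-1.
have d0 : 0 < d by rewrite invr_gt0 mulr_gt0.
have Nd : N%:R * d <= 2^-1.
  rewrite /d invfM mulrCA ler_piMr ?invr_ge0 // ler_pdivrMr ?ltr0Sn //.
  by rewrite mul1r ler_nat.
have Dphi x i j : U x -> 'D_(delta_mx 0 i) phi x 0 j =
    (delta_mx 0 i : E) 0 j - 'D_(delta_mx 0 i) c x 0 j.
  move=> Ux; have [dp dpE] := dphi x Ux.
  by rewrite deriveE // dpE deriveE ?mxE //; exact: cd.
have small : \forall x \near x0, U x /\ forall i j, `|'D_(delta_mx 0 i) phi x 0 j| < d.
  have h1 : \forall x \near x0, forall i j,
      `|'D_(delta_mx 0 i) phi x0 0 j - 'D_(delta_mx 0 i) phi x 0 j| < d.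
    suff hij i j : \forall x \near x0,
        `|'D_(delta_mx 0 i) phi x0 0 j - 'D_(delta_mx 0 i) phi x 0 j| < d.
      by do 2!(apply: (@filter_forall _ _ _ (nbhs x0) (nbhs_filter x0)) => ?); exact: hij.
    have cont : {for x0, continuous (fun x => 'D_(delta_mx 0 i) c x 0 j : R^o)}.
      by apply: (Ck_on_entry (k := 0) j oU (Ck_onW (cC _))).
    have /cvgrPdist_lt/(_ _ d0) hc := cont.
    near=> x; have Ux : U x by near: x; exact: open_nbhs_nbhs.
    have sub3 (a b b' : R) : a - b - (a - b') = b' - b by ring.
    rewrite (Dphi _ _ _ Ux0) (Dphi _ _ _ Ux) sub3 distrC.
    by near: x; exact: hc.
  near=> x; have Ux : U x by near: x; exact: open_nbhs_nbhs.
  split=> // i j.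
  have : `|'D_(delta_mx 0 i) phi x0 0 j - 'D_(delta_mx 0 i) phi x 0 j| < d.
    by move: i j; near: x.
  rewrite (Dphi _ _ _ Ux0) deriveE; last exact: cd.
  by rewrite dc0 subrr sub0r normrN.
have [r r0 Br] : exists2 r : R, 0 < r & forall x, ball x0 r x ->
    U x /\ forall i j, `|'D_(delta_mx 0 i) phi x 0 j| < d.
  by move/nbhs_ballP: small => [r r0 h]; exists r.
have BU x : ball x0 r x -> U x by move=> /Br[].
have phi_lip x y : ball x0 r x -> ball x0 r y -> `|phi x - phi y| <= 2^-1 * `|x - y|.
  have H1 z : ball x0 r z -> differentiable phi z by move=> /BU Uz; have [] := dphi z Uz.
  have H2 z i j : ball x0 r z -> `|'D_(delta_mx 0 i) phi z 0 j| <= d.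
    by move=> /Br[_ h]; apply/ltW/h.
  move=> Bx By; apply: (le_trans (small_derivative_lipschitz (ltW d0) H1 H2 Bx By)).
  by rewrite ler_wpM2r.
have expand x y : ball x0 r x -> ball x0 r y -> `|x - y| <= 2 * `|c x - c y|.
  move=> Bx By; have := phi_lip x y Bx By; rewrite !phiE.
  have -> : x - c x - (y - c y) = (x - y) - (c x - c y).
    by apply/rowP => j; rewrite !mxE; ring.
  have := ler_normD (x - y - (c x - c y)) (c x - c y); rewrite subrK.
  by set a := `|x - y|; set b := `|c x - c y|; lra.
pose s := r / 2; have s0 : 0 < s by rewrite divr_gt0.
pose K := [set x : E | `|x0 - x| <= s].
have KB x : K x -> ball x0 r x.
  by rewrite -ball_normE /K /= => /le_lt_trans; apply; rewrite /s ltr_pdivrMr // ltr_pMr // ltr1n.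
pose V1 := ball (c x0) (s / 2).
have solve z : V1 z -> exists x, [/\ `|x0 - x| < s & c x = z].
  rewrite /V1 -ball_normE /= => Vz.
  pose T x := phi x + z.
  have TK : set_fun K K T.
    move=> x Kx; rewrite /K /= /T.
    have -> : x0 - (phi x + z) = (phi x0 - phi x) + (c x0 - z).
      by rewrite [phi x0]phiE; apply/rowP => j; rewrite !mxE; ring.
    have := phi_lip x0 x (ballxx _ r0) (KB x Kx).
    have := ler_normD (phi x0 - phi x) (c x0 - z); move: Kx; rewrite /K /=.
    by move: Vz; set t1 := `|x0 - x|; set t2 := `|c x0 - z|; lra.
  pose Tf : {fun K >-> K} := HB.pack_for {fun K >-> K} T (isFun.Build E E K K T TK).
  have Tc : is_contraction Tf.
    have half0 : 0 <= (2^-1 : R) by rewrite invr_ge0.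
    exists (NngNum half0); split => /=; first by rewrite invf_lt1 // ltr1n.
    move=> [x y] /= [Kx Ky]; rewrite /T.
    have -> : phi x + z - (phi y + z) = phi x - phi y.
      by apply/rowP => j; rewrite !mxE; ring.
    by apply: phi_lip; apply: KB.
  have Kcl : closed K.
    have -> : K = (fun x => `|x0 - x|) @^-1` [set t | t <= s] by [].
    apply: preimage_closed; last exact: closed_le.
    move=> x _; apply: continuous_comp; last exact: norm_continuous.
    by apply: continuousB; [exact: cst_continuous|].
  have [|x Kx xE] := banach_fixed_point Tc Kcl.
    by exists x0; rewrite /K /= subrr normr0 ltW.
  have cx : c x = z.
    move: xE; rewrite /Tf /= /T phiE => /eqP; rewrite -addrA -subr_eq0 opprD addrA subrr add0r.
    by rewrite oppr_eq0 addrC subr_eq0 => /eqP.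
  exists x; split=> //.
  have := expand x0 x (ballxx _ r0) (KB x Kx); rewrite cx.
  by move: Vz; set t1 := `|x0 - x|; set t2 := `|c x0 - z|; lra.
have [g gP] : exists g : E -> E, forall z, V1 z -> `|x0 - g z| < s /\ c (g z) = z.
  have h z : exists x, V1 z -> `|x0 - x| < s /\ c x = z.
    have [/solve[x [h1 h2]]|nVz] := pselect (V1 z); first by exists x.
    by exists 0.
  by have [g gP] := choice h; exists g.
have gB z : V1 z -> ball x0 r (g z).
  by move=> /gP[h _]; apply: KB; rewrite /K /=; apply: ltW.
pose U1 := [set x : E | `|x0 - x| < s /\ V1 (c x)].
have oV1 : open V1 by exact: ball_open.
have oU1 : open U1.
  rewrite openE => x [xs Vcx]; rewrite /interior.
  have Ux : U x by apply/BU/KB/ltW.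
  have h1 : \forall y \near x, `|x0 - y| < s.
    have := ball_open x0 s; rewrite openE => /(_ x); rewrite /interior -ball_normE /=.
    exact.
  have h2 : \forall y \near x, V1 (c y).
    apply: (differentiable_continuous (cd x Ux)).
    by have := oV1; rewrite openE; apply.
  by apply: (near_imp2 _ h1 h2) => y ? ?; split.
have gK y : U1 y -> g (c y) = y.
  move=> [ys Vcy]; have [h1 h2] := gP _ Vcy.
  have := expand (g (c y)) y (gB _ Vcy) (KB y (ltW ys)).
  by rewrite h2 subrr normr0 mulr0 normr_le0 subr_eq0 => /eqP.
have g_lip z z' : V1 z -> V1 z' -> `|g z - g z'| <= 2 * `|z - z'|.
  move=> Vz Vz'; have [_ h] := gP _ Vz; have [_ h'] := gP _ Vz'.
  by have := expand _ _ (gB _ Vz) (gB _ Vz'); rewrite h h'.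
(* By expand, c moves points at least half as far as their distance; with an
   error of a quarter in the differential, no direction can be killed. *)
have dc_unit x : ball x0 r x -> 'J c x \in unitmx.
  move=> Bx; rewrite -row_free_unit; apply: inj_row_free => v.
  have dcx := cd x (BU _ Bx).
  rewrite -deriveEjacobian // deriveE // => dv0.
  have e0 : 0 < (4^-1 : R) by rewrite invr_gt0.
  have h1 := differentiable_eps dcx e0.
  have h2 : \forall h \near (0 : E), ball x0 r (h + x).
    have : \forall y \near x, ball x0 r y by have := ball_open x0 r; rewrite openE; apply.
    by have := (near_shift 0 x (fun y => ball x0 r y)); rewrite subr0 => ->.
  have h3 : \forall h \near (0 : E), `|h| <= 2 * (4^-1 * `|h + 'd c x h|) \/ 'd c x h <> 0.
    near=> h; have Bh : ball x0 r (h + x) by near: h; exact: h2.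
    have h1' : `|c (h + x) - (c x + 'd c x h)| <= 4^-1 * `|h| by near: h; exact: h1.
    have [e|] := pselect ('d c x h = 0); last by right.
    left; have := expand _ _ Bh Bx; move: h1'; rewrite e !addr0 addrK.
    by set a := `|c (h + x) - c x|; set b := `|h|; lra.
  have h4 : \forall t \near (0 : R), `|t *: v| <= 2 * (4^-1 * `|t *: v|).
    have tv : (fun t : R => t *: v) t @[t --> (0 : R)] --> (0 : E).
      by have := @scalel_continuous R _ v 0; rewrite /continuous_at scale0r.
    have h3t := tv _ h3; near=> t.
    have : `|t *: v| <= 2 * (4^-1 * `|t *: v + 'd c x (t *: v)|) \/ 'd c x (t *: v) <> 0.
      by near: t; exact: h3t.
    by rewrite linearZ /= dv0 scaler0 addr0 => -[].
  have [t [t0 ht]] : exists t : R, 0 < t /\ `|t *: v| <= 2 * (4^-1 * `|t *: v|).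
    move/nbhs_ballP: h4 => [e /= e00 he]; exists (e / 2).
    have e2 : 0 < e / 2 by rewrite divr_gt0.
    split=> //; apply: he; rewrite /ball /= sub0r normrN gtr0_norm //.
    by rewrite ltr_pdivrMr // ltr_pMr // ltr1n.
  have : `|t *: v| <= 0 by move: ht; set a := `|_|; lra.
  by rewrite normr_le0 scaler_eq0 gt_eqF //= => /eqP.
have dg z : V1 z -> differentiable g z /\ forall v, 'd g z v = v *m invmx ('J c (g z)).
  move=> Vz; set x := g z; have Bx : ball x0 r x := gB z Vz.
  have cx : c x = z by have [] := gP z Vz.
  have dcx := cd x (BU _ Bx).
  pose M := invmx ('J c x).
  have L_lin : linear (fun v : E => v *m M) by move=> a u v; rewrite mulmxDl scalemxAl.
  pose L := linear_of L_lin.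
  have Lc : continuous L by exact: linear_rV_continuous.
  have [kap kap0 Lk] := linear_lipschitz Lc.
  have [dgz dgE] : differentiable g z /\ 'd g z = L :> (E -> E).
    apply: differentiable_epsP => // e e0.
    have e'0 : 0 < e / (2 * kap) by rewrite divr_gt0 // mulr_gt0.
    have h1 := differentiable_eps dcx e'0.
    have hV : \forall k \near (0 : E), V1 (k + z).
      have : \forall y \near z, V1 y by have := oV1; rewrite openE; apply.
      by have := (near_shift 0 z V1); rewrite subr0 => ->.
    pose h k := g (k + z) - x.
    have hlip k : V1 (k + z) -> `|h k| <= 2 * `|k|.
      by move=> Vk; have := g_lip _ _ Vk Vz; rewrite addrK.
    have hh1 : \forall k \near (0 : E), `|c (h k + x) - (c x + 'd c x (h k))| <= e / (2 * kap) * `|h k|.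
      move/nbhs_ballP: h1 => [e1 /= e10 he1].
      have near1 : \forall k \near (0 : E), `|k| < e1 / 2.
        apply/nbhs_ballP; exists (e1 / 2); first by rewrite /= divr_gt0.
        by move=> k; rewrite -ball_normE /= sub0r normrN.
      near=> k; have Vk : V1 (k + z) by near: k; exact: hV.
      have k1 : `|k| < e1 / 2 by near: k; exact: near1.
      apply: he1; rewrite -ball_normE /= sub0r normrN.
      by apply: (le_lt_trans (hlip k Vk)); rewrite mulrC -ltr_pdivlMr.
    near=> k; have Vk : V1 (k + z) by near: k; exact: hV.
    have : `|c (h k + x) - (c x + 'd c x (h k))| <= e / (2 * kap) * `|h k|.
      by near: k; exact: hh1.
    rewrite {1}/h subrK; have [_ ->] := gP _ Vk.
    rewrite cx => hk.
    have -> : g (k + z) - (g z + L k) = - L (k + z - (z + 'd c x (h k))).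
      have -> : k + z - (z + 'd c x (h k)) = k - 'd c x (h k).
        by apply/rowP => j; rewrite !mxE; ring.
      rewrite linearB.
      have -> : L ('d c x (h k)) = h k.
        by rewrite /L /= -deriveE // deriveEjacobian // mulmxK // dc_unit.
      by rewrite /h -/x; apply/rowP => j; rewrite !mxE; ring.
    rewrite normrN (le_trans (Lk _)) //.
    apply: (@le_trans _ _ (kap * (e / (2 * kap) * (2 * `|k|)))).
      rewrite ler_pM2l // (le_trans hk) // ler_pM2l //; exact: hlip.
    rewrite le_eqVlt; apply/orP; left; apply/eqP; field.
    by rewrite gt_eqF.
  by split; [exact: dgz|move=> v; rewrite dgE].
have gU z : V1 z -> U1 (g z).
  by move=> Vz; have [h1 h2] := gP z Vz; split=> //; rewrite h2.
exists U1, V1, g; split; first (split; [exact: oU1|exact: oV1|idtac|idtac]).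
- by split; [rewrite subrr normr0|apply: ballxx; rewrite divr_gt0].
- by move=> x [xs _]; apply/BU/KB/ltW.
split.
- elim=> [|k IH].
    by move=> z /dg[h _]; exact: differentiable_continuous.
  split=> [z /dg[h _]|v]; first exact: h.
  have oB : open (ball x0 r) by exact: ball_open.
  have hJ : Ck_on k (ball x0 r) (fun x => v *m invmx ('J c x)).
    apply: Ck_on_mul_invmx => [//|//|i j].
    have [_ /(_ (delta_mx 0 i)) hD] := sc k.+1.
    have := Ck_on_entry j oB (Ck_on_sub (U' := ball x0 r) BU hD).
    apply: (Ck_on_eq oB) => x Bx; rewrite deriveEjacobian; last by apply: cd; exact: BU.
    by rewrite -rowE mxE.
  have e z : V1 z -> ((fun x => v *m invmx ('J c x)) \o g) z = 'D_v g z.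
    move=> Vz; have [h1 h2] := dg z Vz.
    by transitivity ('d g z v); [rewrite h2|exact/esym/deriveE].
  exact: (Ck_on_eq oV1 e (Ck_on_comp oV1 oB gB hJ IH)).
- by move=> y Uy; split; [case: Uy|exact: gK].
- by move=> z Vz; split; [exact: gU|have [] := gP z Vz].
Unshelve. all: by end_near. Qed.
End InverseFunction.

(** * Slice charts and tangent spaces *)
Lemma derive1_chain (R : realType) (V W : normedModType R) (c : R^o -> V) (f : V -> W)
    (t : R^o) :
  differentiable c t -> differentiable f (c t) ->
  (f \o c)^`()%classic t = 'd f (c t) (c^`()%classic t).
Proof.
move=> dc df; rewrite (derive1E' (differentiable_comp dc df)) (derive1E' dc).
exact: (congr1 (fun h : R^o -> W => h 1) (diff_comp dc df)).
Qed.

Lemma derive1_line (R : realType) (V : normedModType R) (w b : V) (t : R^o) :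
  (fun s : R^o => (s : R) *: w + b)^`()%classic t = w.
Proof.
have dl : is_diff (t : R^o) (fun s : R^o => (s : R) *: w + b) (fun s : R^o => (s : R) *: w).
  by apply: is_diff_eq; rewrite ?addr0.
have [h1 h2] := dl.
by rewrite (derive1E' h1) h2 scale1r.
Qed.

Section CurveDerivative.
Variables (R : realType) (N : nat).
Local Notation E := 'rV[R]_N.

Lemma linear_rV_diff (W : normedModType R) (l : {linear E -> W}) x :
  differentiable l x /\ forall v, 'd l x v = l v.
Proof.
have lc := @linear_rV_continuous _ _ _ l.
by split=> [|v]; [exact: linear_differentiable|rewrite diff_lin].
Qed.

Lemma derive1_comp_lin m (c : R^o -> E) (l : {linear E -> 'rV[R]_m}) (t : R^o) :
  differentiable c t ->
  (fun s : R^o => l (c s))^`()%classic t = l (c^`()%classic t).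
Proof.
move=> dc; have [dl dlE] := linear_rV_diff l (c t).
rewrite !derive1E' //; last exact: (differentiable_comp dc dl).
by rewrite (diff_comp dc dl) /= dlE.
Qed.

Lemma derive1_subspace (c : R^o -> E) (t : R^o) (L : {vspace E}) :
  differentiable c t -> (\forall s \near t, c s \in L) -> c^`()%classic t \in L.
Proof.
move=> dc cL; pose pL := (\1 - projv L)%VF.
have pLE v : (pL v == 0) = (v \in L).
  rewrite /pL add_lfunE opp_lfunE id_lfunE subr_eq0; apply/eqP/idP => [->|].
    exact: memv_proj.
  by move=> vL; rewrite projv_id.
rewrite -pLE -derive1_comp_lin // derive1E.
have : \forall s \near t, (fun s : R^o => pL (c s)) s = cst (0 : E) s.
  near=> s; apply/eqP; rewrite pLE; near: s; exact: cL.
by move/near_eq_derive => ->; rewrite derive_cst.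
Unshelve. all: by end_near. Qed.

Lemma open_preimage (V W : topologicalType) (U : set V) (U' : set W) (f : V -> W) :
  open U -> open U' -> (forall x, U x -> {for x, continuous f}) ->
  open [set x | U x /\ U' (f x)].
Proof.
move=> oU oU' fc; rewrite openE => x [Ux U'fx]; rewrite /interior.
have h1 : \forall y \near x, U y by move: oU; rewrite openE; apply.
have h2 : \forall y \near x, U' (f y).
  by apply: (fc x Ux); move: oU'; rewrite openE; apply.
by near=> y; split; near: y.
Unshelve. all: by end_near. Qed.

Lemma Ck_on_affine (V W : normedModType R) k (U : set V) (l : {linear V -> W}) (b : W) :
  open U -> continuous l -> Ck_on k U (fun x => l x + b).
Proof. by move=> oU lc; exact: (Ck_onD oU (Ck_on_lin _ _ lc) (Ck_on_cst _ _ b)). Qed.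

Lemma line_linear (w : E) : linear (fun t : R^o => (t : R) *: w).
Proof. by move=> a s t; rewrite scalerDl scalerA. Qed.

Lemma line_continuous (w : E) : continuous (fun t : R^o => (t : R) *: w).
Proof. exact: scalel_continuous. Qed.

(** The condition of submanifold at the single point x, so that n may depend
    on the point. *)
Definition slice_chart n (M : set E) (x : E) : Prop :=
  exists (U U' : set E) (f f' : E -> E) (L : {vspace E}),
    [/\ open U, open U' & U x] /\
    [/\ smooth_on U f, smooth_on U' f',
        forall y, U y -> U' (f y) /\ f' (f y) = y &
        forall z, U' z -> U (f' z) /\ f (f' z) = z] /\
    \dim L = n /\ (forall y, U y -> (M y <-> f y \in L)).

(** S is the preimage of L under the differential of the chart: the chart
    carries curves in M to curves in L, and its inverse carries lines of L back
    to curves in M. *)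
Lemma chart_tangent n (M : set E) x : M x -> slice_chart n M x ->
  exists S : {vspace E}, \dim S = n /\ forall v, tangent M x v <-> v \in S.
Proof.
move=> Mx [U [U' [f [f' [L [[oU oU' Ux] [[sf sf' fK f'K] [dimL ML]]]]]]]].
have [fd _] := sf 1%N; have [f'd _] := sf' 1%N.
have [U'fx f'fx] := fK x Ux.
have dfx := fd x Ux; have df'x := f'd _ U'fx.
have cancel1 v : 'd f' (f x) ('d f x v) = v.
  have e : {near x, f' \o f =1 id}.
    near=> y; have Uy : U y by near: y; exact: open_nbhs_nbhs.
    by have [] := fK y Uy.
  have := congr1 (fun h : E -> E => h v) (diff_comp dfx df'x) => /= <-.
  rewrite -deriveE; last exact: differentiable_comp.
  by rewrite (near_eq_derive v e) derive_id.
have cancel2 w : 'd f x ('d f' (f x) w) = w.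
  have e : {near (f x), f \o f' =1 id}.
    near=> y; have Uy : U' y by near: y; exact: open_nbhs_nbhs.
    by have [] := f'K y Uy.
  have dfx' : differentiable f (f' (f x)) by rewrite f'fx.
  have := congr1 (fun h : E -> E => h w) (diff_comp df'x dfx') => /=.
  rewrite f'fx => <-.
  rewrite -deriveE; last exact: differentiable_comp.
  by rewrite (near_eq_derive w e) derive_id.
have [d dE] : exists d : {linear E -> E}, 'd f x = d by exists ('d f x).
have [d' d'E] : exists d : {linear E -> E}, 'd f' (f x) = d by exists ('d f' (f x)).
rewrite d'E dE in cancel1; rewrite d'E dE in cancel2.
pose T : 'End(E) := linfun d'.
have TE w : T w = d' w by rewrite lfunE.
exists (T @: L)%VS; split.
  rewrite limg_dim_eq //; apply/eqP; rewrite -subv0; apply/subvP => w.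
  rewrite memv_cap memv_ker TE memv0 => /andP[_ /eqP w0].
  by rewrite -(cancel2 w) w0 linear0.
have memT v : (v \in (T @: L)%VS) <-> d v \in L.
  split=> [/memv_imgP[w wL ->]|h]; first by rewrite TE cancel2.
  by have := memv_img T h; rewrite TE cancel1.
move=> v; rewrite memT; split.
  move=> [I [c [[oI I0 sc] [cM c0 <-]]]].
  have [cd _] := sc 1%N; have dc0 := cd 0 I0.
  have dfc : differentiable (f \o c) (0 : R^o) by apply: differentiable_comp; rewrite ?c0.
  have -> : d (c^`()%classic 0) = (f \o c)^`()%classic 0.
    have dfc0 : differentiable f (c 0) by rewrite c0.
    by rewrite -dE -c0; exact/esym/derive1_chain.
  apply: derive1_subspace => //; near=> s.
  have Is : I s by near: s; exact: open_nbhs_nbhs.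
  have Ucs : U (c s).
    near: s; apply: (differentiable_continuous dc0).
    by rewrite c0; exact: open_nbhs_nbhs.
  exact: (ML _ Ucs).1 (cM s Is).
move=> dvL; set w := d v in dvL.
pose line (t : R^o) : E := (t : R) *: w + f x.
pose I : set R^o := [set t | U' (line t)].
have sline k (A : set R^o) : open A -> Ck_on k A line.
  move=> oA; exact: (Ck_on_affine (l := linear_of (line_linear w)) k (f x) oA (@line_continuous w)).
have line_c : continuous line.
  by move=> t; have := sline 0%N setT openT; apply.
have oI : open I by apply: open_comp => // t _; exact: line_c.
have line0 : line 0 = f x by rewrite /line scale0r add0r.
have I0 : I 0 by rewrite /I /= line0.
have dline : differentiable line (0 : R^o) by have [h _] := sline 1%N setT openT; exact: h.
exists I, (f' \o line); split; first split=> //.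
  move=> k; exact: (Ck_on_comp oI oU' (fun _ h => h) (sf' k) (sline k I oI)).
split; last first.
- have df'l : differentiable f' (line 0) by rewrite line0.
  rewrite (derive1_chain dline df'l) line0 d'E -[RHS]cancel1; congr (d' _).
  exact: derive1_line.
- by rewrite /= line0.
- move=> t It; have [Ut ft] := f'K _ It.
  apply/(ML _ Ut); rewrite ft /line rpredD ?memvZ //.
  exact: (ML _ Ux).1 Mx.
Unshelve. all: by end_near. Qed.
End CurveDerivative.

(** * Factors of a product submanifold *)
Section DiffAux.
Variables (R : realType) (V W Z : normedModType R).

Lemma diff_near_eq (f g : V -> W) x v : differentiable f x -> {near x, f =1 g} ->
  'd f x v = 'd g x v.
Proof.
move=> df fg; have dg := near_eq_differentiable fg df.
by rewrite -(deriveE v df) -(deriveE v dg); exact: near_eq_derive.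
Qed.

Lemma diff_chain (f : V -> W) (g : W -> Z) x v : differentiable f x ->
  differentiable g (f x) -> 'd (g \o f) x v = 'd g (f x) ('d f x v).
Proof. by move=> df dg; exact: (congr1 (fun h : V -> Z => h v) (diff_comp df dg)). Qed.
End DiffAux.

Section MulmxLinear.
Variables (R : realType) (m n : nat) (A : 'M[R]_(m, n)).
Lemma mulmxr_linear : linear (fun x : 'rV[R]_m => x *m A).
Proof. by move=> a x y; rewrite mulmxDl scalemxAl. Qed.
Definition mulmxr_lin : {linear 'rV[R]_m -> 'rV[R]_n} := linear_of mulmxr_linear.
Lemma mulmxr_linE x : mulmxr_lin x = x *m A. Proof. by []. Qed.
Lemma mulmxr_continuous : continuous mulmxr_lin.
Proof. exact: linear_rV_continuous. Qed.
End MulmxLinear.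

Section SmoothCurves.
Variables (R : realType) (N : nat).
Lemma smooth_mulmx (V : normedModType R) m (U : set V) (f : V -> 'rV[R]_N) (A : 'M[R]_(N, m)) :
  open U -> smooth_on U f -> smooth_on U (fun x => f x *m A).
Proof. by move=> oU sf k; exact: (Ck_on_comp_lin (@mulmxr_continuous _ _ _ A) oU (sf k)). Qed.

Lemma derive1_mulmx m (c : R^o -> 'rV[R]_N) (A : 'M[R]_(N, m)) (t : R^o) :
  differentiable c t -> (fun s : R^o => c s *m A)^`()%classic t = c^`()%classic t *m A.
Proof. by move=> dc; exact: (derive1_comp_lin (mulmxr_lin A) dc). Qed.
End SmoothCurves.

Section Product.
Variables (R : realType) (N1 N2 N : nat).
Variables (P1 : 'M[R]_(N1, N)) (P2 : 'M[R]_(N2, N)) (Q1 : 'M[R]_(N, N1)) (Q2 : 'M[R]_(N, N2)).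
Hypotheses (P1Q1 : P1 *m Q1 = 1%:M) (P2Q2 : P2 *m Q2 = 1%:M)
  (P1Q2 : P1 *m Q2 = 0) (P2Q1 : P2 *m Q1 = 0) (QP : Q1 *m P1 + Q2 *m P2 = 1%:M).
Variables (M1 : set 'rV[R]_N1) (M2 : set 'rV[R]_N2).
Let M := [set z | exists x1 x2, [/\ M1 x1, M2 x2 & z = x1 *m P1 + x2 *m P2]].

Lemma prodQ1 x1 x2 : (x1 *m P1 + x2 *m P2) *m Q1 = x1 :> 'rV_N1.
Proof. by rewrite mulmxDl -!mulmxA P1Q1 P2Q1 mulmx1 mulmx0 addr0. Qed.

Lemma prodQ2 x1 x2 : (x1 *m P1 + x2 *m P2) *m Q2 = x2 :> 'rV_N2.
Proof. by rewrite mulmxDl -!mulmxA P1Q2 P2Q2 mulmx1 mulmx0 add0r. Qed.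

Lemma prodE (z : 'rV_N) : z *m Q1 *m P1 + z *m Q2 *m P2 = z.
Proof. by rewrite -!mulmxA -mulmxDr QP mulmx1. Qed.

Lemma prodP z : M z <-> M1 (z *m Q1) /\ M2 (z *m Q2).
Proof.
split=> [[x1 [x2 [h1 h2 ->]]]|[h1 h2]]; first by rewrite prodQ1 prodQ2.
by exists (z *m Q1), (z *m Q2); rewrite prodE.
Qed.

Lemma tangent_prod x v :
  tangent M x v <-> tangent M1 (x *m Q1) (v *m Q1) /\ tangent M2 (x *m Q2) (v *m Q2).
Proof.
split.
  move=> [I [c [[oI I0 sc] [cM c0 cv]]]].
  have [cd _] := sc 1%N; have dc := cd 0 I0.
  split; [exists I, (fun t => c t *m Q1)|exists I, (fun t => c t *m Q2)]; split.
  - by split=> //; exact: smooth_mulmx.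
  - split; [by move=> t /cM/prodP[]|by rewrite c0|by rewrite (derive1_mulmx _ dc) cv].
  - by split=> //; exact: smooth_mulmx.
  - split; [by move=> t /cM/prodP[]|by rewrite c0|by rewrite (derive1_mulmx _ dc) cv].
move=> [[I1 [c1 [[oI1 I10 sc1] [cM1 c10 cv1]]]] [I2 [c2 [[oI2 I20 sc2] [cM2 c20 cv2]]]]].
have oI : open (I1 `&` I2) by exact: openI.
have s1 : smooth_on (I1 `&` I2) (fun t => c1 t *m P1).
  by apply: smooth_mulmx => // k; apply: Ck_on_sub (sc1 k) => t [].
have s2 : smooth_on (I1 `&` I2) (fun t => c2 t *m P2).
  by apply: smooth_mulmx => // k; apply: Ck_on_sub (sc2 k) => t [].
exists (I1 `&` I2), ((fun t => c1 t *m P1) + (fun t => c2 t *m P2)); split.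
  by split=> // k; exact: Ck_onD.
split.
- by move=> t [h1 h2]; exists (c1 t), (c2 t); split; [exact: cM1|exact: cM2|].
- by rewrite [LHS]/(c1 0 *m P1 + c2 0 *m P2) c10 c20; exact: prodE.
- have [c1d _] := sc1 1%N; have [c2d _] := sc2 1%N.
  have dc1 := c1d 0 I10; have dc2 := c2d 0 I20.
  have [d1 _] := s1 1%N; have [d2 _] := s2 1%N.
  rewrite derive1E deriveD; last 2 first.
  + by apply: diff_derivable; exact: d1.
  + by apply: diff_derivable; exact: d2.
  by rewrite -!derive1E (derive1_mulmx _ dc1) (derive1_mulmx _ dc2) cv1 cv2; exact: prodE.
Qed.

(** Composing the chart of the product with the projections gives a smooth
    retraction r onto M1.  If A is its differential at x1, an idempotent, then
    r A + (id - r) (1 - A) has differential id at x1 and straightens M1 into the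
    image of A. *)
Lemma factor_chart n x1 x2 : M1 x1 -> M2 x2 ->
  slice_chart n M (x1 *m P1 + x2 *m P2) -> exists n1, slice_chart n1 M1 x1.
Proof.
move=> M1x1 M2x2 [U [U' [f [f' [L [[oU oU' Ux] [[sf sf' fK f'K] [dimL ML]]]]]]]].
pose j (y : 'rV[R]_N1) := y *m P1 + x2 *m P2.
have sj k (A : set 'rV[R]_N1) : open A -> Ck_on k A j.
  by move=> oA; exact: (Ck_on_affine k (x2 *m P2) oA (@mulmxr_continuous _ _ _ P1)).
pose p : {linear 'rV[R]_N -> 'rV[R]_N} := projv L.
pose W0 := [set y | setT y /\ U (j y)].
have oW0 : open W0.
  by apply: open_preimage => [|//|x _]; [exact: openT|exact: (sj 0%N setT openT)].
have jW0 y : W0 y -> U (j y) by case.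
pose F := p \o (f \o j).
have sF k : Ck_on k W0 F.
  apply: Ck_on_comp_lin => //; first exact: linear_rV_continuous.
  exact: (Ck_on_comp oW0 oU jW0 (sf k) (sj k _ oW0)).
pose W := [set y | W0 y /\ U' (F y)].
have oW : open W by apply: open_preimage => [//|//|x]; exact: (sF 0%N).
have WW0 : W `<=` W0 by move=> y [].
have FW y : W y -> U' (F y) by case.
pose r := fun y => (f' \o F) y *m Q1.
have sr : smooth_on W r.
  apply: smooth_mulmx => // k.
  exact: (Ck_on_comp oW oU' FW (sf' k) (Ck_on_sub WW0 (sF k))).
have M1r y : M1 y -> W0 y -> r y = y /\ W y.
  move=> M1y [_ Uj]; have Mj : M (j y) by exists y, x2.
  have FE : F y = f (j y) by rewrite /F /= /p projv_id //; exact: (ML _ Uj).1.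
  have [U'f f'f] := fK _ Uj.
  by rewrite /r /= FE f'f prodQ1; split=> //; split=> //; rewrite FE.
have rM1 y : W y -> M1 (r y).
  move=> [_ U'F]; have [Uf ff] := f'K _ U'F.
  have : M (f' (F y)) by apply/(ML _ Uf); rewrite ff /F /= memv_proj.
  by case/prodP.
have [rx1 Wx1] : r x1 = x1 /\ W x1 by apply: M1r => //; split.
have [rd _] := sr 1%N.
pose A := 'J r x1.
have dr v : 'd r x1 v = v *m A by rewrite -deriveE ?deriveEjacobian //; exact: rd.
(* Near x1 the retraction r is idempotent. *)
have AA : A *m A = A.
  apply/row_matrixP => i; rewrite !rowE mulmxA -!dr.
  have dr1 := rd _ Wx1; have dr1' : differentiable r (r x1) by rewrite rx1.
  have e : {near x1, r \o r =1 r}.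
    have oV := open_preimage oW oW0 (sr 0%N).
    have : \forall y \near x1, W y /\ W0 (r y).
      by move: oV; rewrite openE; apply; rewrite /= rx1; split=> //; exact: WW0.
    by apply: filterS => y [Wy W0ry] /=; have [] := M1r _ (rM1 _ Wy) W0ry.
  have drr := differentiable_comp dr1 dr1'.
  transitivity ('d r (r x1) ('d r x1 (delta_mx 0 i))).
    exact: (congr1 (fun y => 'd r y ('d r x1 (delta_mx 0 i))) (esym rx1)).
  exact: (etrans (esym (diff_chain _ dr1 dr1')) (diff_near_eq _ drr e)).
pose B : 'M[R]_N1 := 1%:M - A.
have AB : A *m B = 0 by rewrite mulmxBr mulmx1 AA subrr.
have AplusB : A + B = 1%:M by rewrite addrC subrK.
pose c : 'rV[R]_N1 -> 'rV[R]_N1 := (fun y => r y *m A) + (fun y => (y - r y) *m B).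
have cE y : c y = r y *m A + (y - r y) *m B by [].
have s_idr k : Ck_on k W (fun y => y - r y).
  have h := Ck_onD oW (Ck_on_lin k W (f := mulmxr_lin 1%:M) (@mulmxr_continuous _ _ _ _))
                   (smooth_mulmx (-1)%:M oW sr k).
  apply: Ck_on_eq h => // y _.
  rewrite [LHS]/(mulmxr_lin 1%:M y + r y *m (-1)%:M) mulmxr_linE mulmx1.
  by rewrite mul_mx_scalar scaleN1r.
have sc : smooth_on W c.
  by move=> k; apply: Ck_onD => //; apply: smooth_mulmx => // l; exact: s_idr.
have dc v : 'd c x1 v = v.
  have [d1 _] := smooth_mulmx A oW sr 1%N.
  have [d2 _] := smooth_mulmx B oW s_idr 1%N.
  have [d3 _] := s_idr 1%N.
  have h1 : 'D_v (fun y => r y *m A) x1 = v *m A *m A.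
    have [l1 l2] := linear_rV_diff (mulmxr_lin A) (r x1).
    rewrite (deriveE v (d1 _ Wx1)) -[v *m A]dr -mulmxr_linE -l2.
    exact: (diff_chain v (rd _ Wx1) l1).
  have h3 : 'D_v (fun y => y - r y) x1 = v - v *m A.
    have d0 : derivable r x1 v by apply: diff_derivable; exact: rd.
    have := deriveB (@derivable_id _ _ x1 v) d0.
    by rewrite derive_id (deriveE v (rd _ Wx1)) dr.
  have h2 : 'D_v (fun y => (y - r y) *m B) x1 = (v - v *m A) *m B.
    have [l1 l2] := linear_rV_diff (mulmxr_lin B) (x1 - r x1).
    rewrite (deriveE v (d2 _ Wx1)) -h3 (deriveE v (d3 _ Wx1)) -mulmxr_linE -l2.
    exact: (diff_chain v (d3 _ Wx1) l1).
  have [cd _] := sc 1%N.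
  rewrite -(deriveE v (cd _ Wx1)).
  have d1' : derivable (fun y => r y *m A) x1 v by apply: diff_derivable; exact: d1.
  have d2' : derivable (fun y => (y - r y) *m B) x1 v by apply: diff_derivable; exact: d2.
  rewrite (deriveD d1' d2').
  rewrite h1 h2 -mulmxA AA mulmxBl -mulmxA AB mulmx0 subr0 -mulmxDr AplusB mulmx1.
  by [].
have [U1 [V1 [g [[oU1 oV1 U1x1 U1W] [sg gK cK]]]]] := inverse_function oW Wx1 sc dc.
pose U2 := [set y | U1 y /\ U1 (r y)].
have oU2 : open U2 by apply: open_preimage => [//|//|x /U1W]; exact: (sr 0%N).
pose V2 := [set z | V1 z /\ U2 (g z)].
have oV2 : open V2 by apply: open_preimage => [//|//|x]; exact: (sg 0%N).
exists (\dim (limg (linfun (mulmxr_lin A)))), U2, V2, c, g, (limg (linfun (mulmxr_lin A))).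
split; first by split=> //; split; rewrite ?rx1.
split.
  split.
  - by move=> k; apply: Ck_on_sub (sc k) => y [/U1W].
  - by move=> k; apply: Ck_on_sub (sg k) => z [].
  - by move=> y U2y; have [U1y _] := U2y; have [h1 h2] := gK _ U1y; split=> //; split=> //; rewrite h2.
  - by move=> z [Vz U2z]; split=> //; have [] := cK _ Vz.
split=> // y [U1y U1r].
have Wy := U1W _ U1y.
split=> [M1y|/memv_imgP[w _]].
  have [ry _] := M1r _ M1y (WW0 _ Wy).
  rewrite cE ry subrr mul0mx addr0 -mulmxr_linE -(lfunE (mulmxr_lin A)).
  exact: (memv_img _ (memvf _)).
rewrite lfunE mulmxr_linE => cyE.
have M1ry := rM1 _ Wy; have [rr _] := M1r _ M1ry (WW0 _ (U1W _ U1r)).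
have cyA : c y = r y *m A.
  have : c y *m A = c y by rewrite cyE -mulmxA AA.
  move=> <-; rewrite cE mulmxDl -!mulmxA AA.
  have -> : B *m A = 0 by rewrite mulmxBl mul1mx AA subrr.
  by rewrite mulmx0 addr0.
have cr : c (r y) = c y by rewrite cyA cE rr subrr mul0mx addr0.
have [_ g1] := gK _ U1y; have [_ g2] := gK _ U1r.
by rewrite -g1 -cr g2.
Qed.
End Product.

Section ProductSubmanifold.
Variables (R : realType) (N1 N2 N : nat).
Variables (P1 : 'M[R]_(N1, N)) (P2 : 'M[R]_(N2, N)) (Q1 : 'M[R]_(N, N1)) (Q2 : 'M[R]_(N, N2)).
Hypotheses (P1Q1 : P1 *m Q1 = 1%:M) (P2Q2 : P2 *m Q2 = 1%:M)
  (P1Q2 : P1 *m Q2 = 0) (P2Q1 : P2 *m Q1 = 0) (QP : Q1 *m P1 + Q2 *m P2 = 1%:M).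
Variables (M1 : set 'rV[R]_N1) (M2 : set 'rV[R]_N2).
Let M := [set z | exists x1 x2, [/\ M1 x1, M2 x2 & z = x1 *m P1 + x2 *m P2]].

Let chart_dims n x1 x2 d1 d2 : M1 x1 -> M2 x2 ->
  slice_chart n M (x1 *m P1 + x2 *m P2) -> slice_chart d1 M1 x1 ->
  slice_chart d2 M2 x2 -> (n = d1 + d2)%N.
Proof.
move=> M1x1 M2x2 cM c1 c2.
have Mx : M (x1 *m P1 + x2 *m P2) by exists x1, x2.
have [S [dimS SP]] := chart_tangent Mx cM.
have [S1 [dimS1 S1P]] := chart_tangent M1x1 c1.
have [S2 [dimS2 S2P]] := chart_tangent M2x2 c2.
have tP v : v \in S <-> v *m Q1 \in S1 /\ v *m Q2 \in S2.
  have := tangent_prod P1Q1 P2Q2 P1Q2 P2Q1 QP M1 M2 (x1 *m P1 + x2 *m P2) v.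
  rewrite (prodQ1 P1Q1 P2Q1) (prodQ2 P2Q2 P1Q2) -/M => h.
  by rewrite -(SP v) h (S1P _) (S2P _).
pose l1 := linfun (mulmxr_lin P1); pose l2 := linfun (mulmxr_lin P2).
have l1E x : l1 x = x *m P1 by rewrite lfunE.
have l2E x : l2 x = x *m P2 by rewrite lfunE.
have cap0 : (l1 @: S1 :&: l2 @: S2)%VS = 0%VS.
  apply/eqP; rewrite -subv0; apply/subvP => w.
  rewrite memv_cap => /andP[/memv_imgP[u _ ->] /memv_imgP[u' _]].
  rewrite l1E l2E => e; rewrite memv0.
  have := congr1 (mulmx^~ Q1) e; rewrite -!mulmxA P1Q1 P2Q1 mulmx1 mulmx0 => ->.
  by rewrite mul0mx.
have SE : S = (l1 @: S1 + l2 @: S2)%VS.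
  apply/eqP; rewrite eqEsubv; apply/andP; split; apply/subvP => w.
    move/tP => [h1 h2]; rewrite -(prodE QP w) memv_add // -?l1E -?l2E; exact: memv_img.
  case/memv_addP => _ /memv_imgP[u uS ->] [_ /memv_imgP[u' u'S ->] ->].
  by apply/tP; rewrite l1E l2E (prodQ1 P1Q1 P2Q1) (prodQ2 P2Q2 P1Q2).
rewrite -dimS SE dimv_disjoint_sum // !limg_dim_eq ?dimS1 ?dimS2 //.
- apply/eqP; rewrite -subv0; apply/subvP => w.
  rewrite memv_cap memv_ker l2E memv0 => /andP[_ /eqP /(congr1 (mulmx^~ Q2))].
  by rewrite -mulmxA P2Q2 mulmx1 mul0mx => ->.
- apply/eqP; rewrite -subv0; apply/subvP => w.
  rewrite memv_cap memv_ker l1E memv0 => /andP[_ /eqP /(congr1 (mulmx^~ Q1))].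
  by rewrite -mulmxA P1Q1 mulmx1 mul0mx => ->.
Qed.

(** The dimensions of the factors cannot vary from point to point because
    their sum is that of the product. *)
Theorem factors_submanifold n a b : M1 a -> M2 b -> submanifold n M ->
  exists n1 n2, submanifold n1 M1 /\ submanifold n2 M2.
Proof.
move=> M1a M2b sM.
have cM x1 x2 : M1 x1 -> M2 x2 -> slice_chart n M (x1 *m P1 + x2 *m P2).
  by move=> h1 h2; apply: sM; exists x1, x2.
have c1 x1 : M1 x1 -> exists n1, slice_chart n1 M1 x1.
  move=> h1; exact: (factor_chart P1Q1 P2Q2 P1Q2 P2Q1 QP h1 M2b (cM _ _ h1 M2b)).
have c2 x2 : M2 x2 -> exists n2, slice_chart n2 M2 x2.
  move=> h2; have QP' : Q2 *m P2 + Q1 *m P1 = 1%:M by rewrite addrC.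
  apply: (factor_chart P2Q2 P1Q1 P2Q1 P1Q2 QP' h2 M1a).
  rewrite addrC (_ : [set z | _] = M); first exact: cM.
  by apply/seteqP; split=> z [u [v [hu hv ->]]]; exists v, u; rewrite addrC.
have [n1 c1a] := c1 a M1a; have [n2 c2b] := c2 b M2b.
have n12 := chart_dims M1a M2b (cM _ _ M1a M2b) c1a c2b.
exists n1, n2; split=> x Mx.
  have [m cx] := c1 x Mx.
  have := chart_dims Mx M2b (cM _ _ Mx M2b) cx c2b; rewrite n12 => /addIn e.
  by rewrite e.
have [m cx] := c2 x Mx.
have := chart_dims M1a Mx (cM _ _ M1a Mx) c1a cx; rewrite n12 => /addnI e.
by rewrite e.
Qed.
End ProductSubmanifold.

(** * Geometry of the orbit *)
Section BaseChange.
Variables (R : realType) (p q : nat) (M : set 'rV[R]_(p + q)) (g : vectType R)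
  (br : lieAlgebra g) (ip : {bilinear g -> g -> R^o}) (D theta : 'End(g)).
Hypothesis tri : weak_extrinsic_symmetric_triple br ip D theta.
Local Notation orbit := (orbit_of_0 br D theta).
Local Opaque lfun_exp exp_phi aff_gen.

(** L is the product of the automorphisms exp (ad X), the linear part of the
    transvection that carries the origin to y. *)
Lemma orbit_homogeneous y : orbit y -> exists L : 'End(g),
  [/\ forall z, L z = 0 -> z = 0, forall z, z \in g_m theta -> L z \in g_m theta,
      forall z w, ip (L z) (L w) = ip z w &
      forall w, orbit w <-> exists2 z, orbit z & w = y + L z].
Proof.
elim=> [|X {}y hX _ [L [L0 Lm Lip Lorb]]].
  exists \1%VF; split=> [z|z|z w|w]; rewrite ?id_lfunE //.
  split=> [h|[z hz ->]]; last by rewrite add0r id_lfunE.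
  by exists w => //; rewrite id_lfunE add0r.
exists (lfun_exp (ad br X) \o L)%VF; split=> [z|z|z w|w]; rewrite ?comp_lfunE.
- move=> h; apply: L0; rewrite -(lfun_expN (ad br X) (L z)) h.
  exact: linear0.
- by move=> /Lm; exact: (exp_ad_m tri hX).
- by rewrite (exp_ad_isometry tri).
split=> [hw|[z hz ->]].
  have : orbit (exp_phi br D (- X) w) by apply: orbit_of_0_step; rewrite ?memvN.
  move=> /Lorb[z hz e]; exists z => //; rewrite comp_lfunE addrC -exp_phiD -e.
  by rewrite exp_phiVK.
rewrite comp_lfunE addrC -exp_phiD; apply: orbit_of_0_step => //.
by apply/Lorb; exists z.
Qed.

(** With L as in orbit_homogeneous, J o L replaces J.  It is therefore enough
    to compare geometry and algebra at the base point. *)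
Lemma associated_triple_base x0 x : associated_triple M x0 br ip D theta -> M x ->
  associated_triple M x br ip D theta.
Proof.
move=> [J [J0 [hullM hullW] Jip ME]]; rewrite {1}ME => -[y hy xE].
have [L [L0 Lm Lip Lorb]] := orbit_homogeneous hy.
have JL z : (J \o L)%VF z = J (L z) by rewrite comp_lfunE.
have LJ : ((J \o L) @: g_m theta = J @: g_m theta)%VS.
  rewrite limg_comp; congr (J @: _)%VS; apply/eqP; rewrite eqEdim.
  rewrite limg_dim_eq ?leqnn ?andbT.
    by apply/subvP => _ /memv_imgP[z hz ->]; apply: Lm.
  apply/eqP; rewrite -subv0; apply/subvP => z; rewrite memv_cap memv_ker memv0.
  by move=> /andP[_ /eqP /L0 ->].
exists (J \o L)%VF; split.
- by move=> u hu; rewrite JL => /(J0 _ (Lm _ hu)) /L0.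
- rewrite LJ; have MW z : M z -> z - x0 \in (J @: g_m theta)%VS by exact: hullM.
  have xW : x - x0 \in (J @: g_m theta)%VS by apply: MW; rewrite ME; exists y.
  split=> [z /MW zW|W' hW'].
    by rewrite -[z](subrK x0) -addrA -[x0 - x]opprB; apply: memvB.
  have Mx0 : M x0 by rewrite ME; exists 0; [exact: orbit_of_0_base|rewrite linear0 addr0].
  apply: hullW => z /hW' h.
  rewrite -[z](subrK x) -addrA -[x - x0]opprB; apply: memvB => //.
  exact: hW'.
- by move=> u v hu hv; rewrite !JL Jip ?Lip //; apply: Lm.
rewrite ME; apply/seteqP; split=> [_ [w /Lorb[z hz ->] <-]|_ [z hz <-]].
  by exists z => //; rewrite JL -xE linearD /= addrA.
exists (y + L z); first by apply/Lorb; exists z.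
by rewrite JL -xE linearD /= addrA.
Qed.
End BaseChange.

Section ExpCurves.
Variables (R : realType) (V : vectType R) (F : 'End(V)).
Local Opaque lfun_exp.

(** The derivative of l (exp (t F)) has the same form, with the functional
    G |-> l (F o G). *)
Lemma smooth_exp_functional k (l : {linear 'End(V) -> R^o}) :
  Ck_on k setT (fun t : R^o => l (lfun_exp ((t : R) *: F)) : R^o).
Proof.
elim: k l => [|k IH] l /=.
  move=> t _; apply: differentiable_continuous; apply/derivable1_diffP.
  by have [] := lfun_exp_derive F l t.
have d t : differentiable (fun t : R^o => l (lfun_exp ((t : R) *: F)) : R^o) t.
  by apply/derivable1_diffP; have [] := lfun_exp_derive F l t.
split=> // v.
have h : linear (fun G : 'End(V) => (v : R) * l (F \o G)%VF : R^o).
  by move=> a G G'; rewrite comp_lfunDr -comp_lfunZr linearP mulrDr mulrCA.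
apply: Ck_on_eq (IH (linear_of h)); first exact: openT.
move=> t _ /=; rewrite (deriveE v (d t)).
have [_ <-] := lfun_exp_derive F l t.
rewrite (deriveE (1 : R^o) (d t)).
have e : v = (v : R) *: (1 : R^o) by rewrite -[RHS]/(v * 1) mulr1.
rewrite [in RHS]e; move: ('d _ _) => L; exact/esym/(linearZ_LR L).
Qed.

Lemma smooth_exp_curve N (l : {linear V -> 'rV[R]_N}) (z : V) (b : 'rV[R]_N) :
  let c := fun t : R^o => b + l (lfun_exp ((t : R) *: F) z) in
  [/\ smooth_on setT c, c 0 = b + l z & c^`()%classic 0 = l (F z)].
Proof.
move=> c.
have hj j : linear (fun G : 'End(V) => l (G z) 0 j : R^o).
  by move=> a G G'; rewrite add_lfunE scale_lfunE linearP !mxE.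
have cj j : (fun t => c t 0 j : R^o) =
    (fun t : R^o => (linear_of (hj j)) (lfun_exp ((t : R) *: F)) : R^o) + cst (b 0 j).
  by apply/funext => t; rewrite /c mxE addrC.
have sc : smooth_on setT c.
  move=> k; apply: Ck_on_coord => [|j]; first exact: openT.
  rewrite cj; apply: Ck_onD; [exact: openT|exact: smooth_exp_functional|exact: Ck_on_cst].
split=> //; first by rewrite /c scale0r lfun_exp0 id_lfunE.
have [dc _] := sc 1%N; have dc0 := dc 0 I.
apply/rowP => j.
have [dl dlE] := linear_rV_diff (linear_of (@coord_linear R N j)) (c 0).
have := derive1_chain dc0 dl; rewrite dlE /= => <-.
have -> : ((fun x : 'rV[R]_N => x 0 j) \o c) = (fun t => c t 0 j : R^o) by [].
have [h1 h2] := lfun_exp_derive F (linear_of (hj j)) 0.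
have [h3 h4] := is_deriveD (lfun_exp_derive F (linear_of (hj j)) 0) (is_derive_cst (b 0 j : R^o) (0 : R^o) 1).
rewrite cj derive1E h4 addr0 /= scale0r lfun_exp0.
by rewrite !comp_lfunE id_lfunE.
Qed.
End ExpCurves.

Lemma vderiv_near0 (R : realType) (V : vectType R) (Z : R -> V) (v : V) :
  (\forall t \near (0 : R^o), Z t = 0) -> vderiv Z 0 v -> v = 0.
Proof.
move=> Z0 h; apply: v2r_inj; rewrite linear0; apply/rowP => j; rewrite mxE.
have row_lin : linear (fun f : V => v2r f 0 j : R^o).
  by move=> a f f'; rewrite linearP !mxE.
have [_ e] := h (linear_of row_lin).
rewrite -[LHS]/(linear_of row_lin v) -e.
have z0 : \forall t \near (0 : R^o), (linear_of row_lin (Z t) : R^o) = cst (0 : R^o) t.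
  near=> t; have -> : Z t = 0 by near: t; exact: Z0.
  by rewrite linear0.
by rewrite (near_eq_derive _ z0) derive_cst.
Unshelve. all: by end_near. Qed.

Lemma vderiv_const (R : realType) (V : vectType R) (w : V) (t : R) : vderiv (fun _ => w) t 0.
Proof. by move=> l; rewrite linear0; exact: is_derive_cst. Qed.

Lemma curve_vderiv (R : realType) N (c : R^o -> 'rV[R]_N) (t : R^o) :
  differentiable c t -> vderiv c t (c^`()%classic t).
Proof.
move=> dc l; have [dl dlE] := linear_rV_diff l (c t).
have d := differentiable_comp dc dl.
have e := derive1_chain dc dl; rewrite dlE in e; rewrite -e derive1E.
by apply: DeriveDef => //; apply: diff_derivable.
Qed.

Section TangentSpace.
Variables (R : realType) (p q : nat) (M : set 'rV[R]_(p + q)) (g : vectType R)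
  (br : lieAlgebra g) (ip : {bilinear g -> g -> R^o}) (D theta : 'End(g)).
Hypothesis tri : weak_extrinsic_symmetric_triple br ip D theta.
Variables (x0 : 'rV[R]_(p + q)) (J : 'Hom(g, 'rV[R]_(p + q))).
Hypotheses (J0 : forall u, u \in g_m theta -> J u = 0 -> u = 0)
  (Jip : forall u v, u \in g_m theta -> v \in g_m theta -> pseudo_inner (J u) (J v) = ip u v)
  (ME : M = [set x0 + J y | y in orbit_of_0 br D theta]).
Local Notation orbit := (orbit_of_0 br D theta).
Local Notation T := (g_m_tm D theta).
Local Notation m := (g_p_tm D theta).
Local Notation N := (g_m_tp D theta).
Local Opaque lfun_exp exp_phi aff_gen.

Lemma M_base : M x0.
Proof. by rewrite ME; exists 0; [exact: orbit_of_0_base|rewrite linear0 addr0]. Qed.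

Lemma left_inverse_J : exists K : 'Hom('rV[R]_(p + q), g),
  forall u, u \in g_m theta -> K (J u) = u.
Proof.
pose f := (J \o projv (g_m theta))%VF.
exists (projv (g_m theta) \o f^-1)%VF => u hu; rewrite comp_lfunE.
have fu : f u = J u by rewrite comp_lfunE projv_id.
apply/eqP; rewrite -subr_eq0; apply/eqP; apply: J0.
  by apply: memvB => //; apply: memv_proj.
have e : f (f^-1%VF (J u)) = J u by rewrite -fu limg_lfunVK // memv_img ?memvf.
rewrite comp_lfunE in e; set w := projv _ _ in e *.
by have /= := linearB J w u; rewrite e subrr.
Qed.

(** Differentiate the curve exp_phi (t X) y. *)
Lemma orbit_velocity X y : X \in g_p theta -> orbit y ->
  tangent M (x0 + J y) (J (br X y - D X)).
Proof.
move=> hX hy.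
have l_lin : linear (fun z : (g * R^o)%type => J z.1) by move=> a u v; rewrite linearP.
have [sc c0 dc] := smooth_exp_curve (aff_gen br D X) (linear_of l_lin) (y, 1 : R^o) x0.
exists setT; eexists; split; first by split; [exact: openT| |exact: sc].
split; [move=> t _ |exact: c0|].
  rewrite ME; exists (exp_phi br D ((t : R) *: X) y).
    by apply: orbit_of_0_step => //; apply: memvZ.
  have -> : (t : R) *: aff_gen br D X = aff_gen br D ((t : R) *: X).
    apply/lfunP => z; rewrite scale_lfunE !aff_genE; congr pair => /=.
      by rewrite scalerBr brZl [D (_ *: X)]linearZ /= !scalerA mulrC.
    by rewrite -[LHS]/((t : R) * 0) mulr0.
  by rewrite exp_affE.
by rewrite dc /= aff_genE /= scale1r.
Qed.

Lemma T_tangent u : u \in T -> tangent M x0 (J u).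
Proof.
move=> uT; have DuM : D u \in m by apply: (DT tri).
have hX : D u \in g_p theta by move: DuM; rewrite memv_cap => /andP[].
have := orbit_velocity hX (orbit_of_0_base _ _ _).
rewrite linear0 addr0 br0r sub0r.
by move: uT; rewrite (memT tri) => /andP[_ /eqP ->]; rewrite opprK.
Qed.

Lemma T_sub_m u : u \in T -> u \in g_m theta.
Proof. by rewrite memv_cap => /andP[]. Qed.

(** The equation for w is the linear part at the origin of the cubic equation
    of the orbit. *)
Lemma tangent_m v : tangent M x0 v -> exists2 w, w \in g_m theta &
  v = J w /\ forall z, D (D (br w z)) + D (br w (D z)) + br w (D (D z)) + br w z = 0.
Proof.
move=> [I [c [[oI I0 sc] [cM c0 c'0]]]].
have [K KJ] := left_inverse_J.
have [dc _] := sc 1%N.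
have dv : vderiv (fun t => c t - x0) 0 v.
  by rewrite -[v]addr0 -c'0; apply: vderivD; [exact: curve_vderiv (dc _ I0)|exact: vderiv_const].
have nearI : \forall t \near (0 : R^o), I t by move: oI; rewrite openE; apply.
have yorb t : I t -> orbit (K (c t - x0)) /\ c t - x0 = J (K (c t - x0)).
  move=> /cM; rewrite ME => -[y hy <-]; rewrite addrC addKr KJ //.
  exact: (orbit_m tri hy).
pose y t := K (c t - x0).
have dy : vderiv y 0 (K v) by exact: (vderiv_lin K dv).
have y0 : y 0 = 0 by rewrite /y c0 subrr linear0.
have vE : v = J (K v).
  apply/eqP; rewrite -subr_eq0; apply/eqP.
  have dN := vderivD dv (vderiv_lin (- J)%VF dy).
  have -> : v - J (K v) = v + (- J)%VF (K v) by rewrite opp_lfunE.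
  apply: vderiv_near0 dN; near=> t.
  have /yorb[_ h] : I t by near: t; exact: nearI.
  by rewrite /= opp_lfunE /y -h subrr.
exists (K v).
  rewrite mem_g_m -addr_eq0; apply/eqP.
  have -> : theta (K v) + K v = (theta + \1)%VF (K v) by rewrite add_lfunE id_lfunE.
  apply: vderiv_near0 (vderiv_lin (theta + \1)%VF dy); near=> t.
  have /yorb[/(orbit_m tri) h _] : I t by near: t; exact: nearI.
  by move: h; rewrite mem_g_m -/(y t) => /eqP h; rewrite /= add_lfunE id_lfunE h addNr.
split=> // z.
have brl b : linear (fun a => br a b) by move=> k a a'; rewrite brDl brZl.
have brr a : linear (br a) by move=> k b b'; rewrite brDr brZr.
have dP Z w : vderiv Z 0 w -> vderiv (fun t => D (Z t) + br (y t) (Z t)) 0 (D w + br (K v) (Z 0)).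
  move=> hZ; apply: vderivD; first exact: (vderiv_lin D hZ).
  by have := vderiv_bilin brl brr dy hZ; rewrite y0 br0l addr0.
have d1 := dP _ _ (vderiv_const z 0).
have d2 := dP _ _ d1; have d3 := dP _ _ d2.
rewrite y0 in d2 d3; have d4 := vderivD d3 d1.
have := vderiv_near0 _ d4; rewrite linear0 add0r !br0l !addr0.
rewrite [D (D (br (K v) z) + _)]linearD; apply; near=> t.
have /yorb[/(orbit_cubic tri) h _] : I t by near: t; exact: nearI.
by have /= -> := h z; rewrite addNr.
Unshelve. all: by end_near. Qed.
End TangentSpace.

Section PseudoInner.
Variables (R : realType) (p q : nat).
Implicit Types x y z : 'rV[R]_(p + q).

Lemma pseudo_innerC x y : pseudo_inner x y = pseudo_inner y x.
Proof. by rewrite /pseudo_inner; congr (_ - _); apply: eq_bigr => i _; rewrite mulrC. Qed.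

Lemma pseudo_inner_linear x : linear (pseudo_inner x : _ -> R^o).
Proof.
move=> a y z.
suff : pseudo_inner x (a *: y + z) = a * pseudo_inner x y + pseudo_inner x z by [].
rewrite /pseudo_inner mulrBr !mulr_sumr addrACA -opprD -!big_split /=; congr (_ - _); apply: eq_bigr => i _;
by rewrite !mxE mulrDr mulrCA.
Qed.

Lemma pseudo_innerDl x y z : pseudo_inner (x + y) z = pseudo_inner x z + pseudo_inner y z.
Proof.
have := pseudo_inner_linear z 1 x y; rewrite !scale1r.
by rewrite ![pseudo_inner z _]pseudo_innerC.
Qed.

Lemma pseudo_innerNl x y : pseudo_inner (- x) y = - pseudo_inner x y.
Proof.
apply/eqP; rewrite -addr_eq0 -pseudo_innerDl addNr.
rewrite pseudo_innerC; apply/eqP.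
exact: (linear0 (linear_of (pseudo_inner_linear y))).
Qed.
End PseudoInner.

Section SecondFundamentalForm.
Variables (R : realType) (p q n : nat) (M : set 'rV[R]_(p + q)) (g : vectType R)
  (br : lieAlgebra g) (ip : {bilinear g -> g -> R^o}) (D theta : 'End(g)).
Hypothesis tri : weak_extrinsic_symmetric_triple br ip D theta.
Hypothesis full : full_triple br D theta.
Hypothesis M_nd : nondegenerate_submanifold n M.
Variables (x0 : 'rV[R]_(p + q)) (J : 'Hom(g, 'rV[R]_(p + q))).
Hypotheses (J0 : forall u, u \in g_m theta -> J u = 0 -> u = 0)
  (Jip : forall u v, u \in g_m theta -> v \in g_m theta -> pseudo_inner (J u) (J v) = ip u v)
  (ME : M = [set x0 + J y | y in orbit_of_0 br D theta]).
Local Notation orbit := (orbit_of_0 br D theta).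
Local Notation T := (g_m_tm D theta).
Local Notation m := (g_p_tm D theta).
Local Notation N := (g_m_tp D theta).
Local Opaque lfun_exp exp_phi aff_gen.

Let Mx0 : M x0 := M_base ME.

Lemma N_sub_m u : u \in N -> u \in g_m theta.
Proof. by rewrite memv_cap => /andP[]. Qed.

Lemma g_m_dec w : w \in g_m theta ->
  exists wT wN, [/\ wT \in T, wN \in N & w = wT + wN].
Proof.
rewrite mem_g_m => /eqP thw; exists (- D (D w)), (w + D (D w)).
have DN z : D (- z) = - D z by exact: linearN.
have thDD : theta (D (D w)) = - D (D w) by rewrite !(thD' tri) thw !DN !opprK.
have thT : theta (- D (D w)) = - - D (D w) by rewrite (linearN theta (D (D w))) /= thDD.
have thN : theta (w + D (D w)) = - (w + D (D w)) by rewrite linearD /= thw thDD opprD.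
split; last by rewrite addrC addrK.
  by rewrite (memT tri) thT eqxx /= !DN (D3 tri) eqxx.
by rewrite (memN tri) thN eqxx /= linearD /= (D3 tri) subrr.
Qed.

Lemma ip_NT u v : u \in N -> v \in T -> ip u v = 0.
Proof.
rewrite (memN tri) (memT tri) => /andP[_ /eqP h1] /andP[_ /eqP h2].
exact: (ip_perp tri).
Qed.

(** Subtracting a vector of J T leaves a tangent vector J w with w in N, so
    that D commutes with ad w.  The linearized cubic equation becomes
    3 [w, D^2 z] + [w, z] = 0, which makes w central.  Then w is orthogonal to
    N = [m, T] and to T, and J w = 0 by non-degeneracy. *)
Lemma tangent_T v : tangent M x0 v <-> exists2 u, u \in T & v = J u.
Proof.
split=> [tv|[u uT ->]]; last exact: (T_tangent tri ME).
have [S [_ hS]] := chart_tangent Mx0 (M_nd.1 _ Mx0).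
have [w hw [vE _]] := tangent_m tri J0 ME tv.
have [wT [wN [hT hN wE]]] := g_m_dec hw.
have tN : tangent M x0 (J wN).
  have -> : J wN = v - J wT by rewrite vE wE linearD /= addrC addKr.
  by apply/hS/memvB; apply/hS => //; apply: (T_tangent tri ME).
have [w' hw' [w'E hz]] := tangent_m tri J0 ME tN.
have e : w' = wN.
  apply/eqP; rewrite -subr_eq0; apply/eqP/J0; first by apply: memvB => //; apply: N_sub_m.
  by rewrite linearB /= w'E subrr.
rewrite e {w' hw' w'E e} in hz.
have DwN : D wN = 0 by move: hN; rewrite (memN tri) => /andP[_ /eqP].
have Db z : D (br wN z) = br wN (D z) by rewrite (Dbr tri) DwN br0l add0r.
have hz3 z : br wN (D (D z)) *+ 3 + br wN z = 0.
  by have := hz z; rewrite !Db mulrS mulr2n addrA => ->.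
have central z : br wN z = 0.
  have h1 := hz3 (D (D z)); rewrite (D3 tri) brNr mulNrn in h1.
  have h2 : br wN (D (D z)) = 0.
    move/eqP: h1; rewrite mulrS opprD addrAC addNr add0r oppr_eq0 -scaler_nat scaler_eq0 pnatr_eq0 /=.
    by move=> /eqP.
  by have := hz3 z; rewrite h2 mul0rn add0r.
have ipN y : y \in N -> ip wN y = 0.
  rewrite full => /lie_prodP[k [a [b [_ _ ->]]]].
  by rewrite ip_sumr big1 // => i _; rewrite -(ip_br2 tri) central ip0l.
have : J wN = 0.
  apply: (M_nd.2 _ _ Mx0 tN) => v' /(tangent_m tri J0 ME)[w' hw' [-> _]].
  have [wT' [wN' [hT' hN' ->]]] := g_m_dec hw'.
  have wm : wT' + wN' \in g_m theta by apply: memvD; [exact: T_sub_m hT'|exact: N_sub_m hN'].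
  rewrite (Jip (N_sub_m hN) wm).
  by rewrite ipDr ip_NT // ipN // addr0.
by move=> h; exists wT => //; rewrite vE wE linearD /= h addr0.
Qed.

Lemma N_normal w : w \in N -> normal M x0 (J w).
Proof.
move=> hN v /tangent_T[u uT ->].
by rewrite (Jip (N_sub_m hN) (T_sub_m uT)) ip_NT.
Qed.

Lemma tangent_normal0 v : tangent M x0 v -> normal M x0 v -> v = 0.
Proof. exact: M_nd.2. Qed.

Lemma dim_T : \dim T = n.
Proof.
have [S [<- hS]] := chart_tangent Mx0 (M_nd.1 _ Mx0).
have -> : S = (J @: T)%VS.
  apply/eqP; rewrite eqEsubv; apply/andP; split; apply/subvP => v.
    by move=> /hS/tangent_T[u uT ->]; apply: memv_img.
  by move=> /memv_imgP[u uT ->]; apply/hS/tangent_T; exists u.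
rewrite limg_dim_eq //; apply/eqP; rewrite -subv0; apply/subvP => z.
rewrite memv_cap memv_ker memv0 => /andP[hT /eqP h].
by apply/eqP; exact: (J0 (T_sub_m hT) h).
Qed.

Variables (alpha A : 'rV[R]_(p + q) -> 'rV[R]_(p + q) -> 'rV[R]_(p + q) -> 'rV[R]_(p + q))
  (h : 'rV[R]_(p + q) -> 'rV[R]_(p + q)).
Hypotheses (alpha_sff : second_fundamental_form M alpha)
    (A_shape : shape_operator M alpha A)
    (h_mean : mean_curvature n M alpha h).

(** The affine vector field y |-> [D v, y] + v is tangent to M and takes the
    value v at the origin; its derivative [D v, u] is already normal. *)
Lemma alphaE u v : u \in T -> v \in T -> alpha x0 (J u) (J v) = J (br (D v) u).
Proof.
move=> uT vT; have [K KJ] := left_inverse_J J0.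
have vm : D v \in m by apply: (DT tri).
have hX : D v \in g_p theta by move: vm; rewrite memv_cap => /andP[].
have l_lin : linear (fun y : 'rV[R]_(p + q) => J (br (D v) (K y)) : 'rV[R]_(p + q)).
  by move=> k z z'; rewrite linearP brDr brZr linearP.
pose l := linear_of l_lin : {linear 'rV[R]_(p + q) -> 'rV[R]_(p + q)}; pose b := - l x0 - J (D (D v)).
pose Y y := l y + b.
have YE y : Y y = J (br (D v) (K (y - x0)) - D (D v)).
  have lE w : l w = J (br (D v) (K w)) by [].
  have lB : l (y - x0) = l y - l x0 by exact: linearB.
  rewrite lE in lB; have JB z z' : J (z - z') = J z - J z' by exact: linearB.
  by rewrite /Y /b addrA -lB JB.
have lc := @linear_rV_continuous _ _ _ l.
have sY : smooth_on setT Y by move=> k; apply: (Ck_on_affine k b openT lc).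
have tY y : setT y -> M y -> tangent M y (Y y).
  move=> _; rewrite {1}ME => -[w hw <-].
  rewrite YE [x0 + J w - x0]addrC addKr (KJ _ (orbit_m tri hw)).
  exact: (orbit_velocity ME hX hw).
have DDv : D (D v) = - v by move: vT; rewrite (memT tri) => /andP[_ /eqP].
have Yx0 : Y x0 = J v by rewrite YE subrr linear0 br0r DDv sub0r opprK.
have [na ta] := alpha_sff Mx0 (T_tangent tri ME uT) openT I sY tY.
have dY : 'D_(J u) Y x0 = J (br (D v) u).
  have [dl dlE] := linear_rV_diff l x0.
  have -> : Y = (l : 'rV[R]_(p + q) -> 'rV[R]_(p + q)) + cst b by [].
  rewrite deriveD; [|exact: diff_derivable|exact: derivable_cst].
  by rewrite derive_cst addr0 (deriveE (J u) dl) dlE /= (KJ _ (T_sub_m uT)).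
rewrite Yx0 dY in na ta.
apply/eqP; rewrite eq_sym -subr_eq0; apply/eqP; apply: tangent_normal0 => // w tw.
rewrite pseudo_innerDl pseudo_innerNl (na _ tw) subr0.
by apply: N_normal => //; apply: (br_mT tri).
Qed.

Lemma tangent_frame : exists e : seq g,
  [/\ forall a, a \in e -> a \in T,
      forall x, x \in T -> x = \sum_(a <- e) (ip a a * ip x a) *: a &
      h x0 = n%:R^-1 *: J (mean_vector br ip D e)].
Proof.
have [|s1 [s2 [[hp h1 h2] sz sT sexp]]] :=
  ortho_basis (f := ip) (ipC tri) (ip_linear ip) (U := T).
  by move=> x xT hx; apply: (ipT_nondeg tri).
exists (s1 ++ s2); split=> //.
have szn : size (s1 ++ s2) = n by rewrite size_cat sz dim_T.
pose e (i : 'I_n) := J (s1 ++ s2)`_i.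
have sTi (i : 'I_n) : (s1 ++ s2)`_i \in T by apply: sT; rewrite mem_nth ?szn.
have eip i j : pseudo_inner (e i) (e j) = ip (s1 ++ s2)`_i (s1 ++ s2)`_j.
  exact: (Jip (T_sub_m (sTi i)) (T_sub_m (sTi j))).
have frame : orthonormal_frame M x0 e.
  split=> [i|i j|i].
  - by apply/tangent_T; exists (s1 ++ s2)`_i.
  - rewrite eip => ij; have [lt|lt|eq] := ltngtP i j.
    + by apply/eqP; move/(pairwiseP 0): hp; apply; rewrite ?inE ?szn.
    + by rewrite (ipC tri); apply/eqP; move/(pairwiseP 0): hp; apply; rewrite ?inE ?szn.
    by rewrite (val_inj eq) eqxx in ij.
  rewrite eip; have : (s1 ++ s2)`_i \in s1 ++ s2 by rewrite mem_nth ?szn.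
  by rewrite mem_cat => /orP[/h1|/h2]; [left|right].
rewrite (h_mean Mx0 frame); congr (_ *: _).
rewrite /mean_vector linear_sum (big_nth 0) big_mkord szn; apply: eq_bigr => i _.
by rewrite eip alphaE // linearZ.
Qed.

Lemma shape_mean e : (forall a, a \in e -> a \in T) ->
  h x0 = n%:R^-1 *: J (mean_vector br ip D e) ->
  forall u, u \in T ->
  A x0 (h x0) (J u) = n%:R^-1 *: J (br (mean_vector br ip D e) (D u)).
Proof.
move=> eT hE u uT; set H := mean_vector _ _ _ _ in hE *.
have HN : H \in N by exact: (mean_vectorN tri eT).
have hN : normal M x0 (h x0).
  by rewrite hE -linearZ /=; apply: N_normal; apply: memvZ.
have [ta aE] := A_shape Mx0 hN (T_tangent tri ME uT).
have [a aT Aa] := (tangent_T _).1 ta.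
have HDu : br H (D u) \in T by apply: (br_Nm tri) => //; apply: (DT tri).
rewrite Aa -linearZ /=; congr (J _); apply/eqP; rewrite -subr_eq0; apply/eqP.
apply: (ipT_nondeg tri) => [|v vT]; first by apply: memvB => //; apply: memvZ.
have := aE _ (T_tangent tri ME vT); rewrite Aa alphaE // hE -linearZ /=.
have DDv : D (D v) = - v by move: vT; rewrite (memT tri) => /andP[_ /eqP].
have DDu : D (D u) = - u by move: uT; rewrite (memT tri) => /andP[_ /eqP].
have DvuN : br (D v) u \in N by apply: (br_mT tri) => //; apply: (DT tri).
have HnN : n%:R^-1 *: H \in N by apply: memvZ.
rewrite (Jip (T_sub_m aT) (T_sub_m vT)) (Jip (N_sub_m DvuN) (N_sub_m HnN)) => e1.
have e2 : br (D v) u = br (D u) v.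
  have [_ <-] := br_mm tri (x := D v) (y := u) (D3 tri v) DDu.
  by rewrite DDv brNl -brC.
by rewrite ipBl e1 ipZr ipZl (ip_br2 tri H) e2 [ip _ H](ipC tri) subrr.
Qed.
End SecondFundamentalForm.

(** * Orthogonal splittings of the ambient space *)
Section InjectiveDim.
Variables (R : realType) (m d : nat).
Lemma injective_dim (f : 'rV[R]_m -> 'rV[R]_d) : linear f ->
  (forall c, f c = 0 -> c = 0) -> (m <= d)%N.
Proof.
move=> flin finj; pose A := lin1_mx (linear_of flin).
have : row_free A by apply: inj_row_free => c; rewrite mul_rV_lin1 /= => /finj.
by rewrite /row_free => /eqP <-; exact: rank_leq_col.
Qed.
End InjectiveDim.

Section SquareNorm.
Variables (R : realType).
Definition sqnorm d (u : 'rV[R]_d) : R := \sum_i u 0 i ^+ 2.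

Lemma sqnorm_ge0 d (u : 'rV[R]_d) : 0 <= sqnorm u.
Proof. by apply: sumr_ge0 => i _; apply: sqr_ge0. Qed.

Lemma sqnorm_eq0 d (u : 'rV[R]_d) : sqnorm u = 0 -> u = 0.
Proof.
move=> /eqP; rewrite psumr_eq0 => [/allP h|i _]; last exact: sqr_ge0.
apply/rowP => i; rewrite mxE; apply/eqP.
by have := h i (mem_index_enum i); rewrite sqrf_eq0.
Qed.

Lemma pseudo_inner_sq p q (x : 'rV[R]_(p + q)) :
  pseudo_inner x x = sqnorm (lsubmx x) - sqnorm (rsubmx x).
Proof. by congr (_ - _); apply: eq_bigr => i _; rewrite !mxE expr2. Qed.

Lemma pseudo_inner_nondeg p q (x : 'rV[R]_(p + q)) :
  (forall y, pseudo_inner x y = 0) -> x = 0.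
Proof.
move=> h; have := h (row_mx (lsubmx x) (- rsubmx x)).
rewrite /pseudo_inner => e; have e' : sqnorm (lsubmx x) + sqnorm (rsubmx x) = 0.
  rewrite -[RHS]e -sumrN; congr (_ + _); apply: eq_bigr => i _.
    by rewrite row_mxEl !mxE expr2.
  by rewrite row_mxEr !mxE mulrN opprK expr2.
move/eqP: e'; rewrite paddr_eq0 ?sqnorm_ge0 // => /andP[/eqP/sqnorm_eq0 h1 /eqP/sqnorm_eq0 h2].
by rewrite -[x]hsubmxK h1 h2 row_mx0.
Qed.
End SquareNorm.

Section Frames.
Variables (R : realType) (p q : nat).
Local Notation E := 'rV[R]_(p + q).
Local Notation f := (@pseudo_inner R p q).
Implicit Types (x y z : E).

Lemma pseudo_inner_sign a b (x y : 'rV[R]_(a + b)) :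
  pseudo_inner x y = \sum_(i < a + b) (-1) ^+ (a <= i)%N * (x 0 i * y 0 i).
Proof.
rewrite big_split_ord /pseudo_inner -sumrN; congr (_ + _); apply: eq_bigr => i _ /=.
  by rewrite leqNgt ltn_ord mul1r.
by rewrite leq_addr expr1 mulN1r.
Qed.

Section Frame.
Variables (s1 s2 : seq E) (V : {vspace E}).
Hypotheses (ON : orthonormal f s1 s2) (sV : forall e, e \in s1 ++ s2 -> e \in V)
  (s_exp : forall x, x \in V -> x = \sum_(e <- s1 ++ s2) (f e e * f x e) *: e).
Local Notation a := (size s1).
Local Notation b := (size s2).
Definition frame_mx : 'M[R]_(a + b, p + q) := \matrix_(i < a + b) nth 0 (s1 ++ s2) i.

(** The coordinates of x in the frame s1 ++ s2, the vectors of s1 being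
    positive and those of s2 negative. *)
Definition coframe x : 'rV[R]_(a + b) :=
  \row_i ((-1) ^+ (a <= i)%N * f x (nth 0 (s1 ++ s2) i)).
Lemma coframe_linear : linear coframe.
Proof.
move=> k x y; apply/rowP => i; rewrite !mxE ![f _ (nth 0 _ _)]pseudo_innerC.
by rewrite (pseudo_inner_linear _ k x y) mulrDr mulrCA.
Qed.
Definition coframe_mx : 'M[R]_(p + q, a + b) := lin1_mx (linear_of coframe_linear).

Lemma coframeE x i : (x *m coframe_mx) 0 i = (-1) ^+ (a <= i)%N * f x (nth 0 (s1 ++ s2) i).
Proof. by rewrite mul_rV_lin1 -[LHS]/(coframe x 0 i) mxE. Qed.

Lemma frame_f (i j : 'I_(a + b)) :
  f (nth 0 (s1 ++ s2) i) (nth 0 (s1 ++ s2) j) = (-1) ^+ (a <= i)%N *+ (i == j).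
Proof.
have [hp h1 h2] := ON; have sz : size (s1 ++ s2) = (a + b)%N by rewrite size_cat.
have [lt|lt|eq] := ltngtP i j.
- rewrite -val_eqE (ltn_eqF lt) mulr0n; apply/eqP.
  by move/(pairwiseP 0): hp; apply; rewrite ?inE ?sz.
- rewrite -val_eqE (gtn_eqF lt) mulr0n pseudo_innerC; apply/eqP.
  by move/(pairwiseP 0): hp; apply; rewrite ?inE ?sz.
rewrite (val_inj eq) eqxx mulr1n nth_cat; case: ltnP => h.
  by rewrite h1 ?mem_nth.
by rewrite h2 ?mem_nth // ltn_subLR // ltn_ord.
Qed.

Lemma frameK : frame_mx *m coframe_mx = 1%:M.
Proof.
apply/row_matrixP => i; rewrite row_mul rowK; apply/rowP => j.
by rewrite coframeE !mxE pseudo_innerC frame_f mulrnAr -expr2 sqrr_sign eq_sym.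
Qed.

Lemma frame_adjoint (x : 'rV[R]_(a + b)) z : f (x *m frame_mx) z = pseudo_inner x (z *m coframe_mx).
Proof.
rewrite [RHS]pseudo_inner_sign mulmx_sum_row [LHS]pseudo_innerC.
have -> : f z (\sum_i x 0 i *: row i frame_mx) = \sum_i f z (x 0 i *: row i frame_mx).
  exact: (linear_sum (linear_of (pseudo_inner_linear z))).
apply: eq_bigr => i _; rewrite rowK coframeE.
have -> : f z (x 0 i *: (s1 ++ s2)`_i) = x 0 i * f z (s1 ++ s2)`_i.
  exact: (linearZ_LR (linear_of (pseudo_inner_linear z))).
by rewrite [RHS]mulrCA; congr (_ * _); rewrite mulrA -expr2 sqrr_sign mul1r.
Qed.

Lemma frame_mem (x : 'rV[R]_(a + b)) : x *m frame_mx \in V.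
Proof.
rewrite mulmx_sum_row; apply: memv_suml => i _; apply: memvZ; rewrite rowK.
by apply/sV/mem_nth; rewrite size_cat.
Qed.

Lemma frame_proj x : x \in V -> x *m coframe_mx *m frame_mx = x.
Proof.
move=> /s_exp {2}->; rewrite mulmx_sum_row (big_nth 0) big_mkord size_cat.
apply: eq_bigr => i _; rewrite rowK coframeE; congr (_ * _ *: _).
by rewrite frame_f eqxx.
Qed.

Lemma coframe_eq0 x : (forall v, v \in V -> f x v = 0) -> x *m coframe_mx = 0.
Proof.
move=> h; apply/rowP => i; rewrite coframeE h ?mulr0 ?mxE //.
by apply/sV/mem_nth; rewrite size_cat.
Qed.

Lemma coframe_perp x v : x *m coframe_mx = 0 -> v \in V -> f x v = 0.
Proof.
move=> hx /frame_proj <-; rewrite pseudo_innerC frame_adjoint hx.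
exact: (linear0 (linear_of (pseudo_inner_linear _))).
Qed.
End Frame.
End Frames.

Section OrthogonalSplitting.
Variables (R : realType) (p q : nat).
Local Notation E := 'rV[R]_(p + q).
Local Notation f := (@pseudo_inner R p q).

(** Sylvester's argument: a combination of positive frame vectors has positive
    square unless it is zero, and a vector without positive coordinates has
    non-positive square.  So the positive span embeds in the positive
    coordinates, and likewise for the negative ones. *)
Lemma inertia p1 q1 p2 q2 (P1 : 'M[R]_(p1 + q1, p + q)) (P2 : 'M[R]_(p2 + q2, p + q)) :
  (forall x1 y1 x2 y2, f (x1 *m P1 + x2 *m P2) (y1 *m P1 + y2 *m P2) =
     pseudo_inner x1 y1 + pseudo_inner x2 y2) ->
  (p1 + p2 <= p)%N /\ (q1 + q2 <= q)%N.
Proof.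
move=> iso.
have sq0 m (u v : R) : 0 <= u -> 0 <= v -> 0 <= m -> u + v = - m -> u = 0 /\ v = 0.
  by move=> *; split; lra.
have sqnorm0 d : sqnorm (0 : 'rV[R]_d) = 0.
  by apply: big1 => i _; rewrite mxE expr0n.
split.
- pose F (c : 'rV[R]_(p1 + p2)) : E :=
    row_mx (lsubmx c) 0 *m P1 + row_mx (rsubmx c) 0 *m P2.
  have Flin : linear (fun c => lsubmx (F c)).
    move=> k c c'; rewrite -linearP; congr lsubmx; rewrite /F.
    have e d1 d2 (y y' : 'rV[R]_d1) : row_mx (k *: y + y') (0 : 'rV_d2) =
        k *: row_mx y 0 + row_mx y' 0.
      by rewrite scale_row_mx add_row_mx scaler0 addr0.
    by rewrite !linearP !e !mulmxDl -!scalemxAl scalerDr addrACA.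
  apply: (injective_dim Flin) => c hc.
  have := iso (row_mx (lsubmx c) 0) (row_mx (lsubmx c) 0) (row_mx (rsubmx c) 0) (row_mx (rsubmx c) 0).
  rewrite -/(F c) !pseudo_inner_sq hc !row_mxKl !row_mxKr !sqnorm0 !subr0 sub0r => e.
  have [/sqnorm_eq0 h1 /sqnorm_eq0 h2] :=
    sq0 _ _ _ (sqnorm_ge0 _) (sqnorm_ge0 _) (sqnorm_ge0 _) (esym e).
  by rewrite -[c]hsubmxK h1 h2 row_mx0.
- pose F (c : 'rV[R]_(q1 + q2)) : E :=
    row_mx 0 (lsubmx c) *m P1 + row_mx 0 (rsubmx c) *m P2.
  have Flin : linear (fun c => rsubmx (F c)).
    move=> k c c'; rewrite -linearP; congr rsubmx; rewrite /F.
    have e d1 d2 (y y' : 'rV[R]_d1) : row_mx (0 : 'rV_d2) (k *: y + y') =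
        k *: row_mx 0 y + row_mx 0 y'.
      by rewrite scale_row_mx add_row_mx scaler0 addr0.
    by rewrite !linearP !e !mulmxDl -!scalemxAl scalerDr addrACA.
  apply: (injective_dim Flin) => c hc.
  have := iso (row_mx 0 (lsubmx c)) (row_mx 0 (lsubmx c)) (row_mx 0 (rsubmx c)) (row_mx 0 (rsubmx c)).
  rewrite -/(F c) !pseudo_inner_sq hc !row_mxKl !row_mxKr !sqnorm0 !sub0r subr0 -opprD => e.
  have [/sqnorm_eq0 h1 /sqnorm_eq0 h2] :=
    sq0 _ _ _ (sqnorm_ge0 _) (sqnorm_ge0 _) (sqnorm_ge0 _) (canRL (@opprK _) (esym e)).
  by rewrite -[c]hsubmxK h1 h2 row_mx0.
Qed.

(** Take orthonormal frames of V and of its orthogonal complement; inertia,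
    together with the count of dimensions, gives the signatures. *)
Lemma orthogonal_splitting (V : {vspace E}) :
  (forall x, x \in V -> (forall y, y \in V -> f x y = 0) -> x = 0) ->
  V != 0%VS -> V != fullv ->
  exists p1 q1 p2 q2 (P1 : 'M[R]_(p1 + q1, p + q)) (P2 : 'M[R]_(p2 + q2, p + q))
     (Q1 : 'M[R]_(p + q, p1 + q1)) (Q2 : 'M[R]_(p + q, p2 + q2)),
  [/\ (p1 + p2 = p)%N, (q1 + q2 = q)%N, (0 < p1 + q1)%N & (0 < p2 + q2)%N] /\
  (forall x1 y1 x2 y2, f (x1 *m P1 + x2 *m P2) (y1 *m P1 + y2 *m P2) =
     pseudo_inner x1 y1 + pseudo_inner x2 y2) /\
  [/\ P1 *m Q1 = 1%:M, P2 *m Q2 = 1%:M, P1 *m Q2 = 0, P2 *m Q1 = 0 &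
     Q1 *m P1 + Q2 *m P2 = 1%:M] /\
  (forall x, (forall v, v \in V -> f x v = 0) -> x *m Q1 = 0) /\
  (forall x, x \in V -> x *m Q2 = 0).
Proof.
move=> Vnd V0 Vfull.
have [s1 [s2 [sON sdim sV sexp]]] := ortho_basis (@pseudo_innerC R p q) (@pseudo_inner_linear R p q) Vnd.
pose P1 := frame_mx s1 s2; pose Q1 := coframe_mx s1 s2.
pose W := lker (linfun (mulmxr_lin Q1)).
have WP x : (x \in W) = (x *m Q1 == 0) by rewrite memv_ker lfunE.
have VW x v : x \in W -> v \in V -> f x v = 0.
  by rewrite WP => /eqP; apply: (coframe_perp sON sexp).
have P1Q1 : P1 *m Q1 = 1%:M by exact: frameK.
have projW x : x - x *m Q1 *m P1 \in W.
  by rewrite WP mulmxBl -!mulmxA P1Q1 mulmx1 subrr.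
have fD x y z : f x (y + z) = f x y + f x z.
  exact: (linearD (linear_of (pseudo_inner_linear x))).
have Wnd x : x \in W -> (forall y, y \in W -> f x y = 0) -> x = 0.
  move=> xW h; apply: pseudo_inner_nondeg => y.
  rewrite -[y](subrK (y *m Q1 *m P1)) fD h // (VW _ _ xW) ?addr0 //.
  exact: frame_mem.
have [t1 [t2 [tON tdim tW texp]]] := ortho_basis (@pseudo_innerC R p q) (@pseudo_inner_linear R p q) Wnd.
pose P2 := frame_mx t1 t2; pose Q2 := coframe_mx t1 t2.
have P2Q2 : P2 *m Q2 = 1%:M by exact: frameK.
have VQ2 x : x \in V -> x *m Q2 = 0.
  by move=> xV; apply: (coframe_eq0 tW) => w wW; rewrite pseudo_innerC VW.
have WQ1 x : (forall v, v \in V -> f x v = 0) -> x *m Q1 = 0 by exact: coframe_eq0.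
have row0 d1 d2 (A : 'M[R]_(d1, d2)) : (forall u : 'rV_d1, u *m A = 0) -> A = 0.
  by move=> h; apply/row_matrixP => i; rewrite rowE h row0.
have P1Q2 : P1 *m Q2 = 0.
  by apply: row0 => u; rewrite mulmxA; apply/VQ2/frame_mem.
have P2Q1 : P2 *m Q1 = 0.
  by apply: row0 => u; rewrite mulmxA; apply/eqP; rewrite -WP; exact: frame_mem.
have QP (x : E) : x *m Q1 *m P1 + x *m Q2 *m P2 = x.
  have -> : x *m Q2 = (x - x *m Q1 *m P1) *m Q2.
    by rewrite mulmxBl -[x *m Q1 *m P1 *m Q2]mulmxA P1Q2 mulmx0 subr0.
  by rewrite (frame_proj tON texp (projW x)) addrC subrK.
have QP1 : Q1 *m P1 + Q2 *m P2 = 1%:M.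
  apply/eqP; rewrite -subr_eq0; apply/eqP/row0 => u.
  by rewrite mulmxBr mulmxDr !mulmxA QP mulmx1 subrr.
have iso x1 y1 x2 y2 : f (x1 *m P1 + x2 *m P2) (y1 *m P1 + y2 *m P2) =
    pseudo_inner x1 y1 + pseudo_inner x2 y2.
  rewrite pseudo_innerDl !frame_adjoint -/Q1 -/Q2.
  by rewrite (prodQ1 P1Q1 P2Q1) (prodQ2 P2Q2 P1Q2).
have dimVW : (\dim V + \dim W = p + q)%N.
  transitivity (\dim (fullv : {vspace E})); last by rewrite dimvf /dim /= mul1n.
  have -> : fullv = (V + W)%VS.
    apply/esym/eqP; rewrite eqEsubv subvf /=; apply/subvP => x _.
    rewrite -[x](subrK (x *m Q1 *m P1)) addrC memv_add //; exact: frame_mem.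
  rewrite dimv_disjoint_sum //; apply/eqP; rewrite -subv0; apply/subvP => x.
  rewrite memv_cap memv0 => /andP[xV xW]; apply/eqP/Vnd => // y yV.
  exact: VW.
have [le1 le2] := inertia iso.
have V1 : (0 < \dim V)%N by rewrite lt0n dimv_eq0.
have W1 : (0 < \dim W)%N.
  rewrite lt0n; apply: contra Vfull => /eqP dW.
  have Vd : \dim V = (p + q)%N by move: dimVW; rewrite dW addn0.
  by rewrite eqEdim subvf /= Vd dimvf /dim /= mul1n.
rewrite -sdim in dimVW V1; rewrite -tdim in dimVW W1.
exists (size s1), (size s2), (size t1), (size t2), P1, P2, Q1, Q2.
split; last by [].
have nat_eq a b c d u v : (a + b + (c + d) = u + v)%N -> (a + c <= u)%N ->
    (b + d <= v)%N -> (a + c = u)%N /\ (b + d = v)%N.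
  rewrite addnACA => e le_u le_v.
  have e1 : (a + c = u)%N.
    by apply/eqP; rewrite eqn_leq le_u -(leq_add2r v) -e leq_add2l.
  by split=> //; move/eqP: e; rewrite e1 eqn_add2l => /eqP.
by have [e1 e2] := nat_eq _ _ _ _ _ _ dimVW le1 le2.
Qed.
End OrthogonalSplitting.

Section ProductDecomposition.
Variables (R : realType) (p q p1 q1 p2 q2 : nat).
Variables (P1 : 'M[R]_(p1 + q1, p + q)) (P2 : 'M[R]_(p2 + q2, p + q))
  (Q1 : 'M[R]_(p + q, p1 + q1)) (Q2 : 'M[R]_(p + q, p2 + q2)).
Hypotheses (P1Q1 : P1 *m Q1 = 1%:M) (P2Q2 : P2 *m Q2 = 1%:M)
  (P1Q2 : P1 *m Q2 = 0) (P2Q1 : P2 *m Q1 = 0) (QP : Q1 *m P1 + Q2 *m P2 = 1%:M)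
  (iso : forall x1 y1 x2 y2,
    pseudo_inner (x1 *m P1 + x2 *m P2) (y1 *m P1 + y2 *m P2) =
    pseudo_inner x1 y1 + pseudo_inner x2 y2).

Lemma tangent0 N (M : set 'rV[R]_N) x : M x -> tangent M x 0.
Proof.
move=> Mx; exists setT, (cst x); split; split=> //; first exact: openT.
  by move=> k; exact: Ck_on_cst.
by rewrite derive1E derive_cst.
Qed.

Lemma factor_nondegenerate n1 (M1 : set 'rV[R]_(p1 + q1)) (M2 : set 'rV[R]_(p2 + q2)) b n :
  submanifold n1 M1 -> M2 b ->
  nondegenerate_submanifold n
    [set z | exists x1 x2, [/\ M1 x1, M2 x2 & z = x1 *m P1 + x2 *m P2]] ->
  nondegenerate_submanifold n1 M1.
Proof.
move=> sM1 M2b [_ nd]; split=> // x u M1x tu nu.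
have Q1E := prodQ1 P1Q1 P2Q1; have Q2E := prodQ2 P2Q2 P1Q2.
have tP := tangent_prod P1Q1 P2Q2 P1Q2 P2Q1 QP M1 M2.
suff e : u *m P1 + 0 *m P2 = 0.
  by rewrite -[u](Q1E u (0 : 'rV_(p2 + q2))) e mul0mx.
apply: (nd (x *m P1 + b *m P2)); first by exists x, b.
  by apply/tP; rewrite !Q1E !Q2E; split=> //; apply: tangent0.
move=> v /tP; rewrite Q1E Q2E => -[t1 _].
rewrite -(prodE QP v) iso (nu _ t1) add0r pseudo_innerC.
exact: (linear0 (linear_of (pseudo_inner_linear _))).
Qed.
End ProductDecomposition.

(** The closure hypothesis says that M is the product of its two
    projections. *)
Lemma product_decomposable (R : realType) (p q p1 q1 p2 q2 n : nat) (M : set 'rV[R]_(p + q))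
  (P1 : 'M[R]_(p1 + q1, p + q)) (P2 : 'M[R]_(p2 + q2, p + q))
  (Q1 : 'M[R]_(p + q, p1 + q1)) (Q2 : 'M[R]_(p + q, p2 + q2)) :
  [/\ (p1 + p2 = p)%N, (q1 + q2 = q)%N, (0 < p1 + q1)%N & (0 < p2 + q2)%N] ->
  (forall x1 y1 x2 y2,
    pseudo_inner (x1 *m P1 + x2 *m P2) (y1 *m P1 + y2 *m P2) =
    pseudo_inner x1 y1 + pseudo_inner x2 y2) ->
  [/\ P1 *m Q1 = 1%:M, P2 *m Q2 = 1%:M, P1 *m Q2 = 0, P2 *m Q1 = 0 &
     Q1 *m P1 + Q2 *m P2 = 1%:M] ->
  nondegenerate_submanifold n M -> M !=set0 ->
  (forall z z', M z -> M z' -> M (z *m Q1 *m P1 + z' *m Q2 *m P2)) ->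
  decomposable M.
Proof.
move=> dims iso [P1Q1 P2Q2 P1Q2 P2Q1 QP] M_nd [c Mc] mix.
pose M1 : set 'rV[R]_(p1 + q1) := [set z *m Q1 | z in M].
pose M2 : set 'rV[R]_(p2 + q2) := [set z *m Q2 | z in M].
have ME : M = [set z | exists x1 x2, [/\ M1 x1, M2 x2 & z = x1 *m P1 + x2 *m P2]].
  apply/seteqP; split=> [z Mz|_ [_ [_ [[z Mz <-] [z' Mz' <-] ->]]]]; last exact: mix.
  by exists (z *m Q1), (z *m Q2); split; [exists z|exists z|rewrite (prodE QP)].
have M1c : M1 (c *m Q1) by exists c.
have M2c : M2 (c *m Q2) by exists c.
have [n1 [n2 [sM1 sM2]]] :
    exists n1 n2, submanifold n1 M1 /\ submanifold n2 M2.
  apply: (factors_submanifold P1Q1 P2Q2 P1Q2 P2Q1 QP M1c M2c (n := n)).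
  by rewrite -ME; case: M_nd.
exists p1, q1, p2, q2, n1, n2, P1, P2, M1, M2; split=> //; split=> //; split=> //.
  by apply: (factor_nondegenerate P1Q1 P2Q2 P1Q2 P2Q1 QP iso sM1 M2c (n := n)); rewrite -ME.
have QP' : Q2 *m P2 + Q1 *m P1 = 1%:M by rewrite addrC.
have iso' x1 y1 x2 y2 : pseudo_inner (x1 *m P2 + x2 *m P1) (y1 *m P2 + y2 *m P1) =
    pseudo_inner x1 y1 + pseudo_inner x2 y2.
  by rewrite ![_ *m P2 + _]addrC iso addrC.
apply: (factor_nondegenerate P2Q2 P1Q1 P2Q1 P1Q2 QP' iso' sM2 M1c (n := n)).
rewrite (_ : [set z | _] = M) // {1}ME.
by apply/seteqP; split=> _ [x1 [x2 [h1 h2 ->]]]; exists x2, x1; split=> //; rewrite addrC.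
Qed.

(** * Indecomposable orbits *)
Section Indecomposable.
Variables (R : realType) (p q n : nat) (M : set 'rV[R]_(p + q)) (g : vectType R)
  (br : lieAlgebra g) (ip : {bilinear g -> g -> R^o}) (D theta : 'End(g)).
Hypothesis tri : weak_extrinsic_symmetric_triple br ip D theta.
Hypothesis full : full_triple br D theta.
Hypothesis M_nd : nondegenerate_submanifold n M.
Hypothesis M_indec : indecomposable M.
Variables (x0 : 'rV[R]_(p + q)) (J : 'Hom(g, 'rV[R]_(p + q))).
Hypotheses (J0 : forall u, u \in g_m theta -> J u = 0 -> u = 0)
  (Jip : forall u v, u \in g_m theta -> v \in g_m theta -> pseudo_inner (J u) (J v) = ip u v)
  (ME : M = [set x0 + J y | y in orbit_of_0 br D theta]).
Local Notation T := (g_m_tm D theta).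
Local Opaque lfun_exp exp_phi aff_gen.

Lemma ip_g_p_m x y : theta x = x -> y \in g_m theta -> ip x y = 0.
Proof. by rewrite mem_g_m => hx /eqP; apply: (ip_perp_th tri). Qed.

Lemma g_p_m_dec x : exists a b, [/\ theta a = a, b \in g_m theta & x = a + b].
Proof.
have [xT [xm [xk [xN [[hT hm hk hN] ->]]]]] := g_dec tri x.
exists (xm + xk), (xT + xN); split; last by rewrite [xT + xm]addrC addrACA.
  rewrite linearD /=; move: hm hk; rewrite (memm tri) (memk tri).
  by move=> /andP[/eqP -> _] /andP[/eqP -> _].
by apply: memvD; [exact: T_sub_m hT|exact: N_sub_m hN].
Qed.

(** Otherwise the non-zero non-degenerate subspace V = J (E g_-) would be
    proper, and by orbit_split M would decompose along V and its orthogonal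
    complement. *)
Lemma indecomposable_projector E : splitting_projector br ip D theta E ->
  forall u, u \in T -> E u = u.
Proof.
move=> hE; have [EE ED Eth Eb Ebl Esym Ecent [u0 u0T Eu0] _] := hE.
have Em u : u \in g_m theta -> E u \in g_m theta.
  by rewrite !mem_g_m -Eth => /eqP ->; rewrite linearN.
pose V := (J @: (E @: g_m theta))%VS.
have VP v : v \in V -> exists2 w, w \in g_m theta & v = J (E w).
  by move=> /memv_imgP[_ /memv_imgP[w hw ->] ->]; exists w.
have VE w : w \in g_m theta -> J (E w) \in V by move=> hw; do 2!apply: memv_img.
have EF w z : ip (E w) (z - E z) = 0 by rewrite Esym linearB /= EE subrr ip0r.
have Vnd v : v \in V -> (forall v', v' \in V -> pseudo_inner v v' = 0) -> v = 0.
  move=> /VP[w hw ->] h; suff -> : E w = 0 by rewrite linear0.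
  rewrite -EE; apply: Ecent; apply: (ip_radical_central tri full) => z.
  have [a [b [tha hb ->]]] := g_p_m_dec z.
  rewrite ipDr (ipC tri) (ip_g_p_m tha (Em _ hw)) add0r -EE Esym.
  by rewrite -(Jip (Em _ hw) (Em _ hb)) h // VE.
have [/eqP V0|V0] := boolP (V == 0%VS).
  case: Eu0; have um := T_sub_m u0T; apply: (J0 (Em _ um)).
  by have := VE _ um; rewrite V0 memv0 => /eqP.
have [/eqP Vfull|Vfull] := boolP (V == fullv).
  move=> u /T_sub_m um; have := memvf (J u); rewrite -Vfull => /VP[w hw JuE].
  suff -> : u = E w by rewrite EE.
  apply/eqP; rewrite -subr_eq0; apply/eqP/J0.
    by apply: memvB => //; apply: Em.
  by rewrite linearB /= JuE subrr.
have [p1 [q1 [p2 [q2 [P1 [P2 [Q1 [Q2 [dims [iso [PQ [Q1V Q2V]]]]]]]]]]]] :=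
  orthogonal_splitting Vnd V0 Vfull.
case: M_indec; apply: (product_decomposable dims iso PQ M_nd); first by exists x0; exact: M_base ME.
have [_ _ _ _ QP] := PQ.
rewrite ME => _ _ [y hy <-] [y' hy' <-].
have ym := orbit_m tri hy; have ym' := orbit_m tri hy'.
exists (E y + (y' - E y')); first exact: (orbit_split EE ED Eth Eb Ebl hy hy').
have JQ1 w : w \in g_m theta -> J (w - E w) *m Q1 = 0.
  move=> hw; apply: Q1V => _ /VP[w' hw' ->].
  have hm : w - E w \in g_m theta by apply: memvB (Em _ hw).
  by rewrite (Jip hm (Em _ hw')) (ipC tri) (EF w' w).
have JQ2 w : w \in g_m theta -> J (E w) *m Q2 = 0 by move=> hw; exact/Q2V/VE.
have JE w : J w = J (E w) + J (w - E w) by rewrite -linearD /= addrC subrK.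
rewrite [RHS](_ : _ = (x0 + J (E y + (y' - E y'))) *m (Q1 *m P1 + Q2 *m P2)); first by rewrite QP mulmx1.
have e1 : J (E y + (y' - E y')) = J (E y) + J (y' - E y') by exact: linearD.
have q1E : J y *m Q1 = J (E y) *m Q1 by rewrite (JE y) mulmxDl (JQ1 _ ym) addr0.
have q2E : J y' *m Q2 = J (y' - E y') *m Q2 by rewrite {1}(JE y') mulmxDl (JQ2 _ ym') add0r.
rewrite mulmxDr !mulmxA !mulmxDl e1 !mulmxDl q1E q2E (JQ1 _ ym') (JQ2 _ ym).
by rewrite !mul0mx addr0 add0r.
Qed.
End Indecomposable.

Theorem theorem1 (R : realType) (p q n : nat) (n_ge1 : (1 <= n)%N)
    (M : set 'rV[R]_(p + q))
    (M_sym : extrinsic_symmetric n M) (M_indec : indecomposable M)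
    (alpha A : 'rV[R]_(p + q) -> 'rV[R]_(p + q) -> 'rV[R]_(p + q) ->
               'rV[R]_(p + q))
    (h : 'rV[R]_(p + q) -> 'rV[R]_(p + q))
    (alpha_sff : second_fundamental_form M alpha)
    (A_shape : shape_operator M alpha A)
    (h_mean : mean_curvature n M alpha h)
    (g : vectType R) (br : lieAlgebra g) (ip : {bilinear g -> g -> R^o})
    (D theta : 'End(g))
    (triple : weak_extrinsic_symmetric_triple br ip D theta)
    (triple_full : full_triple br D theta)
    (x0 : 'rV[R]_(p + q)) (x0_in_M : M x0)
    (triple_assoc : associated_triple M x0 br ip D theta) :
  forall x, M x ->
    ((exists2 u, tangent M x u & A x (h x) (A x (h x) u) <> 0) <->
     lie_semisimple br).
Proof.
move=> x Mx; have [_ M_nd _] := M_sym.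
have [J [J0 _ Jip ME]] := associated_triple_base triple triple_assoc Mx.
have TP := tangent_T triple triple_full M_nd J0 Jip ME.
have [e [eT e_exp hE]] := tangent_frame triple triple_full M_nd J0 Jip ME alpha_sff h_mean.
have AE := shape_mean triple triple_full M_nd J0 Jip ME alpha_sff A_shape eT hE.
set H := mean_vector br ip D e in AE.
have HD u : u \in g_m_tm D theta -> br H (D u) \in g_m_tm D theta.
  move=> uT; apply: (br_Nm triple); first exact: (mean_vectorN triple eT).
  exact: (DT triple).
have AAE u : u \in g_m_tm D theta -> A x (h x) (A x (h x) (J u)) =
    (n%:R^-1 * n%:R^-1) *: J (br H (D (br H (D u)))).
  move=> uT; rewrite (AE _ uT) -linearZ /= (AE _ (memvZ _ (HD _ uT))).
  by rewrite linearZ /= brZr linearZ /= scalerA.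
split=> [[u /TP[v vT ->]]|ss].
  rewrite AAE // => AA.
  have [E hE'] : exists E, splitting_projector br ip D theta E.
    apply: (splitting triple triple_full eT e_exp); exists v => //.
    by move=> h0; apply: AA; rewrite -/H in h0; rewrite h0 linear0 scaler0.
  apply: (E_full hE').
  exact: (indecomposable_projector triple triple_full M_nd M_indec J0 Jip ME hE').
have T0 : (g_m_tm D theta != 0)%VS.
  by move: n_ge1; rewrite lt0n -(dim_T triple triple_full M_nd J0 Jip ME) dimv_eq0.
pose u := vpick (g_m_tm D theta).
have uT : u \in g_m_tm D theta by exact: memv_pick.
have u0 : u != 0 by rewrite vpick0.
exists (J u); first by apply/TP; exists u.
rewrite AAE // => /eqP; rewrite scaler_eq0 mulf_eq0 orbb invr_eq0 pnatr_eq0 eqn0Ngt n_ge1 /=.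
have inj := shape_injective triple eT e_exp ss.
move=> /eqP /(J0 _ (T_sub_m (HD _ (HD _ uT)))) /(inj _ (HD _ uT)) /(inj _ uT) u00.
by rewrite u00 eqxx in u0.
Qed.
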